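(* The non-commutative Weil algebra $\mathcal{W}_G=U(\mathfrak{g})\otimes\mathrm{Cl}(\mathfrak{g})$, equipped with the derivations $$\iota_a=\mathrm{ad}(x_a),\qquad L_a=\mathrm{ad}(u_a+g_a),\qquad \mathrm{d}=\mathrm{ad}(\mathfrak{D}),$$ is a filtered $G$-differential algebra, with associated graded $G$-differential algebra equal to the standard Weil algebra $W_G$ (identifying $\mathfrak{g}^*\cong\mathfrak{g}$).
   Context: $G$ is a compact connected Lie group with Lie algebra $\mathfrak{g}$, equipped with an invariant inner product used to identify $\mathfrak{g}\cong\mathfrak{g}^*$. $(e_a)$ is an orthonormal basis, $[e_a,e_b]=f_{abc}e_c$; repeated indices are summed. Everything is over $\mathbb{R}$; commutators, derivations, tensor products are $\mathbb{Z}_2$-graded; $\mathrm{ad}(b)c=[b,c]$. A $G$-differential algebra is a super-algebra $B$ with odd derivations $\iota_a$, even derivations $L_a$, and an odd derivation $\mathrm{d}$ satisfying $[L_a,\iota_b]=f_{abc}\iota_c$, $[L_a,L_b]=f_{abc}L_c$, $[\iota_a,\mathrm{d}]=L_a$, $[\iota_a,\iota_b]=0$, $[L_a,\mathrm{d}]=0$, $[\mathrm{d},\mathrm{d}]=0$. It is graded (filtered) if $B$ is a graded (filtered) super-algebra and $\iota_a,L_a,\mathrm{d}$ have degree (filtration degree) $-1,0,1$ respectively; here a filtered super-algebra is required to have its filtration preserved by the parity operator and its associated graded algebra to have parity $(-1)^k$ in degree $k$. The associated graded of a filtered $G$-differential algebra is a graded $G$-differential algebra. $u_a$ are the generators of $U(\mathfrak{g})$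 corresponding to $e_a$; $\mathrm{Cl}(\mathfrak{g})$ is the Clifford algebra with generators $x_a$ and relations $x_ax_b+x_bx_a=\delta_{ab}$. With the natural filtrations $U^{(k)}(\mathfrak{g})$, $\mathrm{Cl}^{(j)}(\mathfrak{g})$, $\mathcal{W}_G$ is filtered by $\mathcal{W}_G^{(l)}=\sum_{j+2k= l}U^{(k)}(\mathfrak{g})\otimes\mathrm{Cl}^{(j)}(\mathfrak{g})$, so $u_a$ has degree 2 and $x_a$ degree 1. $g_a=-\frac12f_{ars}x_rx_s$, $\gamma=-\frac16f_{abc}x_ax_bx_c$, $\mathfrak{D}=x_au_a+\gamma$. The standard Weil algebra is $W_G=S\mathfrak{g}^*\otimes\wedge\mathfrak{g}^*$, with generators $v^a\in S^1\mathfrak{g}^*$ of degree 2 and $y^a\in\wedge^1\mathfrak{g}^*$ of degree 1 corresponding to the dual basis; $\iota_a$ is the derivation with $\iota_ay^b=\delta_a^b$, $\iota_av^b=0$; $L_a$ is the Lie derivative of the coadjoint action ($L_ay^c=-f_{ab}^cy^b$, $L_av^c=-f_{ab}^cv^b$); and $\mathrm{d}$ is the derivation with $\mathrm{d}y^a=v^a-\frac12f^a_{jk}y^jy^k$, $\mathrm{d}v^a=-f^a_{jk}y^jv^k$, where $f^c_{ab}=f_{abc}$. *)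

(* Defs.v *)
From HB Require Import structures.
From mathcomp Require Import all_boot all_order all_algebra.
From mathcomp Require Import boolp classical_sets.

Set Implicit Arguments.
Unset Strict Implicit.
Unset Printing Implicit Defensive.

Import Order.TTheory GRing.Theory Num.Theory.

Local Open Scope ring_scope.
Local Open Scope classical_set_scope.

(* Associative unital algebras.  The library's [algType] demands 1 != 0, which
   is not known a priori for algebras given by generators and relations. *)
Record pzAlgType (R : pzRingType) := PzAlg {
  pza_ring : pzRingType;
  pza_scale : R -> pza_ring -> pza_ring;
  pza_scaleA : forall a b x, pza_scale a (pza_scale b x) = pza_scale (a * b) x;
  pza_scale1 : left_id 1 pza_scale;
  pza_scaleDr : right_distributive pza_scale +%R;
  pza_scaleDl : forall x, {morph pza_scale^~ x : a b / a + b};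
  pza_scaleAl : forall a (x y : pza_ring), pza_scale a (x * y) = pza_scale a x * y;
  pza_scaleAr : forall a (x y : pza_ring), pza_scale a (x * y) = x * pza_scale a y
}.

Section PzAlgTheory.
Variables (R : pzRingType) (A : pzAlgType R).

Definition pza_sort : Type := pza_ring A.
HB.instance Definition _ := GRing.PzRing.on pza_sort.
HB.instance Definition _ := GRing.Zmodule_isLmodule.Build R pza_sort
  (@pza_scaleA _ A) (@pza_scale1 _ A) (@pza_scaleDr _ A) (@pza_scaleDl _ A).

Lemma pzscalerAl a (x y : pza_sort) : a *: (x * y) = (a *: x) * y.
Proof. exact: pza_scaleAl. Qed.
Lemma pzscalerAr a (x y : pza_sort) : a *: (x * y) = x * (a *: y).
Proof. exact: pza_scaleAr. Qed.

End PzAlgTheory.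
Coercion pza_sort : pzAlgType >-> Sortclass.

(* A type with algebra operations obeying the algebra axioms up to a
   congruence; its quotient is an algebra. *)
Record setoidAlg (R : pzRingType) := SetoidAlg {
  sa_sort : Type;
  sa_eq : sa_sort -> sa_sort -> Prop;
  sa0 : sa_sort;
  sa1 : sa_sort;
  saD : sa_sort -> sa_sort -> sa_sort;
  saN : sa_sort -> sa_sort;
  saM : sa_sort -> sa_sort -> sa_sort;
  saZ : R -> sa_sort -> sa_sort;
  sa_refl : forall s, sa_eq s s;
  sa_sym : forall s t, sa_eq s t -> sa_eq t s;
  sa_trans : forall t s u, sa_eq s t -> sa_eq t u -> sa_eq s u;
  saD_cong : forall s s' t t',
    sa_eq s s' -> sa_eq t t' -> sa_eq (saD s t) (saD s' t');
  saN_cong : forall s s', sa_eq s s' -> sa_eq (saN s) (saN s');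
  saM_cong : forall s s' t t',
    sa_eq s s' -> sa_eq t t' -> sa_eq (saM s t) (saM s' t');
  saZ_cong : forall a s s', sa_eq s s' -> sa_eq (saZ a s) (saZ a s');
  saDA : forall s t u, sa_eq (saD s (saD t u)) (saD (saD s t) u);
  saDC : forall s t, sa_eq (saD s t) (saD t s);
  sa0D : forall s, sa_eq (saD sa0 s) s;
  saND : forall s, sa_eq (saD (saN s) s) sa0;
  saMA : forall s t u, sa_eq (saM s (saM t u)) (saM (saM s t) u);
  sa1M : forall s, sa_eq (saM sa1 s) s;
  saM1 : forall s, sa_eq (saM s sa1) s;
  saMDl : forall s t u, sa_eq (saM (saD s t) u) (saD (saM s u) (saM t u));
  saMDr : forall s t u, sa_eq (saM s (saD t u)) (saD (saM s t) (saM s u));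
  saZA : forall a b s, sa_eq (saZ a (saZ b s)) (saZ (a * b) s);
  sa1Z : forall s, sa_eq (saZ 1 s) s;
  saZDr : forall a s t, sa_eq (saZ a (saD s t)) (saD (saZ a s) (saZ a t));
  saZDl : forall a b s, sa_eq (saZ (a + b) s) (saD (saZ a s) (saZ b s));
  saZAl : forall a s t, sa_eq (saZ a (saM s t)) (saM (saZ a s) t);
  saZAr : forall a s t, sa_eq (saZ a (saM s t)) (saM s (saZ a t))
}.

Section SetoidQuotient.
Variables (R : pzRingType) (S : setoidAlg R).
Implicit Types s t : sa_sort S.

Definition sa_carrier : Type := sa_sort S.
HB.instance Definition _ := gen_eqMixin sa_carrier.
HB.instance Definition _ := gen_choiceMixin sa_carrier.

Definition sa_rel : rel sa_carrier := fun s t => `[< sa_eq s t >].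

Lemma sa_rel_equiv : equiv_class_of sa_rel.
Proof.
split=> [s|s t|t s u]; first by apply/asboolP; apply: sa_refl.
  by apply/asboolP/asboolP; apply: sa_sym.
by move=> /asboolP st /asboolP tu; apply/asboolP/(sa_trans st tu).
Qed.

Canonical sa_equiv_rel := EquivRelPack sa_rel_equiv.

Definition sa_quot : Type := {eq_quot sa_equiv_rel}%qT.
HB.instance Definition _ := Choice.on sa_quot.

Definition sa_pi (s : sa_sort S) : sa_quot := (\pi_sa_quot (s : sa_carrier))%qT.
Definition sa_repr (x : sa_quot) : sa_sort S := (repr x : sa_carrier).

Lemma sa_reprK : cancel sa_repr sa_pi.
Proof. by move=> x; rewrite /sa_pi /sa_repr reprK. Qed.

Lemma sa_piP s t : sa_pi s = sa_pi t <-> sa_eq s t.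
Proof.
rewrite /sa_pi; split=> [/eqmodP/asboolP//|st].
by apply/eqmodP/asboolP.
Qed.

Lemma sa_repr_pi s : sa_eq (sa_repr (sa_pi s)) s.
Proof. by apply/sa_piP; rewrite sa_reprK. Qed.

Lemma sa_quotP (P : sa_quot -> Prop) : (forall s, P (sa_pi s)) -> forall x, P x.
Proof. by move=> h x; rewrite -(sa_reprK x). Qed.

Definition saq_add (x y : sa_quot) := sa_pi (saD (sa_repr x) (sa_repr y)).
Definition saq_opp (x : sa_quot) := sa_pi (saN (sa_repr x)).
Definition saq_mul (x y : sa_quot) := sa_pi (saM (sa_repr x) (sa_repr y)).
Definition saq_scale a (x : sa_quot) := sa_pi (saZ a (sa_repr x)).

Lemma saq_addE s t : saq_add (sa_pi s) (sa_pi t) = sa_pi (saD s t).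
Proof. by apply/sa_piP; apply: saD_cong; apply: sa_repr_pi. Qed.
Lemma saq_oppE s : saq_opp (sa_pi s) = sa_pi (saN s).
Proof. by apply/sa_piP; apply: saN_cong; apply: sa_repr_pi. Qed.
Lemma saq_mulE s t : saq_mul (sa_pi s) (sa_pi t) = sa_pi (saM s t).
Proof. by apply/sa_piP; apply: saM_cong; apply: sa_repr_pi. Qed.
Lemma saq_scaleE a s : saq_scale a (sa_pi s) = sa_pi (saZ a s).
Proof. by apply/sa_piP; apply: saZ_cong; apply: sa_repr_pi. Qed.
Definition saqE := (saq_addE, saq_oppE, saq_mulE, saq_scaleE).

Lemma saq_addA : associative saq_add.
Proof.
elim/sa_quotP=> s; elim/sa_quotP=> t; elim/sa_quotP=> u.
by rewrite !saqE; apply/sa_piP/saDA.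
Qed.
Lemma saq_addC : commutative saq_add.
Proof. by elim/sa_quotP=> s; elim/sa_quotP=> t; rewrite !saqE; apply/sa_piP/saDC. Qed.
Lemma saq_add0 : left_id (sa_pi (sa0 S)) saq_add.
Proof. by elim/sa_quotP=> s; rewrite !saqE; apply/sa_piP/sa0D. Qed.
Lemma saq_addN : left_inverse (sa_pi (sa0 S)) saq_opp saq_add.
Proof. by elim/sa_quotP=> s; rewrite !saqE; apply/sa_piP/saND. Qed.
HB.instance Definition _ :=
  GRing.isZmodule.Build sa_quot saq_addA saq_addC saq_add0 saq_addN.

Lemma saq_mulA : associative saq_mul.
Proof.
elim/sa_quotP=> s; elim/sa_quotP=> t; elim/sa_quotP=> u.
by rewrite !saqE; apply/sa_piP/saMA.
Qed.
Lemma saq_mul1 : left_id (sa_pi (sa1 S)) saq_mul.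
Proof. by elim/sa_quotP=> s; rewrite !saqE; apply/sa_piP/sa1M. Qed.
Lemma saq_mulr1 : right_id (sa_pi (sa1 S)) saq_mul.
Proof. by elim/sa_quotP=> s; rewrite !saqE; apply/sa_piP/saM1. Qed.
Lemma saq_mulDl : left_distributive saq_mul +%R.
Proof.
elim/sa_quotP=> s; elim/sa_quotP=> t; elim/sa_quotP=> u.
by rewrite -[_ + _]/(saq_add _ _) -[RHS]/(saq_add _ _) !saqE; apply/sa_piP/saMDl.
Qed.
Lemma saq_mulDr : right_distributive saq_mul +%R.
Proof.
elim/sa_quotP=> s; elim/sa_quotP=> t; elim/sa_quotP=> u.
rewrite -[RHS]/(saq_add _ _) -[X in saq_mul _ X]/(saq_add _ _) !saqE.
exact/sa_piP/saMDr.
Qed.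
HB.instance Definition _ := GRing.Zmodule_isPzRing.Build sa_quot
  saq_mulA saq_mul1 saq_mulr1 saq_mulDl saq_mulDr.

Lemma saq_scaleA a b v : saq_scale a (saq_scale b v) = saq_scale (a * b) v.
Proof. by elim/sa_quotP: v => s; rewrite !saqE; apply/sa_piP/saZA. Qed.
Lemma saq_scale1 : left_id 1 saq_scale.
Proof. by elim/sa_quotP=> s; rewrite !saqE; apply/sa_piP/sa1Z. Qed.
Lemma saq_scaleDr : right_distributive saq_scale +%R.
Proof.
move=> a; elim/sa_quotP=> s; elim/sa_quotP=> t.
rewrite -[RHS]/(saq_add _ _) -[X in saq_scale _ X]/(saq_add _ _) !saqE.
exact/sa_piP/saZDr.
Qed.
Lemma saq_scaleDl v : {morph saq_scale^~ v : a b / a + b}.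
Proof.
move=> a b; elim/sa_quotP: v => s.
by rewrite -[RHS]/(saq_add _ _) !saqE; apply/sa_piP/saZDl.
Qed.
Lemma saq_scaleAl a (x y : sa_quot) : saq_scale a (x * y) = saq_scale a x * y.
Proof.
elim/sa_quotP: x => s; elim/sa_quotP: y => t.
rewrite -[LHS]/(saq_scale _ (saq_mul _ _)) -[RHS]/(saq_mul (saq_scale _ _) _).
by rewrite !saqE; apply/sa_piP/saZAl.
Qed.
Lemma saq_scaleAr a (x y : sa_quot) : saq_scale a (x * y) = x * saq_scale a y.
Proof.
elim/sa_quotP: x => s; elim/sa_quotP: y => t.
rewrite -[LHS]/(saq_scale _ (saq_mul _ _)) -[RHS]/(saq_mul _ (saq_scale _ _)).
by rewrite !saqE; apply/sa_piP/saZAr.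
Qed.

Definition sa_quotAlg : pzAlgType R :=
  @PzAlg R sa_quot saq_scale saq_scaleA saq_scale1 saq_scaleDr saq_scaleDl
    saq_scaleAl saq_scaleAr.

End SetoidQuotient.

(* The algebra presented by generators X and relations [s = t], for s and t
   algebra expressions in X with [Q s t]: expressions modulo the congruence
   generated by the algebra axioms and Q. *)
Inductive term (R X : Type) : Type :=
| TGen of X
| TZero
| TOne
| TAdd of term R X & term R X
| TMul of term R X & term R X
| TScale of R & term R X.
Arguments TGen {R X}.
Arguments TZero {R X}.
Arguments TOne {R X}.

Section Presented.
Variables (R : pzRingType) (X : Type) (Q : term R X -> term R X -> Prop).
Notation TOpp := (TScale (-1)).

Inductive teq : term R X -> term R X -> Prop :=
| teq_rel s t : Q s t -> teq s t
| teq_refl s : teq s s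
| teq_sym s t : teq s t -> teq t s
| teq_trans t s u : teq s t -> teq t u -> teq s u
| teqD s s' t t' : teq s s' -> teq t t' -> teq (TAdd s t) (TAdd s' t')
| teqM s s' t t' : teq s s' -> teq t t' -> teq (TMul s t) (TMul s' t')
| teqZ a s s' : teq s s' -> teq (TScale a s) (TScale a s')
| teqDA s t u : teq (TAdd s (TAdd t u)) (TAdd (TAdd s t) u)
| teqDC s t : teq (TAdd s t) (TAdd t s)
| teq0D s : teq (TAdd TZero s) s
| teqND s : teq (TAdd (TOpp s) s) TZero
| teqMA s t u : teq (TMul s (TMul t u)) (TMul (TMul s t) u)
| teq1M s : teq (TMul TOne s) s
| teqM1 s : teq (TMul s TOne) s
| teqMDl s t u : teq (TMul (TAdd s t) u) (TAdd (TMul s u) (TMul t u))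
| teqMDr s t u : teq (TMul s (TAdd t u)) (TAdd (TMul s t) (TMul s u))
| teqZA a b s : teq (TScale a (TScale b s)) (TScale (a * b) s)
| teq1Z s : teq (TScale 1 s) s
| teqZDr a s t : teq (TScale a (TAdd s t)) (TAdd (TScale a s) (TScale a t))
| teqZDl a b s : teq (TScale (a + b) s) (TAdd (TScale a s) (TScale b s))
| teqZAl a s t : teq (TScale a (TMul s t)) (TMul (TScale a s) t)
| teqZAr a s t : teq (TScale a (TMul s t)) (TMul s (TScale a t)).

Definition term_setoidAlg : setoidAlg R :=
  SetoidAlg teq_refl teq_sym teq_trans teqD (teqZ (-1)) teqM teqZ
    teqDA teqDC teq0D teqND teqMA teq1M teqM1 teqMDl teqMDr
    teqZA teq1Z teqZDr teqZDl teqZAl teqZAr.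

Definition presented : pzAlgType R := sa_quotAlg term_setoidAlg.

Definition pgen (x : X) : presented := sa_pi (TGen x : sa_sort term_setoidAlg).

Fixpoint teval (A : pzAlgType R) (f : X -> A) (t : term R X) : A :=
  match t with
  | TGen x => f x
  | TZero => 0
  | TOne => 1
  | TAdd s t => teval f s + teval f t
  | TMul s t => teval f s * teval f t
  | TScale a s => a *: teval f s
  end.

(* The algebra morphism extending f, provided f respects the relations. *)
Definition plift (A : pzAlgType R) (f : X -> A) (x : presented) : A :=
  teval f (sa_repr x).

Lemma presented_ind (P : presented -> Prop) :
  (forall x, P (pgen x)) -> P 0 -> P 1 ->
  (forall x y, P x -> P y -> P (x + y)) ->
  (forall x y, P x -> P y -> P (x * y)) ->
  (forall a x, P x -> P (a *: x)) -> forall x, P x.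
Proof.
move=> Pg P0 P1 PD PM PZ; elim/sa_quotP; elim=> //.
- by move=> s Ps t Pt; rewrite -[sa_pi _]saq_addE; apply: PD.
- by move=> s Ps t Pt; rewrite -[sa_pi _]saq_mulE; apply: PM.
- by move=> a s Ps; rewrite -[sa_pi _]saq_scaleE; apply: PZ.
Qed.

Lemma presented_rel s t : Q s t ->
  sa_pi (s : sa_sort term_setoidAlg) = sa_pi (t : sa_sort term_setoidAlg).
Proof. by move=> st; apply/sa_piP/teq_rel. Qed.

End Presented.

Section Span.
Variables (R : pzRingType) (V : lmodType R).

Definition submod (P : set V) : Prop :=
  P 0 /\ forall a x y, P x -> P y -> P (a *: x + y).

Definition span (S : set V) : set V :=
  [set x | forall P : set V, submod P -> S `<=` P -> P x].

Lemma span_submod S : submod (span S).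
Proof.
split=> [P [P0 _] _ //|a x y Sx Sy P sP SP].
by apply: (proj2 sP); [apply: Sx | apply: Sy].
Qed.

Lemma sub_span S : S `<=` span S.
Proof. by move=> x Sx P _; apply. Qed.

Lemma span_min S P : submod P -> S `<=` P -> span S `<=` P.
Proof. by move=> sP SP x; apply. Qed.

Lemma span_mono S T : S `<=` T -> span S `<=` span T.
Proof.
by move=> ST; apply: span_min; [exact: span_submod | move=> x /ST /sub_span].
Qed.

End Span.

Lemma span_mul (R : pzRingType) (A : pzAlgType R) (S T U : set A) :
  (forall x y, S x -> T y -> span U (x * y)) ->
  forall x y, span S x -> span T y -> span U (x * y).
Proof.
move=> h x y Sx Ty; have [U0 UD] := span_submod U.
apply: (Sx [set x | span U (x * y)]).
  by split=> [|a x1 x2 h1 h2] /=; rewrite ?mul0r// mulrDl -pzscalerAl; apply: UD.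
move=> x1 Sx1 /=; apply: (Ty [set y | span U (x1 * y)]).
  by split=> [|a y1 y2 h1 h2] /=; rewrite ?mulr0// mulrDr -pzscalerAr; apply: UD.
by move=> y1 Ty1 /=; apply: h.
Qed.

(* The quotient of the tensor algebra of V by relations Q. *)
Section TensorAlgebraQuotient.
Variables (R : pzRingType) (V : lmodType R).
Variable (Q : term R V -> term R V -> Prop).

Inductive lin_rel : term R V -> term R V -> Prop :=
| lin_rel_gen a x y :
    lin_rel (TGen (a *: x + y)) (TAdd (TScale a (TGen x)) (TGen y))
| lin_rel_in s t : Q s t -> lin_rel s t.

Definition tquot : pzAlgType R := presented lin_rel.

Definition tgen (x : V) : tquot := pgen lin_rel x.

Definition words (P : nat -> Prop) : set tquot :=
  [set z | exists2 w : seq V, P (size w) & z = \prod_(x <- w) tgen x].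

Definition tfilt (k : nat) : set tquot := span (words (fun m => (m <= k)%N)).

(* For homogeneous relations, the degree k component. *)
Definition tdeg (k : nat) : set tquot := span (words (fun m => m = k)).

Lemma tfilt_mono k l : (k <= l)%N -> tfilt k `<=` tfilt l.
Proof.
move=> kl; apply: span_mono => _ [w hw ->].
by exists w => //; apply: leq_trans kl.
Qed.

Lemma tfilt1 : tfilt 0 1.
Proof. by apply: sub_span; exists [::]; rewrite ?big_nil. Qed.

Lemma tfiltM k l x y : tfilt k x -> tfilt l y -> tfilt (k + l) (x * y).
Proof.
apply: span_mul => _ _ [w hw ->] [w' hw' ->]; apply: sub_span.
by exists (w ++ w'); rewrite ?big_cat// size_cat leq_add.
Qed.

Lemma tfilt_exhaust x : exists k, tfilt k x.
Proof.
elim/presented_ind: x => [v||||x y [k xk] [l yl]|a x [k xk]].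
- by exists 1%N; apply: sub_span; exists [:: v]; rewrite ?big_seq1.
- by exists 0%N; exact: (proj1 (span_submod _)).
- by exists 0%N; exact: tfilt1.
- move=> x y [k xk] [l yl]; exists (maxn k l).
  rewrite -[x]scale1r; apply: (proj2 (span_submod _)).
    by apply: tfilt_mono xk; apply: leq_maxl.
  by apply: tfilt_mono yl; apply: leq_maxr.
- by exists (k + l)%N; apply: tfiltM.
- by exists k; rewrite -[_ *: _]addr0; apply: (proj2 (span_submod _)) => //;
    exact: (proj1 (span_submod _)).
Qed.

End TensorAlgebraQuotient.

Section ClassicalAlgebras.
Variables (R : realFieldType).

(* U(g): xy - yx = [x, y] *)
Inductive uea_rel (g : lmodType R) (br : g -> g -> g) :
    term R g -> term R g -> Prop :=
| UeaRel x y : uea_rel br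
    (TAdd (TMul (TGen x) (TGen y)) (TScale (-1) (TMul (TGen y) (TGen x))))
    (TGen (br x y)).

(* Cl(g): xy + yx = <x, y> *)
Inductive cliff_rel (g : lmodType R) (ip : g -> g -> R) :
    term R g -> term R g -> Prop :=
| CliffRel x y : cliff_rel ip
    (TAdd (TMul (TGen x) (TGen y)) (TMul (TGen y) (TGen x)))
    (TScale (ip x y) TOne).

(* S(V): xy = yx *)
Inductive sym_rel (V : lmodType R) : term R V -> term R V -> Prop :=
| SymRel x y : sym_rel (TMul (TGen x) (TGen y)) (TMul (TGen y) (TGen x)).

(* /\(V): xx = 0 *)
Inductive ext_rel (V : lmodType R) : term R V -> term R V -> Prop :=
| ExtRel x : ext_rel (TMul (TGen x) (TGen x)) TZero.

Definition uea (g : lmodType R) (br : g -> g -> g) : pzAlgType R :=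
  tquot (uea_rel br).
Definition cliff (g : lmodType R) (ip : g -> g -> R) : pzAlgType R :=
  tquot (cliff_rel ip).
Definition symalg (V : lmodType R) : pzAlgType R :=
  tquot (@sym_rel V).
Definition extalg (V : lmodType R) : pzAlgType R :=
  tquot (@ext_rel V).


(* Parity operators; U(g) and S(V) are purely even. *)
Definition cliff_par (g : lmodType R) (ip : g -> g -> R) :
  cliff ip -> cliff ip := plift (fun x => - tgen (cliff_rel ip) x).
Definition extalg_par (V : lmodType R) :
  extalg V -> extalg V := plift (fun x => - tgen (@ext_rel V) x).

End ClassicalAlgebras.

(* A (x) B, generated by symbols a (x) b subject to bilinearity and to
   (a (x) b)(a' (x) b') = aa' (x) bb', 1 (x) 1 = 1.  It is only used when A is
   purely even, so that the sign rule for graded tensor products is void. *)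
Section Tensor.
Variables (R : pzRingType) (A B : pzAlgType R).

Inductive tens_rel : term R (A * B) -> term R (A * B) -> Prop :=
| TensL c a a' b : tens_rel (TGen (c *: a + a', b))
    (TAdd (TScale c (TGen (a, b))) (TGen (a', b)))
| TensR c a b b' : tens_rel (TGen (a, c *: b + b'))
    (TAdd (TScale c (TGen (a, b))) (TGen (a, b')))
| TensM a b a' b' : tens_rel (TMul (TGen (a, b)) (TGen (a', b')))
    (TGen (a * a', b * b'))
| Tens1 : tens_rel (TGen (1, 1)) TOne.

Definition tensor : pzAlgType R := presented tens_rel.

Definition tens (a : A) (b : B) : tensor := pgen tens_rel (a, b).

Lemma tensDl c a a' b : tens (c *: a + a') b = c *: tens a b + tens a' b.
Proof.
rewrite /tens /pgen (presented_rel (TensL _ _ _ _)).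
by rewrite -[sa_pi _]saq_addE -[X in saq_add X _]saq_scaleE.
Qed.
Lemma tensDr c a b b' : tens a (c *: b + b') = c *: tens a b + tens a b'.
Proof.
rewrite /tens /pgen (presented_rel (TensR _ _ _ _)).
by rewrite -[sa_pi _]saq_addE -[X in saq_add X _]saq_scaleE.
Qed.
Lemma tensM a b a' b' : tens a b * tens a' b' = tens (a * a') (b * b').
Proof.
by rewrite /tens /pgen -(presented_rel (TensM _ _ _ _)) -[RHS]saq_mulE.
Qed.
Lemma tens1 : tens 1 1 = 1.
Proof. by rewrite /tens /pgen (presented_rel Tens1). Qed.
Lemma tens0l b : tens 0 b = 0.
Proof.
have := tensDl (-1) 0 0 b; rewrite scaler0 addr0 => ->.
by rewrite scaleN1r addNr.
Qed.
Lemma tens0r a : tens a 0 = 0.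
Proof.
have := tensDr (-1) a 0 0; rewrite scaler0 addr0 => ->.
by rewrite scaleN1r addNr.
Qed.

(* \sum_(j + 2k = l) F^k (x) G^j *)
Definition tens_gens (F : nat -> set A) (G : nat -> set B) (l : nat) :
    set tensor :=
  [set z | exists j k a b, [/\ (j + 2 * k)%N = l, F k a, G j b & z = tens a b]].
Definition tens_part F G l : set tensor := span (tens_gens F G l).

End Tensor.

(* Filtrations are indexed by nat, with the convention F_k = 0 for k < 0. *)
Definition fext (V : nmodType) (F : nat -> set V) (k : int) : set V :=
  if k is Posz m then F m else [set 0].

Record filtration (R : pzRingType) (B : pzAlgType R) := Filtration {
  filt :> nat -> set B;
  filt_submod : forall k, submod (filt k);
  filt_incr : forall k, filt k `<=` filt k.+1;
  filt_exhaust : forall b, exists k, filt k b;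
  filt_1 : filt 0 1;
  filt_mul : forall k l b c, filt k b -> filt l c -> filt (k + l)%N (b * c)
}.

(* The associated graded algebra, the direct sum of the F_k / F_(k-1):
   finitely supported sequences p with p k in F_k, modulo those with p k in
   F_(k-1) for all k, under the Cauchy product. *)
Section AssociatedGraded.
Variables (R : pzRingType) (B : pzAlgType R) (F : filtration B).

Definition rees_axiom (p : nat -> B) : Prop :=
  (forall k, F k (p k)) /\ exists N, forall k, (N <= k)%N -> p k = 0.
Definition rees : Type := {p : nat -> B | rees_axiom p}.
Definition rcoef (p : rees) : nat -> B := sval p.
Definition rees_eq (p q : rees) : Prop :=
  forall k : nat, fext F (k%:Z - 1) (rcoef p k - rcoef q k).

Lemma filt0 k : F k 0. Proof. exact: (proj1 (filt_submod F k)). Qed.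
Lemma filtZD k a x y : F k x -> F k y -> F k (a *: x + y).
Proof. exact: (proj2 (filt_submod F k)). Qed.
Lemma filtD k x y : F k x -> F k y -> F k (x + y).
Proof. by move=> Fx Fy; rewrite -[x]scale1r; apply: filtZD. Qed.
Lemma filtZ k a x : F k x -> F k (a *: x).
Proof. by move=> Fx; rewrite -[_ *: _]addr0; apply: filtZD => //; apply: filt0. Qed.

Definition filtp (k : nat) : set B := fext F (k%:Z - 1).
Lemma filtpE k : filtp k = if k is m.+1 then F m else [set 0].
Proof. by case: k => [//|k]; rewrite /filtp -predn_int. Qed.
Lemma filtp0 k : filtp k 0.
Proof. by rewrite filtpE; case: k => [//|k]; apply: filt0. Qed.
Lemma filtpD k x y : filtp k x -> filtp k y -> filtp k (x + y).
Proof.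
by rewrite filtpE; case: k => [/= -> ->|k]; [rewrite addr0 | apply: filtD].
Qed.
Lemma filtpZ k a x : filtp k x -> filtp k (a *: x).
Proof. by rewrite filtpE; case: k => [/= ->|k]; [rewrite scaler0 | apply: filtZ]. Qed.
Lemma filtpN k x : filtp k x -> filtp k (- x).
Proof. by rewrite -scaleN1r; apply: filtpZ. Qed.
Lemma filtpMl k l x y : filtp k x -> F l y -> filtp (k + l) (x * y).
Proof.
rewrite !filtpE; case: k => [/= -> _|k Gx Fy]; last by rewrite addSn; apply: filt_mul.
by rewrite mul0r -filtpE; apply: filtp0.
Qed.
Lemma filtpMr k l x y : F k x -> filtp l y -> filtp (k + l) (x * y).
Proof.
rewrite !filtpE; case: l => [/= _ ->|l Fx Gy]; last by rewrite addnS; apply: filt_mul.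
by rewrite mulr0 -filtpE; apply: filtp0.
Qed.

Lemma rees0_subproof : rees_axiom (fun=> 0).
Proof. by split=> [k|]; [exact: filt0 | exists 0%N]. Qed.
Definition rees0 : rees := exist _ _ rees0_subproof.

(* The sequence p as an element of rees (0 if it is not one). *)
Definition mkrees (p : nat -> B) : rees :=
  if pselect (rees_axiom p) is left h then exist _ p h else rees0.

Lemma rcoef_mkrees p : rees_axiom p -> rcoef (mkrees p) = p.
Proof. by rewrite /mkrees; case: pselect. Qed.

Definition rees_single (k : nat) (b : B) : nat -> B :=
  fun j => if j == k then b else 0.

Lemma rees_singleP k b : F k b -> rees_axiom (rees_single k b).
Proof.
move=> Fb; split=> [j|]; first by rewrite /rees_single; case: eqP => [->//|_]; apply: filt0.
by exists k.+1 => j kj; rewrite /rees_single gtn_eqF.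
Qed.

Definition rees1 : rees := mkrees (rees_single 0 1).
Definition reesD (p q : rees) : rees := mkrees (fun k => rcoef p k + rcoef q k).
Definition reesN (p : rees) : rees := mkrees (fun k => - rcoef p k).
Definition reesZ (a : R) (p : rees) : rees := mkrees (fun k => a *: rcoef p k).
Definition cauchy (p q : nat -> B) : nat -> B :=
  fun k => \sum_(i < k.+1) p i * q (k - i)%N.
Definition reesM (p q : rees) : rees := mkrees (cauchy (rcoef p) (rcoef q)).

Lemma rcoefP (p : rees) k : F k (rcoef p k).
Proof. exact: (proj1 (svalP p)). Qed.
Lemma rcoef_fin (p : rees) : exists N, forall k, (N <= k)%N -> rcoef p k = 0.
Proof. exact: (proj2 (svalP p)). Qed.

Lemma rcoef1 : rcoef rees1 = rees_single 0 1.
Proof. by apply/rcoef_mkrees/rees_singleP/filt_1. Qed.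

Lemma rcoefD p q : rcoef (reesD p q) = fun k => rcoef p k + rcoef q k.
Proof.
apply: rcoef_mkrees; split=> [k|]; first by apply: filtD; apply: rcoefP.
have [[M pM] [N qN]] := (rcoef_fin p, rcoef_fin q).
by exists (maxn M N) => k; rewrite geq_max => /andP[/pM-> /qN->]; rewrite addr0.
Qed.

Lemma rcoefZ a p : rcoef (reesZ a p) = fun k => a *: rcoef p k.
Proof.
apply: rcoef_mkrees; split=> [k|]; first by apply: filtZ; apply: rcoefP.
by have [M pM] := rcoef_fin p; exists M => k /pM->; rewrite scaler0.
Qed.

Lemma rcoefN p : rcoef (reesN p) = fun k => - rcoef p k.
Proof.
apply: rcoef_mkrees; split=> [k|].
  by rewrite -scaleN1r; apply: filtZ; apply: rcoefP.
by have [M pM] := rcoef_fin p; exists M => k /pM->; rewrite oppr0.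
Qed.

Lemma rcoefM p q : rcoef (reesM p q) = cauchy (rcoef p) (rcoef q).
Proof.
apply: rcoef_mkrees; split=> [k|].
  apply: big_ind => [||i _]; [exact: filt0 | exact: filtD |].
  rewrite -[X in F X](@subnKC i) -1?ltnS//.
  by apply: filt_mul; apply: rcoefP.
have [[M pM] [N qN]] := (rcoef_fin p, rcoef_fin q).
exists (M + N)%N => k MNk; apply: big1 => i _.
have [/pM->|iM] := leqP M i; first by rewrite mul0r.
rewrite qN ?mulr0// leq_subRL; last by rewrite -ltnS.
by rewrite (leq_trans _ MNk)// leq_add2r ltnW.
Qed.

Definition rcoefE := (rcoefD, rcoefN, rcoefM, rcoefZ, rcoef1).

Lemma rees_eqP p q : rcoef p = rcoef q -> rees_eq p q.
Proof. by move=> pq k; rewrite pq subrr; exact: filtp0. Qed.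

Lemma rees_refl p : rees_eq p p. Proof. exact: rees_eqP. Qed.
Lemma rees_sym p q : rees_eq p q -> rees_eq q p.
Proof. by move=> pq k; rewrite -/(filtp k _) -opprB; apply: filtpN; exact: pq. Qed.
Lemma rees_trans q p r : rees_eq p q -> rees_eq q r -> rees_eq p r.
Proof.
move=> pq qr k; rewrite -/(filtp k _) -(subrK (rcoef q k) (rcoef p k)) -addrA.
by apply: filtpD; [exact: pq | exact: qr].
Qed.
Lemma reesD_cong p p' q q' :
  rees_eq p p' -> rees_eq q q' -> rees_eq (reesD p q) (reesD p' q').
Proof. by move=> pp qq k; rewrite -/(filtp k _) !rcoefE opprD addrACA; apply: filtpD; [exact: pp | exact: qq]. Qed.
Lemma reesN_cong p p' : rees_eq p p' -> rees_eq (reesN p) (reesN p').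
Proof. by move=> pp k; rewrite -/(filtp k _) !rcoefE -opprD; apply: filtpN; exact: pp. Qed.
Lemma reesZ_cong a p p' : rees_eq p p' -> rees_eq (reesZ a p) (reesZ a p').
Proof. by move=> pp k; rewrite -/(filtp k _) !rcoefE -scalerBr; apply: filtpZ; exact: pp. Qed.
Lemma reesM_cong p p' q q' :
  rees_eq p p' -> rees_eq q q' -> rees_eq (reesM p q) (reesM p' q').
Proof.
move=> pp qq k; rewrite -/(filtp k _) !rcoefE /cauchy -sumrB.
apply: (big_ind (filtp k)) => [||i _]; [exact: filtp0 | exact: filtpD |].
have ki : (i + (k - i))%N = k by rewrite subnKC// -ltnS.
rewrite -[X in X - _](subrK (rcoef p' i * rcoef q (k - i))) -mulrBl -addrA.
rewrite -mulrBr -{1}ki; apply: filtpD; rewrite ?ki.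
  by rewrite -{1}ki; apply: filtpMl; [exact: pp | exact: rcoefP].
by rewrite -{1}ki; apply: filtpMr; [exact: rcoefP | exact: qq].
Qed.

Lemma cauchy_rev (p q : nat -> B) k :
  cauchy p q k = \sum_(i < k.+1) p (k - i)%N * q i.
Proof.
rewrite /cauchy (reindex_inj rev_ord_inj) /=.
by apply: eq_bigr => i _; rewrite !subSS subKn// -ltnS.
Qed.

Lemma cauchyA : associative cauchy.
Proof.
move=> p q r; apply/funext => i; rewrite [LHS]/cauchy [RHS]cauchy_rev.
pose c3 j k := p j * (q (i - j - k)%N * r k).
transitivity (\sum_(j < i.+1) \sum_(k < i.+1 | (k <= i - j)%N) c3 j k).
  apply: eq_bigr => /= j _; rewrite cauchy_rev big_distrr /=.
  by rewrite (big_ord_narrow_leq (leq_subr _ _)).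
rewrite (exchange_big_dep predT) //=; apply: eq_bigr => k _.
transitivity (\sum_(j < i.+1 | (j <= i - k)%N) c3 j k).
  apply: eq_bigl => j; rewrite -ltnS -(ltnS j) -!subSn ?leq_ord //.
  by rewrite -subn_gt0 -(subn_gt0 j) -!subnDA addnC.
rewrite (big_ord_narrow_leq (leq_subr _ _)) /cauchy big_distrl /=.
by apply: eq_bigr => j _; rewrite /c3 -!subnDA addnC mulrA.
Qed.

Lemma cauchy1l p : cauchy (rees_single 0 1) p = p.
Proof.
apply/funext => k; rewrite /cauchy big_ord_recl /= /rees_single eqxx mul1r subn0.
by rewrite big1 ?addr0// => i _; rewrite mul0r.
Qed.
Lemma cauchy1r p : cauchy p (rees_single 0 1) = p.
Proof.
apply/funext => k; rewrite cauchy_rev big_ord_recl /= /rees_single eqxx mulr1.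
by rewrite subn0 big1 ?addr0// => i _; rewrite mulr0.
Qed.

Lemma reesDA p q r : rees_eq (reesD p (reesD q r)) (reesD (reesD p q) r).
Proof.
by apply: rees_eqP; rewrite !rcoefE; apply/funext => k; rewrite addrA.
Qed.
Lemma reesDC p q : rees_eq (reesD p q) (reesD q p).
Proof.
by apply: rees_eqP; rewrite !rcoefE; apply/funext => k; rewrite addrC.
Qed.
Lemma rees0D p : rees_eq (reesD rees0 p) (p).
Proof.
by apply: rees_eqP; rewrite !rcoefE; apply/funext => k; rewrite add0r.
Qed.
Lemma reesND p : rees_eq (reesD (reesN p) p) (rees0).
Proof.
by apply: rees_eqP; rewrite !rcoefE; apply/funext => k; rewrite addNr.
Qed.
Lemma reesMA p q r : rees_eq (reesM p (reesM q r)) (reesM (reesM p q) r).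
Proof.
by apply: rees_eqP; rewrite !rcoefE; rewrite cauchyA.
Qed.
Lemma rees1M p : rees_eq (reesM rees1 p) (p).
Proof.
by apply: rees_eqP; rewrite !rcoefE; rewrite cauchy1l.
Qed.
Lemma reesM1 p : rees_eq (reesM p rees1) (p).
Proof.
by apply: rees_eqP; rewrite !rcoefE; rewrite cauchy1r.
Qed.
Lemma reesMDl p q r : rees_eq (reesM (reesD p q) r) (reesD (reesM p r) (reesM q r)).
Proof.
by apply: rees_eqP; rewrite !rcoefE; apply/funext => k;
  rewrite /cauchy -big_split /=; apply: eq_bigr => i _; rewrite mulrDl.
Qed.
Lemma reesMDr p q r : rees_eq (reesM p (reesD q r)) (reesD (reesM p q) (reesM p r)).
Proof.
by apply: rees_eqP; rewrite !rcoefE; apply/funext => k;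
  rewrite /cauchy -big_split /=; apply: eq_bigr => i _; rewrite mulrDr.
Qed.
Lemma reesZA a b p : rees_eq (reesZ a (reesZ b p)) (reesZ (a * b) p).
Proof.
by apply: rees_eqP; rewrite !rcoefE; apply/funext => k; rewrite scalerA.
Qed.
Lemma rees1Z p : rees_eq (reesZ 1 p) (p).
Proof.
by apply: rees_eqP; rewrite !rcoefE; apply/funext => k; rewrite scale1r.
Qed.
Lemma reesZDr a p q : rees_eq (reesZ a (reesD p q)) (reesD (reesZ a p) (reesZ a q)).
Proof.
by apply: rees_eqP; rewrite !rcoefE; apply/funext => k; rewrite scalerDr.
Qed.
Lemma reesZDl a b p : rees_eq (reesZ (a + b) p) (reesD (reesZ a p) (reesZ b p)).
Proof.
by apply: rees_eqP; rewrite !rcoefE; apply/funext => k; rewrite scalerDl.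
Qed.
Lemma reesZAl a p q : rees_eq (reesZ a (reesM p q)) (reesM (reesZ a p) q).
Proof.
by apply: rees_eqP; rewrite !rcoefE; apply/funext => k;
  rewrite /cauchy scaler_sumr; apply: eq_bigr => i _; rewrite pzscalerAl.
Qed.
Lemma reesZAr a p q : rees_eq (reesZ a (reesM p q)) (reesM p (reesZ a q)).
Proof.
by apply: rees_eqP; rewrite !rcoefE; apply/funext => k;
  rewrite /cauchy scaler_sumr; apply: eq_bigr => i _; rewrite pzscalerAr.
Qed.

Definition rees_setoidAlg : setoidAlg R :=
  SetoidAlg rees_refl rees_sym rees_trans reesD_cong reesN_cong reesM_cong
    reesZ_cong reesDA reesDC rees0D reesND reesMA rees1M reesM1 reesMDl reesMDr
    reesZA rees1Z reesZDr reesZDl reesZAl reesZAr.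

Definition gr : pzAlgType R := sa_quotAlg rees_setoidAlg.

Definition gr_pi (p : rees) : gr := sa_pi (p : sa_sort rees_setoidAlg).

(* The class in F_k / F_(k-1) of an element b of F_k (0 if b is not in F_k). *)
Definition symb (k : nat) (b : B) : gr := gr_pi (mkrees (rees_single k b)).

Definition gr_deg (k : nat) : set gr :=
  [set x | exists2 b, F k b & x = symb k b].

(* The operator on gr induced by an operator D of filtration degree r: it maps
   the class of b in F_k / F_(k-1) to the class of D b in F_(k+r) / F_(k+r-1). *)
Definition gr_op (r : int) (D : B -> B) (x : gr) : gr :=
  gr_pi (mkrees (fun j : nat =>
    if j%:Z - r is Posz i then D (rcoef (sa_repr x) i) else 0)).

End AssociatedGraded.
Arguments symb {R B} F k b.
Arguments gr_deg {R B} F k.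
Arguments gr_op {R B} F r D x.

Section SuperAlgebra.
Variables (R : realFieldType) (B : pzAlgType R).

(* A super-algebra structure is given by its parity operator, the involutive
   automorphism which is 1 on the even part and -1 on the odd part. *)
Definition is_parity (eps : B -> B) : Prop :=
  [/\ linear eps, monoid_morphism eps & involutive eps].

Definition even_part (eps : B -> B) (b : B) : B := 2^-1 *: (b + eps b).
Definition odd_part (eps : B -> B) (b : B) : B := 2^-1 *: (b - eps b).

(* The graded commutator [b, c] = bc - (-1)^(|b||c|) cb. *)
Definition ad (eps : B -> B) (b c : B) : B :=
  b * c - c * even_part eps b - eps c * odd_part eps b.

(* Derivations of parity p (true for odd). *)
Definition is_derivation (eps : B -> B) (p : bool) (D : B -> B) : Prop :=
  [/\ linear D,
      forall b, D (eps b) = (-1) ^+ p *: eps (D b)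
    & forall b c, D (b * c) = D b * c + (if p then eps b else b) * D c].

(* The graded commutator of operators of parities p and q. *)
Definition opcomm (p q : bool) (D E : B -> B) : B -> B :=
  fun b => D (E b) - (-1) ^+ (p && q) *: E (D b).

End SuperAlgebra.

Record gda_ops (B : Type) (n : nat) := GdaOps {
  par : B -> B;
  iota : 'I_n -> B -> B;
  lie : 'I_n -> B -> B;
  diff : B -> B
}.

Section GDifferentialAlgebra.
Variables (R : realFieldType) (n : nat) (f : 'I_n -> 'I_n -> 'I_n -> R).
Variables (B : pzAlgType R).

Record is_gda (o : gda_ops B n) : Prop := IsGda {
  gda_par : is_parity (par o);
  gda_iota : forall a, is_derivation (par o) true (iota o a);
  gda_lie : forall a, is_derivation (par o) false (lie o a);
  gda_diff : is_derivation (par o) true (diff o);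
  gda_lie_iota : forall a b x,
    opcomm false true (lie o a) (iota o b) x = \sum_c f a b c *: iota o c x;
  gda_lie_lie : forall a b x,
    opcomm false false (lie o a) (lie o b) x = \sum_c f a b c *: lie o c x;
  gda_iota_diff : forall a x,
    opcomm true true (iota o a) (diff o) x = lie o a x;
  gda_iota_iota : forall a b x,
    opcomm true true (iota o a) (iota o b) x = 0;
  gda_lie_diff : forall a x, opcomm false true (lie o a) (diff o) x = 0;
  gda_diff_diff : forall x, opcomm true true (diff o) (diff o) x = 0
}.

Definition has_degree (F : nat -> set B) (r : int) (D : B -> B) : Prop :=
  forall (k : int) b, fext F k b -> fext F (k + r) (D b).

Record is_filtered_gda (F : filtration B) (o : gda_ops B n) : Prop :=
  IsFilteredGda {
  fgda_gda : is_gda o;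
  fgda_par : has_degree F 0 (par o);
  fgda_gr_par : forall k x, gr_deg F k x -> gr_op F 0 (par o) x = (-1) ^+ k *: x;
  fgda_iota : forall a, has_degree F (-1) (iota o a);
  fgda_lie : forall a, has_degree F 0 (lie o a);
  fgda_diff : has_degree F 1 (diff o)
}.

Record is_grading (A : nat -> set B) : Prop := IsGrading {
  grading_submod : forall k, submod (A k);
  grading_1 : A 0 1;
  grading_mul : forall k l x y, A k x -> A l y -> A (k + l)%N (x * y);
  grading_span : forall x, exists N (p : nat -> B),
    (forall k, A k (p k)) /\ x = \sum_(k < N) p k;
  grading_direct : forall N (p : nat -> B), (forall k, A k (p k)) ->
    \sum_(k < N) p k = 0 -> forall k, (k < N)%N -> p k = 0
}.

Record is_graded_gda (A : nat -> set B) (o : gda_ops B n) : Prop :=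
  IsGradedGda {
  ggda_grading : is_grading A;
  ggda_gda : is_gda o;
  ggda_par : forall k x, A k x -> par o x = (-1) ^+ k *: x;
  ggda_iota : forall a, has_degree A (-1) (iota o a);
  ggda_lie : forall a, has_degree A 0 (lie o a);
  ggda_diff : has_degree A 1 (diff o)
}.

Definition gr_ops (F : filtration B) (o : gda_ops B n) : gda_ops (gr F) n :=
  {| par := gr_op F 0 (par o);
     iota := fun a => gr_op F (-1) (iota o a);
     lie := fun a => gr_op F 0 (lie o a);
     diff := gr_op F 1 (diff o) |}.

End GDifferentialAlgebra.

Record is_gda_iso (R : realFieldType) (n : nat) (B C : pzAlgType R)
    (A : nat -> set B) (o : gda_ops B n) (A' : nat -> set C) (o' : gda_ops C n)
    (phi : B -> C) : Prop := IsGdaIso {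
  iso_bij : bijective phi;
  iso_linear : linear phi;
  iso_mul : monoid_morphism phi;
  iso_deg : forall k x, A k x <-> A' k (phi x);
  iso_par : forall x, phi (par o x) = par o' (phi x);
  iso_iota : forall a x, phi (iota o a x) = iota o' a (phi x);
  iso_lie : forall a x, phi (lie o a x) = lie o' a (phi x);
  iso_diff : forall x, phi (diff o x) = diff o' (phi x)
}.

Section LieAlgebra.
Variables (R : realFieldType) (g : vectType R).

Record is_lie_bracket (br : g -> g -> g) : Prop := IsLieBracket {
  br_linearl : forall y, linear (br^~ y);
  br_linearr : forall x, linear (br x);
  br_alt : forall x, br x x = 0;
  br_jacobi : forall x y z, br x (br y z) + br y (br z x) + br z (br x y) = 0
}.

Record is_inner_product (ip : g -> g -> R) : Prop := IsInnerProduct {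
  ip_linear : forall x, scalar (ip x);
  ip_sym : forall x y, ip x y = ip y x;
  ip_pos : forall x, x != 0 -> 0 < ip x x
}.

(* ad-invariance; for the Lie algebra of a connected Lie group this is the
   same as invariance under the adjoint action of the group. *)
Definition is_invariant (br : g -> g -> g) (ip : g -> g -> R) : Prop :=
  forall x y z, ip (br z x) y + ip x (br z y) = 0.

Definition is_orthonormal_basis (ip : g -> g -> R) n (e : n.-tuple g) : Prop :=
  basis_of fullv e /\ forall a b : 'I_n, ip e`_a e`_b = (a == b)%:R.

(* [e_a, e_b] = f_abc e_c *)
Definition struct_const (br : g -> g -> g) n (e : n.-tuple g)
  (a b c : 'I_n) : R := coord e c (br e`_a e`_b).

Definition dual_space := 'Hom(g, R^o).
HB.instance Definition _ := Vector.on dual_space.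

(* The dual basis e^a, and the isomorphism g -> g^* given by ip. *)
Definition dual_basis n (e : n.-tuple g) (a : 'I_n) : dual_space :=
  linfun (coord e a : g -> R^o).
Definition flat (ip : g -> g -> R) (x : g) : dual_space :=
  linfun (ip x : g -> R^o).

End LieAlgebra.

Section NcWeil.
Variables (R : realFieldType) (g : vectType R).
Variables (br : g -> g -> g) (ip : g -> g -> R).

Definition ncweil : pzAlgType R := tensor (uea br) (cliff ip).

Definition ncu (x : g) : ncweil := tens (tgen (uea_rel br) x : uea br) (1 : cliff ip).
Definition ncx (x : g) : ncweil := tens (1 : uea br) (tgen (cliff_rel ip) x : cliff ip).

Definition ncweil_par : ncweil -> ncweil :=
  plift (fun z : uea br * cliff ip => tens z.1 (cliff_par z.2)).

Definition ncweil_part (l : nat) : set ncweil :=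
  tens_part (@tfilt _ _ (uea_rel br)) (@tfilt _ _ (cliff_rel ip)) l.

Lemma ncweil_part_incr k : ncweil_part k `<=` ncweil_part k.+1.
Proof.
apply: span_mono => _ [j [m [a [b [<- ha hb ->]]]]].
exists j.+1, m, a, b; split=> //.
by apply: tfilt_mono hb.
Qed.

Lemma ncweil_part_mono k l : (k <= l)%N -> ncweil_part k `<=` ncweil_part l.
Proof.
move=> /subnK <-; elim: (l - k)%N => // m IH x /IH.
exact: ncweil_part_incr.
Qed.

Lemma ncweil_part1 : ncweil_part 0 1.
Proof.
apply: sub_span; exists 0%N, 0%N, 1, 1.
by split=> //; [exact: tfilt1 | exact: tfilt1 | rewrite tens1].
Qed.

Lemma ncweil_partM k l x y :
  ncweil_part k x -> ncweil_part l y -> ncweil_part (k + l) (x * y).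
Proof.
apply: span_mul => _ _ [j [m [a [b [<- ha hb ->]]]]]
  [j' [m' [a' [b' [<- ha' hb' ->]]]]]; apply: sub_span.
exists (j + j')%N, (m + m')%N, (a * a'), (b * b').
split; [by rewrite mulnDr addnACA | exact: tfiltM | exact: tfiltM |].
exact: tensM.
Qed.

Lemma ncweil_part_exhaust x : exists k, ncweil_part k x.
Proof.
elim/presented_ind: x => [[a b]||||x y [k xk] [l yl]|c x [k xk]].
- have [m ha] := tfilt_exhaust a; have [j hb] := tfilt_exhaust b.
  by exists (j + 2 * m)%N; apply: sub_span; exists j, m, a, b.
- by exists 0%N; exact: (proj1 (span_submod _)).
- by exists 0%N; exact: ncweil_part1.
- move=> x y [k xk] [l yl]; exists (maxn k l).
  rewrite -[x]scale1r; apply: (proj2 (span_submod _)).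
    by apply: ncweil_part_mono xk; apply: leq_maxl.
  by apply: ncweil_part_mono yl; apply: leq_maxr.
- by exists (k + l)%N; apply: ncweil_partM.
- by exists k; rewrite -[_ *: _]addr0; apply: (proj2 (span_submod _)) => //;
    exact: (proj1 (span_submod _)).
Qed.

Definition ncweil_filt : filtration ncweil :=
  Filtration (fun k => span_submod _) ncweil_part_incr ncweil_part_exhaust
    ncweil_part1 ncweil_partM.

Variables (n : nat) (e : n.-tuple g).
Notation f := (struct_const br e).

Definition ncg (a : 'I_n) : ncweil :=
  - (2^-1 *: \sum_r \sum_s f a r s *: (ncx e`_r * ncx e`_s)).

Definition ncgamma : ncweil :=
  - (6^-1 *: \sum_a \sum_b \sum_c f a b c *: (ncx e`_a * ncx e`_b * ncx e`_c)).

Definition dirac : ncweil :=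
  (\sum_(a < n) ncx e`_a * ncu e`_a) + ncgamma.

Definition ncweil_ops : gda_ops ncweil n :=
  {| par := ncweil_par;
     iota := fun a => ad ncweil_par (ncx e`_a);
     lie := fun a => ad ncweil_par (ncu e`_a + ncg a);
     diff := ad ncweil_par dirac |}.

End NcWeil.

Section Weil.
Variables (R : realFieldType) (g : vectType R).

Definition weil : pzAlgType R := tensor (symalg (dual_space g)) (extalg (dual_space g)).

Definition weilv (m : dual_space g) : weil :=
  tens (tgen (@sym_rel _ _) m : symalg (dual_space g)) (1 : extalg (dual_space g)).
Definition weily (m : dual_space g) : weil :=
  tens (1 : symalg (dual_space g)) (tgen (@ext_rel _ _) m : extalg (dual_space g)).

Definition weil_par : weil -> weil :=
  plift (fun z : symalg (dual_space g) * extalg (dual_space g) =>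
           tens z.1 (extalg_par z.2)).

Definition weil_deg (l : nat) : set weil :=
  tens_part (@tdeg _ _ (@sym_rel _ (dual_space g)))
            (@tdeg _ _ (@ext_rel _ (dual_space g))) l.

Variables (br : g -> g -> g) (n : nat) (e : n.-tuple g).
(* f^c_ab = f_abc *)
Notation f := (struct_const br e).
Notation v := (fun a => weilv (dual_basis e a)).
Notation y := (fun a => weily (dual_basis e a)).

(* The standard contractions, Lie derivatives and differential, as the
   derivations with prescribed values on the generators v^a and y^a. *)
Record is_weil_ops (o : gda_ops weil n) : Prop := IsWeilOps {
  weil_parE : par o = weil_par;
  weil_iota_der : forall a, is_derivation weil_par true (iota o a);
  weil_iota_y : forall a b, iota o a (y b) = (a == b)%:R;
  weil_iota_v : forall a b, iota o a (v b) = 0;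
  weil_lie_der : forall a, is_derivation weil_par false (lie o a);
  weil_lie_y : forall a c, lie o a (y c) = - \sum_b f a b c *: y b;
  weil_lie_v : forall a c, lie o a (v c) = - \sum_b f a b c *: v b;
  weil_diff_der : is_derivation weil_par true (diff o);
  weil_diff_y : forall a,
    diff o (y a) = v a - 2^-1 *: \sum_j \sum_k f j k a *: (y j * y k);
  weil_diff_v : forall a,
    diff o (v a) = - \sum_j \sum_k f j k a *: (y j * v k)
}.

End Weil.

(* Main.v *)
Require Import Defs.
From HB Require Import structures.
From mathcomp Require Import all_boot all_order all_algebra.
From mathcomp Require Import boolp classical_sets reals.
From mathcomp Require Import ssrAC mpoly zify ring lra.

(* Graded commutators with elements are derivations and satisfy
   [ad b, ad c] = ad [b, c], so the relations of a G-differential algebra reduce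
   to identities in the algebra: [x_a, D] = u_a + g_a, and u_a + g_a acts on the
   x_b and u_b by the adjoint action, hence kills D because \sum_a e_a (x) e_a is
   invariant. Consequently [D, D] commutes with x_a and with u_a + g_a, hence is
   central, and d squares to 0.

   The symbols of u_a and x_a satisfy the relations of the Weil algebra, whence
   a surjective morphism from W_G to the associated graded algebra. Injectivity
   is the Poincare-Birkhoff-Witt theorem for U(g) (x) Cl(g): one needs linear
   functionals which vanish on the lower filtration steps and are dual to the
   monomials of top degree. They are matrix coefficients of a representation on
   P (x) R^(2^n): the x_a act by the Jordan-Wigner realization of Cl(g), and g
   acts on the polynomial ring P by vector fields that are linearly independent
   at some point. Such vector fields exist because the adjoint representation is
   faithful modulo the center, while the orthogonal projection to the center
   kills all brackets and so defines an action by translations. *)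

Set Implicit Arguments.
Unset Strict Implicit.
Unset Printing Implicit Defensive.

Import Order.TTheory GRing.Theory Num.Theory.

Local Open Scope ring_scope.
Local Open Scope classical_set_scope.

(* [span] is otherwise the span of a sequence in a [vectType]. *)
Local Notation span := Defs.span.

(** * Linear maps and presented algebras *)

(** All algebras here are given by generators and relations: the relations yield spanning families,
    but independence has to be detected from outside, by a representation. No group is at hand over
    an ordered field, so the left-invariant vector fields of a matrix group are replaced by the
    fields A |-> A ad(x) on all matrices, taken at the identity; they are polynomial and use only
    the bracket. Once the fields of a basis are independent at a point, there are functions t_b
    vanishing there with D_a t_b = delta_ab at the point, and iterated derivatives separate
    monomials in the t_b like Taylor coefficients. The degree 2k + j fits this: a word of lower
    degree has too few u's to bring such a monomial to a nonzero value, or too few x's to reach a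
    given basis vector of R^(2^n). The operators on W_G are not built from their values on
    generators. They are carried over from the associated graded algebra by the inverse of the
    symbol map, so the derivation property is inherited and only the values on the y^a and v^a
    remain to be computed. *)

Section LinearMaps.
Variables (R : pzRingType) (V W : lmodType R) (h : V -> W).
Hypothesis lin_h : linear h.

Lemma linD x y : h (x + y) = h x + h y.
Proof. by rewrite -[x]scale1r lin_h !scale1r. Qed.
Lemma lin0 : h 0 = 0.
Proof. by apply: (addrI (h 0)); rewrite -linD !addr0. Qed.
Lemma linZ a x : h (a *: x) = a *: h x.
Proof. by rewrite -[a *: x]addr0 lin_h lin0 addr0. Qed.
Lemma linN x : h (- x) = - h x.
Proof. by rewrite -scaleN1r linZ scaleN1r. Qed.
Lemma linB x y : h (x - y) = h x - h y.
Proof. by rewrite linD linN. Qed.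
Lemma lin_sum I r (P : pred I) (F : I -> V) :
  h (\sum_(i <- r | P i) F i) = \sum_(i <- r | P i) h (F i).
Proof. exact: (big_morph h linD lin0). Qed.

End LinearMaps.

Section Submodules.
Variables (R : pzRingType) (V : lmodType R).

Lemma mem_span (S : set V) x : S x -> span S x.
Proof. exact: Defs.sub_span. Qed.
Lemma submod0 (P : set V) : submod P -> P 0. Proof. by case. Qed.
Lemma submodD (P : set V) : submod P -> forall x y, P x -> P y -> P (x + y).
Proof. by move=> [_ h] x y Px Py; rewrite -[x]scale1r; apply: h. Qed.
Lemma submodZ (P : set V) : submod P -> forall a x, P x -> P (a *: x).
Proof. by move=> [P0 h] a x Px; rewrite -[_ *: _]addr0; apply: h. Qed.
Lemma submodN (P : set V) : submod P -> forall x, P x -> P (- x).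
Proof. by move=> sP x Px; rewrite -scaleN1r; apply: submodZ. Qed.
Lemma submod_sum (P : set V) : submod P -> forall I r (Q : pred I) (F : I -> V),
  (forall i, Q i -> P (F i)) -> P (\sum_(i <- r | Q i) F i).
Proof.
by move=> sP I r Q F PF; apply: (big_ind P) => //; [exact: (submod0 sP) | exact: (submodD sP)].
Qed.

End Submodules.

Section MoreSubmodules.
Variables (R : pzRingType) (V : lmodType R).

Lemma submod_preim (W : lmodType R) (h : V -> W) (P : set W) :
  linear h -> submod P -> submod [set x | P (h x)].
Proof.
move=> lh sP; split=> [|a x y] /=; first by rewrite (lin0 lh); exact: (submod0 sP).
by move=> Px Py; rewrite lh; apply: (proj2 sP).
Qed.

(* A linear map is injective as soon as its values on a spanning family admit a
   biorthogonal family of linear functionals. *)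
Lemma biorthogonal_inj (W : lmodType R) (psi : V -> W) (J : eqType)
    (b : J -> V) (lam : J -> W -> R) :
  linear psi -> (forall j, scalar (lam j)) ->
  (forall x, span [set b j | j in setT] x) ->
  (forall j, GRing.rreg (lam j (psi (b j)))) ->
  (forall i j, i != j -> lam i (psi (b j)) = 0) ->
  injective psi.
Proof.
move=> lpsi llam bspan creg lam0.
have lam_lin j : linear (lam j : W -> R^o) by exact: llam.
have expand x : exists l : seq J, exists c : J -> R,
    uniq l /\ x = \sum_(j <- l) c j *: b j.
  apply: (bspan x [set x | exists l : seq J, exists c : J -> R,
    uniq l /\ x = \sum_(j <- l) c j *: b j]); last first.
    move=> _ [j _ <-]; exists [:: j], (fun=> 1).
    by rewrite big_seq1 scale1r.
  split=> [|a _ _ [l [c [ul ->]]] [l' [c' [ul' ->]]]] /=.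
    by exists [::], (fun=> 0); rewrite big_nil.
  (* Pads a combination over [s] with zero coefficients, so that two combinations get a common
     duplicate-free support and can be added. *)
  have extend s t (d : J -> R) : uniq s ->
      \sum_(j <- s) d j *: b j =
      \sum_(j <- undup (s ++ t)) (if j \in s then d j else 0) *: b j.
    move=> us.
    under [RHS]eq_bigr => j _ do rewrite (fun_if (fun r => r *: b j)) scale0r.
    rewrite -big_mkcond -big_filter; apply: perm_big; apply: uniq_perm => //.
      exact/filter_uniq/undup_uniq.
    move=> j; rewrite mem_filter mem_undup mem_cat.
    by case: (j \in s).
  exists (undup (l ++ l')), (fun j => a * (if j \in l then c j else 0) +
    (if j \in l' then c' j else 0)); split; first exact: undup_uniq.
  rewrite (extend l l' c ul) (extend l' l c' ul').
  rewrite (perm_big (undup (l ++ l')) (_ : perm_eq (undup (l' ++ l)) _)) /=.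
    rewrite scaler_sumr -big_split /=; apply: eq_bigr => j _.
    by rewrite scalerDl scalerA.
  apply: uniq_perm; rewrite ?undup_uniq// => j.
  by rewrite !mem_undup !mem_cat orbC.
move=> x y xy; apply/eqP; rewrite -subr_eq0; apply/eqP.
have := expand (x - y) => -[l [c [ul exy]]].
have psi0 : psi (x - y) = 0 by rewrite linB// xy subrr.
rewrite exy big_seq big1// => j jl.
suff -> : c j = 0 by rewrite scale0r.
apply: (creg j); rewrite mul0r.
have := congr1 (lam j) psi0; rewrite exy (lin_sum lpsi) (lin0 (lam_lin j)).
rewrite (lin_sum (lam_lin j)) (bigD1_seq j) //= [X in _ + X]big1; last first.
  by move=> i ij; rewrite (linZ lpsi) (linZ (lam_lin j)) lam0 1?eq_sym// scaler0.
by rewrite addr0 (linZ lpsi) (linZ (lam_lin j)).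
Qed.

End MoreSubmodules.

Section AlgebraMorphisms.
Variables (R : pzRingType).
Implicit Types A B C : pzAlgType R.

Definition alg_hom A B (h : A -> B) : Prop := linear h /\ monoid_morphism h.

Section Theory.
Variables (A B : pzAlgType R) (h : A -> B).
Hypothesis hh : alg_hom h.
Lemma hom_lin : linear h. Proof. by case: hh. Qed.
Lemma hom1 : h 1 = 1. Proof. by case: hh => _ []. Qed.
Lemma homM x y : h (x * y) = h x * h y. Proof. by case: hh => _ []. Qed.
Lemma hom_prod I r (P : pred I) (F : I -> A) :
  h (\prod_(i <- r | P i) F i) = \prod_(i <- r | P i) h (F i).
Proof. exact: (big_morph h homM hom1). Qed.
End Theory.

Lemma alg_hom_comp A B C (h : B -> C) (k : A -> B) :
  alg_hom h -> alg_hom k -> alg_hom (fun x => h (k x)).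
Proof.
move=> [lh mh] [lk mk]; split; first by move=> a x y; rewrite lk lh.
by split=> [|x y]; rewrite ?mk.1 ?mk.2 ?mh.1 ?mh.2.
Qed.

Section Presented.
Variables (X : Type) (Q : term R X -> term R X -> Prop).
Local Notation pr := (@sa_pi R (term_setoidAlg Q) : _ -> presented Q).

(** [plift] evaluates a chosen representative. Evaluation is constant on the congruence [teq], by
    induction on derivations, so the choice does not matter. *)
Lemma plift_pi A (k : X -> A) : (forall s t, Q s t -> teval k s = teval k t) ->
  forall s, plift k (pr s) = teval k s.
Proof.
move=> kQ s; suff E u v : teq Q u v -> teval k u = teval k v.
  by apply: E; exact: (@sa_repr_pi R (term_setoidAlg Q)).
elim=> {u v s} /=; try by [].
- by move=> s t u _ -> _ ->.
- by move=> s s' t t' _ -> _ ->.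
- by move=> s s' t t' _ -> _ ->.
- by move=> a s s' _ ->.
- by move=> s t u; rewrite addrA.
- by move=> s t; rewrite addrC.
- by move=> s; rewrite add0r.
- by move=> s; rewrite scaleN1r addNr.
- by move=> s t u; rewrite mulrA.
- by move=> s; rewrite mul1r.
- by move=> s; rewrite mulr1.
- by move=> s t u; rewrite mulrDl.
- by move=> s t u; rewrite mulrDr.
- by move=> a b s; rewrite scalerA.
- by move=> s; rewrite scale1r.
- by move=> a s t; rewrite scalerDr.
- by move=> a b s; rewrite scalerDl.
- by move=> a s t; rewrite pzscalerAl.
- by move=> a s t; rewrite pzscalerAr.
Qed.

Lemma plift_hom A (k : X -> A) : (forall s t, Q s t -> teval k s = teval k t) ->
  alg_hom (plift k : presented Q -> A).
Proof.
move=> kQ; split.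
  move=> a; elim/sa_quotP=> s; elim/sa_quotP=> t.
  rewrite -[a *: _]/(saq_scale a (pr s)) -[X in plift k X]/(saq_add _ (pr t)).
  by rewrite !saqE !plift_pi.
split; first exact: (@plift_pi _ k kQ TOne).
elim/sa_quotP=> s; elim/sa_quotP=> t.
by rewrite -[X in plift k X]/(saq_mul (pr s) (pr t)) !saqE !plift_pi.
Qed.

Lemma plift_gen A (k : X -> A) : (forall s t, Q s t -> teval k s = teval k t) ->
  forall x, plift k (pgen Q x) = k x.
Proof. by move=> kQ x; apply: (plift_pi kQ (TGen x)). Qed.

Lemma presented_eq A (h k : presented Q -> A) : alg_hom h -> alg_hom k ->
  (forall x, h (pgen Q x) = k (pgen Q x)) -> h =1 k.
Proof.
move=> hh hk e; elim/presented_ind => //.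
- by rewrite !lin0//; apply: hom_lin.
- by rewrite !hom1.
- by move=> x y ex ey; rewrite !linD ?ex ?ey//; apply: hom_lin.
- by move=> x y ex ey; rewrite !homM// ex ey.
- by move=> a x ex; rewrite !linZ ?ex//; apply: hom_lin.
Qed.

Lemma pgen_rel s t : Q s t -> teval (pgen Q) s = teval (pgen Q) t.
Proof.
have E u : teval (pgen Q) u = pr u.
  elim: u => //= [u -> v ->|u -> v ->|a u ->].
  - by rewrite -saq_addE.
  - by rewrite -saq_mulE.
  - by rewrite -saq_scaleE.
by move=> st; rewrite !E; apply: presented_rel.
Qed.

End Presented.

Section TensorQuotients.
Variables (V : lmodType R) (Q : term R V -> term R V -> Prop).

Lemma tgen_lin : linear (tgen Q).
Proof. by move=> a x y; exact: (pgen_rel (lin_rel_gen Q a x y)). Qed.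

Lemma tgen_rel s t : Q s t -> teval (tgen Q) s = teval (tgen Q) t.
Proof. by move=> st; exact: (pgen_rel (lin_rel_in st)). Qed.

Variables (A : pzAlgType R) (k : V -> A).
Hypothesis lin_k : linear k.
Hypothesis kQ : forall s t, Q s t -> teval k s = teval k t.

Lemma tlift_rel s t : lin_rel Q s t -> teval k s = teval k t.
Proof. by case=> [a x y|u v] /=; [rewrite lin_k | apply: kQ]. Qed.

Lemma tlift_hom : alg_hom (plift k : tquot Q -> A).
Proof. exact: plift_hom tlift_rel. Qed.

Lemma tlift_gen x : plift k (tgen Q x) = k x.
Proof. exact: (plift_gen tlift_rel). Qed.

End TensorQuotients.

(** The elements commuting with a given one form a subalgebra, so commutation spreads from the
    generators to both images. This is the commutation hypothesis of [tens_lift_hom]. *)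
Lemma tlift_comm (V W : lmodType R) (Q : term R V -> term R V -> Prop)
    (Q' : term R W -> term R W -> Prop) (A : pzAlgType R) (k : V -> A) (l : W -> A) :
  linear k -> (forall s t, Q s t -> teval k s = teval k t) ->
  linear l -> (forall s t, Q' s t -> teval l s = teval l t) ->
  (forall x y, k x * l y = l y * k x) ->
  forall (a : tquot Q) (b : tquot Q'), plift k a * plift l b = plift l b * plift k a.
Proof.
move=> lk kQ ll lQ kl a b; have hk := tlift_hom lk kQ; have hl := tlift_hom ll lQ.
elim/presented_ind: a => [x||||z z'|c z].
- elim/presented_ind: b => [y||||t t'|c t].
  + by rewrite (tlift_gen lk kQ) (tlift_gen ll lQ).
  + by rewrite (lin0 (hom_lin hl)) mulr0 mul0r.
  + by rewrite (hom1 hl) mulr1 mul1r.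
  + by move=> t t' Ht Ht'; rewrite (linD (hom_lin hl)) mulrDr mulrDl Ht Ht'.
  + by move=> Ht Ht'; rewrite (homM hl) mulrA Ht -mulrA Ht' mulrA.
  + by move=> Ht; rewrite (linZ (hom_lin hl)) -pzscalerAr -pzscalerAl Ht.
- by rewrite (lin0 (hom_lin hk)) mulr0 mul0r.
- by rewrite (hom1 hk) mulr1 mul1r.
- by move=> z z' Ht Ht'; rewrite (linD (hom_lin hk)) mulrDr mulrDl Ht Ht'.
- by move=> Ht Ht'; rewrite (homM hk) -mulrA Ht' mulrA Ht mulrA.
- by move=> Ht; rewrite (linZ (hom_lin hk)) -pzscalerAr -pzscalerAl Ht.
Qed.

Lemma tquot_words (V : lmodType R) (Q : term R V -> term R V -> Prop)
    (I : finType) (e : I -> V) (c : I -> V -> R) :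
  (forall x, x = \sum_i c i x *: e i) ->
  forall z : tquot Q,
  span [set z | exists w : seq I, z = \prod_(i <- w) tgen Q (e i)] z.
Proof.
move=> ex; elim/presented_ind => [x||||x y|a x].
- rewrite (ex x) -/(tgen Q _) (lin_sum (@tgen_lin _ Q)).
  apply: (submod_sum (span_submod _)) => i _.
  rewrite (linZ (@tgen_lin _ Q)); apply: (submodZ (span_submod _)).
  by apply: mem_span; exists [:: i]; rewrite big_seq1.
- exact: (submod0 (span_submod _)).
- by apply: mem_span; exists [::]; rewrite big_nil.
- exact: (submodD (span_submod _)).
- apply: span_mul => _ _ [w ->] [w' ->]; apply: mem_span.
  by exists (w ++ w'); rewrite big_cat.
- exact: (submodZ (span_submod _)).
Qed.

(** One statement for commuting ([c = 1]) and anticommuting ([c = -1]) letters. The exponent stays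
    existential because only spans are at stake. *)
Lemma perm_prod_scalar (A : pzAlgType R) (I : eqType) (y : I -> A) (c : R) :
  (forall i j, y i * y j = c *: (y j * y i)) -> forall w w', perm_eq w w' ->
  exists k, \prod_(i <- w) y i = c ^+ k *: \prod_(i <- w') y i.
Proof.
move=> yC; elim=> [|i w IH] w'.
  by move=> /perm_size/esym/size0nil ->; exists 0%N; rewrite expr0 scale1r.
move=> wp; have iw : i \in w' by rewrite -(perm_mem wp) mem_head.
move: wp; case/splitPr: iw => w1 w2 wp.
have [|k ek] := IH (w1 ++ w2).
  by rewrite -(perm_cons i) (perm_trans wp)// -cat1s perm_catCA.
have [l el] : exists l, y i * \prod_(j <- w1) y j = c ^+ l *: (\prod_(j <- w1) y j * y i).
  elim: w1 {wp ek IH} => [|j w1 [l IH]].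
    by exists 0%N; rewrite !big_nil mulr1 mul1r expr0 scale1r.
  exists l.+1; rewrite !big_cons mulrA yC -pzscalerAl -mulrA IH -pzscalerAr scalerA.
  by rewrite mulrA exprS.
exists (k + l)%N; rewrite big_cons ek -pzscalerAr big_cat mulrA el -pzscalerAl scalerA -exprD.
by rewrite big_cat big_cons -mulrA.
Qed.

Section Tensors.
Variables (A B : pzAlgType R).

Lemma tens_linl (b : B) : linear (fun a : A => tens a b).
Proof. by move=> c a a'; apply: tensDl. Qed.
Lemma tens_linr (a : A) : linear (fun b : B => tens a b).
Proof. by move=> c b b'; apply: tensDr. Qed.

Lemma inl_hom : alg_hom (fun a : A => tens a (1 : B)).
Proof.
by split; [apply: tens_linl | split=> [|a a']; rewrite ?tens1 ?tensM ?mulr1].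
Qed.
Lemma inr_hom : alg_hom (fun b : B => tens (1 : A) b).
Proof.
by split; [apply: tens_linr | split=> [|b b']; rewrite ?tens1 ?tensM ?mulr1].
Qed.

Lemma tensE (a : A) (b : B) : tens a b = tens a 1 * tens 1 b.
Proof. by rewrite tensM mulr1 mul1r. Qed.
Lemma tens_comm (a : A) (b : B) : tens a 1 * tens 1 b = tens 1 b * tens a 1.
Proof. by rewrite !tensM !mulr1 !mul1r. Qed.

Section Lift.
Variables (C : pzAlgType R) (h : A -> C) (k : B -> C).
Hypotheses (hh : alg_hom h) (hk : alg_hom k).
Hypothesis hk_comm : forall a b, h a * k b = k b * h a.

Lemma tens_lift_rel s t : tens_rel s t ->
  teval (fun z : A * B => h z.1 * k z.2) s = teval (fun z => h z.1 * k z.2) t.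
Proof.
case=> [c a a' b|c a b b'|a b a' b'|] /=.
- by rewrite (hom_lin hh) mulrDl pzscalerAl.
- by rewrite (hom_lin hk) mulrDr pzscalerAr.
- by rewrite (homM hh) (homM hk) -!mulrA; congr (_ * _); rewrite !mulrA hk_comm.
- by rewrite (hom1 hh) (hom1 hk) mulr1.
Qed.

Definition tens_lift : tensor A B -> C := plift (fun z => h z.1 * k z.2).

Lemma tens_lift_hom : alg_hom tens_lift.
Proof. exact: plift_hom tens_lift_rel. Qed.

Lemma tens_liftE a b : tens_lift (tens a b) = h a * k b.
Proof. exact: (plift_gen tens_lift_rel). Qed.

End Lift.

Lemma tens_span2 (S : set A) (T : set B) a b : span S a -> span T b ->
  span [set z | exists a b, [/\ S a, T b & z = tens a b]] (tens a b).
Proof.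
move=> Sa Tb; set U := [set z | _].
apply: (Sa [set a | span U (tens a b)]).
  exact: submod_preim (@tens_linl b) (span_submod U).
move=> a' Sa' /=; apply: (Tb [set b | span U (tens a' b)]).
  exact: submod_preim (@tens_linr a') (span_submod U).
by move=> b' Tb'; apply: mem_span; exists a', b'.
Qed.

Lemma tens_span (S : set A) (T : set B) :
  (forall a, span S a) -> (forall b, span T b) ->
  forall z : tensor A B, span [set z | exists a b, [/\ S a, T b & z = tens a b]] z.
Proof.
move=> hS hT; elim/presented_ind => [[a b]||||x y|a x].
- exact: tens_span2.
- exact: (submod0 (span_submod _)).
- by rewrite -tens1; apply: tens_span2.
- exact: (submodD (span_submod _)).
- by apply: span_mul => _ _ [a [b [_ _ ->]]] [a' [b' [_ _ ->]]]; rewrite tensM; apply: tens_span2.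
- exact: (submodZ (span_submod _)).
Qed.

End Tensors.

End AlgebraMorphisms.

(** * The associated graded of a filtered G-differential algebra *)

Section Extension.
Variables (R : pzRingType) (B : pzAlgType R).

Lemma fext_submod (A : nat -> set B) : (forall k, submod (A k)) ->
  forall k, submod (fext A k).
Proof.
move=> sA [m|m]; first exact: sA.
by split=> [//|a x y /= -> ->]; rewrite scaler0 addr0.
Qed.

Variable F : filtration B.

Lemma filt_fext_submod k : submod (fext F k).
Proof. exact: (fext_submod (filt_submod F)). Qed.

Lemma fext_mul k l b c : fext F k b -> fext F l c -> fext F (k + l) (b * c).
Proof.
case: k => [k|k] Fb; last first.
  by rewrite (Fb : b = 0) mul0r => _; exact: (submod0 (filt_fext_submod _)).
case: l => [l|l] Fc; last first.
  by rewrite (Fc : c = 0) mulr0; exact: (submod0 (filt_fext_submod _)).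
by rewrite -PoszD; apply: filt_mul.
Qed.

Lemma fext_incr (k : int) b : fext F k b -> fext F (k + 1) b.
Proof.
case: k => [k|k] Fb; last by rewrite (Fb : b = 0); exact: (submod0 (filt_fext_submod _)).
by rewrite -[1%R]/(Posz 1) -PoszD addn1; apply: filt_incr.
Qed.

End Extension.

Section GradedCoefficients.
Variables (R : pzRingType) (B : pzAlgType R) (F : filtration B).
Implicit Types (x y : gr F) (j k l : nat).

Lemma filtp_submod j : submod (filtp F j). Proof. exact: filt_fext_submod. Qed.

Lemma filtp_trans j (b c d : B) :
  filtp F j (b - c) -> filtp F j (c - d) -> filtp F j (b - d).
Proof.
by move=> bc cd; rewrite -(subrK c b) -addrA; apply: (submodD (filtp_submod j)).
Qed.
Lemma filtp_sym j (b c : B) : filtp F j (b - c) -> filtp F j (c - b).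
Proof. by move=> /(submodN (filtp_submod j)); rewrite opprB. Qed.

(* A representative in F_j of the degree j component. *)
Definition grc x (j : nat) : B := rcoef (sa_repr x : rees F) j.

Lemma grcF x j : F j (grc x j). Proof. exact: rcoefP. Qed.

Lemma gr_eqP x y : (forall j, filtp F j (grc x j - grc y j)) <-> x = y.
Proof.
split=> [xy|-> j]; last by rewrite subrr; exact: filtp0.
by rewrite -(sa_reprK x) -(sa_reprK y); apply/sa_piP.
Qed.

Lemma grc_pi (p : rees F) j : filtp F j (grc (gr_pi p) j - rcoef p j).
Proof. exact: (@sa_repr_pi R (rees_setoidAlg F) p j). Qed.

Lemma grc_lin a x y j : filtp F j (grc (a *: x + y) j - (a *: grc x j + grc y j)).
Proof.
have h1 : filtp F j (grc (a *: x + y) j -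
    rcoef (reesD (sa_repr (a *: x) : rees F) (sa_repr y)) j).
  exact: (@sa_repr_pi R (rees_setoidAlg F) (reesD _ _) j).
have h2 : filtp F j (grc (a *: x) j - rcoef (reesZ a (sa_repr x : rees F)) j).
  exact: (@sa_repr_pi R (rees_setoidAlg F) (reesZ _ _) j).
apply: filtp_trans h1 _; rewrite rcoefD opprD addrACA subrr addr0.
by apply: filtp_trans h2 _; rewrite rcoefZ subrr; exact: filtp0.
Qed.

Lemma grc0 j : filtp F j (grc 0 j).
Proof. by have := grc_pi (rees0 F) j; rewrite subr0. Qed.

Lemma grc_symb k (b : B) j : F k b -> filtp F j (grc (symb F k b) j - rees_single k b j).
Proof.
by move=> Fb; have := grc_pi (mkrees F (rees_single k b)) j; rewrite rcoef_mkrees//;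
  apply: rees_singleP.
Qed.

Lemma symb_eq k (b c : B) : F k b -> F k c -> filtp F k (b - c) -> symb F k b = symb F k c.
Proof.
move=> Fb Fc bc; apply/gr_eqP => j; apply: filtp_trans (grc_symb _ Fb) _.
apply: filtp_sym; apply: filtp_trans (grc_symb _ Fc) _; apply: filtp_sym.
by rewrite /rees_single; case: eqP => [->//|_]; rewrite subrr; exact: filtp0.
Qed.

Lemma symb_lin k a (b c : B) : F k b -> F k c ->
  symb F k (a *: b + c) = a *: symb F k b + symb F k c.
Proof.
move=> Fb Fc; apply/gr_eqP => j; apply: filtp_trans (grc_symb _ (filtZD a Fb Fc)) _.
apply: filtp_sym; apply: filtp_trans (grc_lin _ _ _ _) _.
rewrite (_ : rees_single _ _ _ = a *: rees_single k b j + rees_single k c j); last first.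
  by rewrite /rees_single; case: eqP; rewrite ?scaler0 ?addr0.
rewrite opprD addrACA -scalerBr; apply: (submodD (filtp_submod j)); last exact: grc_symb.
by apply: (submodZ (filtp_submod j)); apply: grc_symb.
Qed.

Lemma symb0 k : symb F k 0 = 0.
Proof.
apply/gr_eqP => j; apply: filtp_trans (grc_symb _ (filt0 F k)) _.
apply: filtp_sym; rewrite /rees_single if_same subr0; exact: grc0.
Qed.

Lemma symb_filtp k (b : B) : F k b -> symb F k b = 0 <-> filtp F k b.
Proof.
move=> Fb; split=> [b0|b0]; last first.
  by rewrite (symb_eq Fb (filt0 F k)) ?symb0// subr0.
have := grc_symb k Fb; rewrite b0 /rees_single eqxx => /filtp_sym h.
by rewrite -(subr0 b); apply: filtp_trans h _; rewrite subr0; exact: grc0.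
Qed.

Lemma symb1 : symb F 0 1 = 1. Proof. by []. Qed.

Lemma symbM k l (b c : B) : F k b -> F l c ->
  symb F k b * symb F l c = symb F (k + l) (b * c).
Proof.
move=> Fb Fc; rewrite -[LHS]/(saq_mul (gr_pi _) (gr_pi _)) saq_mulE.
apply/sa_piP/rees_eqP; rewrite [LHS]rcoefM !rcoef_mkrees; try exact: rees_singleP.
  apply/funext => j; rewrite /cauchy /rees_single; case: eqP => [->|/eqP jkl].
    have kl : (k < (k + l).+1)%N by rewrite ltnS leq_addr.
    rewrite (bigD1 (Ordinal kl)) //= eqxx addKn eqxx big1 ?addr0// => i ik.
    by rewrite -val_eqE /= in ik; rewrite (negPf ik) mul0r.
  apply: big1 => i _; case: eqP => [ik|_]; last by rewrite mul0r.
  case: eqP => [jl|_]; last by rewrite mulr0.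
  by move: jkl; rewrite -ik -jl subnKC ?eqxx// -ltnS.
by apply: rees_singleP; apply: filt_mul.
Qed.

Lemma symb_sum k I r (P : pred I) (G : I -> B) : (forall i, P i -> F k (G i)) ->
  symb F k (\sum_(i <- r | P i) G i) = \sum_(i <- r | P i) symb F k (G i).
Proof.
move=> FG; elim: r => [|i r IH]; first by rewrite !big_nil symb0.
rewrite !big_cons; case: ifP => // Pi.
rewrite -[G i]scale1r symb_lin ?scale1r ?IH//; first exact: FG.
by apply: (submod_sum (filt_submod F k)) => j /FG.
Qed.

Lemma symbZ k a (b : B) : F k b -> symb F k (a *: b) = a *: symb F k b.
Proof. by move=> Fb; rewrite -[a *: b]addr0 symb_lin ?symb0 ?addr0//; apply: filt0. Qed.

Lemma grc_sum N (p : nat -> B) : (forall k, F k (p k)) -> forall j,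
  filtp F j (grc (\sum_(k < N) symb F k (p k)) j - (if (j < N)%N then p j else 0)).
Proof.
move=> Fp j; elim: N => [|N IH]; first by rewrite big_ord0 subr0; exact: grc0.
rewrite big_ord_recr /= -[X in grc (X + _)]scale1r.
apply: filtp_trans (grc_lin _ _ _ _) _; rewrite scale1r.
have -> : (if (j < N.+1)%N then p j else 0) =
    (if (j < N)%N then p j else 0) + rees_single N (p N) j.
  by rewrite /rees_single ltnS leq_eqVlt; case: (ltngtP j N) => [_|_|->] /=; rewrite ?addr0 ?add0r.
by rewrite opprD addrACA; apply: (submodD (filtp_submod j)) => //; apply: grc_symb.
Qed.

Lemma gr_sum x : exists N, x = \sum_(k < N) symb F k (grc x k).
Proof.
have [N xN] := rcoef_fin (sa_repr x : rees F); exists N.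
apply/gr_eqP => j; apply: filtp_sym; apply: filtp_trans (grc_sum N (grcF x) j) _.
case: ltnP => [_|/xN]; first by rewrite subrr; exact: filtp0.
by rewrite -/(grc x j) => ->; rewrite subrr; exact: filtp0.
Qed.

(** Every element is a finite sum of symbols, so identities on [gr F] need only be checked on
    symbols, where induced operators are computed by [gr_op_symb]. *)
Lemma gr_ext (V : lmodType R) (h h' : gr F -> V) : linear h -> linear h' ->
  (forall k b, F k b -> h (symb F k b) = h' (symb F k b)) -> h =1 h'.
Proof.
move=> lh lh' e x; have [N ->] := gr_sum x.
by rewrite (lin_sum lh) (lin_sum lh'); apply: eq_bigr => k _; apply/e/grcF.
Qed.

Lemma gr_degE k x : gr_deg F k x -> x = symb F k (grc x k).
Proof.
move=> [b Fb ->]; apply: symb_eq => //; first exact: grcF.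
by apply: filtp_sym; have := grc_symb k Fb; rewrite /rees_single eqxx.
Qed.

Lemma gr_deg_submod k : submod (gr_deg F k).
Proof.
split; first by exists 0; [exact: filt0 | rewrite symb0].
move=> a _ _ [b Fb ->] [c Fc ->]; exists (a *: b + c); first exact: filtZD.
by rewrite symb_lin.
Qed.

Lemma gr_grading_direct N (p : nat -> gr F) : (forall k, gr_deg F k (p k)) ->
  \sum_(k < N) p k = 0 -> forall k, (k < N)%N -> p k = 0.
Proof.
move=> dp s0 k kN; have /gr_degE -> := dp k.
have Fp j : F j (grc (p j) j) by exact: grcF.
apply/(symb_filtp (Fp k)).
have sE : \sum_(j < N) symb F j (grc (p j) j) = 0.
  by apply: etrans s0; apply: eq_bigr => j _; rewrite -gr_degE.
have := grc_sum N Fp k; rewrite kN sE => /filtp_sym h.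
by rewrite -(subr0 (grc _ _)); apply: filtp_trans h _; rewrite subr0; exact: grc0.
Qed.

End GradedCoefficients.

Lemma gr_grading (R : realFieldType) (B : pzAlgType R) (F : filtration B) :
  is_grading (gr_deg F).
Proof.
split.
- exact: gr_deg_submod.
- by exists 1; [exact: filt_1 | rewrite symb1].
- move=> k l _ _ [b Fb ->] [c Fc ->]; exists (b * c); first exact: filt_mul.
  by rewrite symbM.
- move=> x; have [N xN] := gr_sum x; exists N, (fun k => symb F k (grc x k)).
  by split=> // k; exists (grc x k); first exact: grcF.
- exact: gr_grading_direct.
Qed.

(* Classes in F_k / F_(k-1) for arbitrary k, with F_k = 0 for k < 0. *)
Definition symbz (R : pzRingType) (B : pzAlgType R) (F : filtration B) (k : int) (b : B) :
  gr F := if k is Posz m then symb F m b else 0.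

(** * Operators induced on the associated graded algebra *)

Section InducedOperators.
Variables (R : realFieldType) (B : pzAlgType R) (F : filtration B).
Implicit Types (k r s : int).

Lemma symbz_lin k a b c : fext F k b -> fext F k c ->
  symbz F k (a *: b + c) = a *: symbz F k b + symbz F k c.
Proof.
case: k => [k|k] Fb Fc; first exact: symb_lin.
by rewrite /symbz scaler0 addr0.
Qed.

Lemma symbz0 k : symbz F k 0 = 0.
Proof. by case: k => // k; apply: symb0. Qed.

Lemma symbzZ k a b : fext F k b -> symbz F k (a *: b) = a *: symbz F k b.
Proof.
move=> Fb; rewrite -[a *: b]addr0 symbz_lin ?symbz0 ?addr0//.
exact: (submod0 (filt_fext_submod F k)).
Qed.
Lemma symbzD k b c : fext F k b -> fext F k c ->
  symbz F k (b + c) = symbz F k b + symbz F k c.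
Proof. by move=> Fb Fc; rewrite -[b]scale1r symbz_lin// !scale1r. Qed.
Lemma symbz_sum k I (t : seq I) (P : pred I) (G : I -> B) :
  (forall i, P i -> fext F k (G i)) ->
  symbz F k (\sum_(i <- t | P i) G i) = \sum_(i <- t | P i) symbz F k (G i).
Proof.
case: k => k FG; first exact: symb_sum.
by rewrite /symbz big1_eq.
Qed.

Lemma symbzM k l b c : fext F k b -> fext F l c ->
  symbz F k b * symbz F l c = symbz F (k + l) (b * c).
Proof.
case: k => [k|k] Fb; last by rewrite (Fb : b = 0) /= !mul0r symbz0.
case: l => [l|l] Fc; last by rewrite (Fc : c = 0) /= !mulr0 symbz0.
by rewrite -PoszD; apply: symbM.
Qed.

Section OneOperator.
Variables (r : int) (D : B -> B).
Hypotheses (lin_D : linear D) (deg_D : has_degree F r D).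

Lemma filtp_deg j b : filtp F j b -> fext F (j%:Z + r - 1) (D b).
Proof. by move=> /deg_D; rewrite addrAC. Qed.

Lemma gr_op_seq (p : rees F) : rees_axiom F
  (fun j : nat => if j%:Z - r is Posz i then D (rcoef p i) else 0).
Proof.
split=> [j|].
  case e: (j%:Z - r) => [i|i]; last exact: filt0.
  suff : fext F j (D (rcoef p i)) by [].
  by rewrite (_ : (j : int) = i%:Z + r); [apply/deg_D/rcoefP | rewrite -e subrK].
(* From N + |r| on, the shifted index j - r is at least N, whatever the sign of r. *)
have [N pN] := rcoef_fin p; exists (N + `|r|)%N => j Nj.
case e: (j%:Z - r) => [i|//].
by rewrite pN ?(lin0 lin_D)//; lia.
Qed.

Lemma gr_op_coef x j : filtp F j
  (grc (gr_op F r D x) j - (if j%:Z - r is Posz i then D (grc x i) else 0)).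
Proof.
by have := grc_pi (mkrees F (fun j : nat => if j%:Z - r is Posz i then
  D (rcoef (sa_repr x : rees F) i) else 0)) j;
  rewrite rcoef_mkrees//; apply: gr_op_seq.
Qed.

Lemma D_filtp (j i : nat) b : j%:Z - r = i -> filtp F i b -> filtp F j (D b).
Proof.
by move=> /(canRL (subrK _)) e /filtp_deg; rewrite -e.
Qed.

Lemma gr_op_lin : linear (gr_op F r D).
Proof.
move=> a x y; apply/gr_eqP => j; apply: filtp_trans (gr_op_coef _ _) _.
apply: filtp_sym; apply: filtp_trans (grc_lin _ _ _ _) _.
have hx := gr_op_coef x j; have hy := gr_op_coef y j.
apply: (@filtp_trans _ _ _ _ _ (a *: (if j%:Z - r is Posz i then D (grc x i) else 0) +
   (if j%:Z - r is Posz i then D (grc y i) else 0))).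
  rewrite opprD addrACA -scalerBr; apply: (submodD (filtp_submod F j)) => //.
  exact: (submodZ (filtp_submod F j)).
case e: (j%:Z - r) => [i|i]; last by rewrite scaler0 addr0 subrr; exact: filtp0.
rewrite -lin_D -(linB lin_D); apply: (D_filtp e); apply: filtp_sym.
exact: grc_lin.
Qed.

(** The value is a [symbz] because k + r may be negative, in which case [deg_D] forces [D b = 0]. *)
Lemma gr_op_symb (k : nat) b : F k b -> gr_op F r D (symb F k b) = symbz F (k%:Z + r) (D b).
Proof.
move=> Fb; apply/gr_eqP => j; apply: filtp_trans (gr_op_coef _ _) _.
apply: (@filtp_trans _ _ _ _ _ (if j%:Z - r == k then D b else 0)).
  case e: (j%:Z - r) => [i|i] /=; last by rewrite subrr; exact: filtp0.
  have := grc_symb i Fb; rewrite /rees_single -eqz_nat; case: eqP => _ h.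
    by rewrite -(linB lin_D); apply: D_filtp e _.
  by rewrite subr0; apply: D_filtp e _; rewrite -(subr0 (grc _ _)).
have FDb : fext F (k%:Z + r) (D b) by exact: deg_D.
apply: filtp_sym; rewrite /symbz.
case e: (k%:Z + r) FDb => [m|m] /= FDb.
  apply: filtp_trans (grc_symb _ FDb) _; rewrite /rees_single.
  rewrite (_ : (j == m) = (j%:Z - r == k)); first by rewrite subrr; exact: filtp0.
  by rewrite subr_eq e.
rewrite (_ : (j%:Z - r == k) = false) ?subr0; first exact: grc0.
by rewrite subr_eq e.
Qed.

Lemma gr_op_symbz k b : fext F k b -> gr_op F r D (symbz F k b) = symbz F (k + r) (D b).
Proof.
case: k => [k|k] Fb; first exact: gr_op_symb.
by rewrite (Fb : b = 0) /= (lin0 gr_op_lin) (lin0 lin_D) symbz0.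
Qed.

Lemma gr_op_deg : has_degree (gr_deg F) r (gr_op F r D).
Proof.
have sub0 k : fext (gr_deg F) k 0 := submod0 (fext_submod (gr_deg_submod F) k).
move=> [k|k] x; last by move=> ->; rewrite (lin0 gr_op_lin).
move=> [b Fb ->]; rewrite gr_op_symb//; have := deg_D (Fb : fext F k b).
rewrite /symbz; case: (_ + r) => m //= FDb.
by exists (D b).
Qed.

End OneOperator.

Lemma eq_gr_op r D E : D =1 E -> gr_op F r D =1 gr_op F r E.
Proof. by move=> /funext ->. Qed.

Lemma gr_op0 r : gr_op F r (fun=> 0) =1 fun=> 0.
Proof.
have lin_0 : linear (fun=> 0 : B) by move=> ? ? ?; rewrite scaler0 addr0.
have deg_0 : has_degree F r (fun=> 0).
  by move=> k b _; exact: (submod0 (filt_fext_submod F _)).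
apply: gr_ext; first exact: gr_op_lin.
  by move=> ? ? ?; rewrite scaler0 addr0.
by move=> k b Fb; rewrite gr_op_symb// symbz0.
Qed.

Lemma gr_op_comb r (I : finType) (c : I -> R) (D : I -> B -> B) :
  (forall i, linear (D i)) -> (forall i, has_degree F r (D i)) ->
  forall x, gr_op F r (fun b => \sum_i c i *: D i b) x = \sum_i c i *: gr_op F r (D i) x.
Proof.
move=> lD dD.
have deg_s : has_degree F r (fun b => \sum_i c i *: D i b).
  move=> k b Fb; apply: (submod_sum (filt_fext_submod F _)) => i _.
  by apply: (submodZ (filt_fext_submod F _)); apply: dD.
have lin_s : linear (fun b => \sum_i c i *: D i b).
  move=> a x y; rewrite scaler_sumr -big_split; apply: eq_bigr => i _ /=.
  by rewrite lD scalerDr !scalerA mulrC.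
apply: gr_ext; first exact: gr_op_lin.
  move=> a x y; rewrite scaler_sumr -big_split; apply: eq_bigr => i _ /=.
  by rewrite gr_op_lin// scalerDr !scalerA mulrC.
move=> k b Fb; rewrite gr_op_symb// symbz_sum; last first.
  by move=> i _; apply: (submodZ (filt_fext_submod F _)); apply: dD.
apply: eq_bigr => i _; rewrite gr_op_symb// symbzZ//; exact: dD.
Qed.

(** Taking symbols is compatible with composition and degrees add. Each commutation relation on [B]
    thus passes to [gr F]. *)
Lemma gr_opcomm p q r s D E :
  linear D -> linear E -> has_degree F r D -> has_degree F s E ->
  opcomm p q (gr_op F r D) (gr_op F s E) =1 gr_op F (r + s) (opcomm p q D E).
Proof.
move=> lD lE dD dE.
have deg_DE : has_degree F (r + s) (opcomm p q D E).
  move=> k b Fb; apply: (submodD (filt_fext_submod F _)).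
    by rewrite (addrC r) addrA; apply/dD/dE.
  apply/(submodN (filt_fext_submod F _))/(submodZ (filt_fext_submod F _)).
  by rewrite addrA; apply/dE/dD.
have lin_DE (C : pzAlgType R) (X Y : C -> C) : linear X -> linear Y ->
    linear (opcomm p q X Y).
  move=> lX lY a x y; rewrite /opcomm lY lX lX lY scalerDr scalerBr opprD.
  by rewrite addrACA !scalerA (mulrC a).
have lgD := gr_op_lin lD dD; have lgE := gr_op_lin lE dE.
apply: gr_ext; [exact: lin_DE | apply: gr_op_lin => //; exact: lin_DE |].
move=> k b Fb; rewrite [RHS]gr_op_symb//; last exact: lin_DE.
have FE := dE _ _ (Fb : fext F k b); have FD := dD _ _ (Fb : fext F k b).
rewrite /opcomm (gr_op_symb lE dE Fb) (gr_op_symb lD dD Fb) !gr_op_symbz//.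
have FDE := dD _ _ FE; have FED := dE _ _ FD.
have e1 : k%:Z + s + r = k%:Z + (r + s) by rewrite addrAC addrA.
have e2 : k%:Z + r + s = k%:Z + (r + s) by rewrite addrA.
rewrite e1 in FDE *; rewrite e2 in FED *; rewrite -!scaleNr symbzD// ?symbzZ//.
exact: (submodZ (filt_fext_submod F _)).
Qed.

Variables (eps : B -> B) (par_eps : is_parity eps) (deg_eps : has_degree F 0 eps).

Lemma gr_parity : is_parity (gr_op F 0 eps).
Proof.
have [le me ie] := par_eps; have lg := gr_op_lin le deg_eps.
have Fe (k : nat) b : F k b -> F k (eps b).
  by move=> Fb; have := deg_eps (Fb : fext F k b); rewrite addr0.
have E (k : nat) b : F k b -> gr_op F 0 eps (symb F k b) = symb F k (eps b).
  by move=> Fb; rewrite gr_op_symb// addr0.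
split=> //.
  split=> [|x y]; first by rewrite -symb1 E ?me.1//; apply: filt_1.
  have lx (z : gr F) : linear (fun x : gr F => gr_op F 0 eps (x * z)).
    by move=> a u v; rewrite mulrDl -pzscalerAl lg.
  have lx' (z : gr F) : linear (fun x : gr F => gr_op F 0 eps x * z).
    by move=> a u v; rewrite lg mulrDl -pzscalerAl.
  move: x; apply: gr_ext => // k b Fb; move: y.
  apply: gr_ext; [by move=> a u v; rewrite mulrDr -pzscalerAr lg |
    by move=> a u v; rewrite lg mulrDr -pzscalerAr |] => l c Fc.
  by rewrite symbM// !E ?symbM ?me.2//; [exact: Fe | exact: Fe | exact: filt_mul].
apply: gr_ext => [a u v|//|k b Fb]; first by rewrite !lg.
by rewrite !E ?ie//; apply: Fe.
Qed.

Lemma gr_derivation p r D : is_derivation eps p D -> has_degree F r D ->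
  is_derivation (gr_op F 0 eps) p (gr_op F r D).
Proof.
move=> [lD De DM] dD.
have [le me ie] := par_eps; have lge := gr_op_lin le deg_eps.
have lg := gr_op_lin lD dD.
have Fe k b : fext F k b -> fext F k (eps b).
  by move=> Fb; have := deg_eps Fb; rewrite addr0.
have E k b : fext F k b -> gr_op F 0 eps (symbz F k b) = symbz F k (eps b).
  by move=> Fb; rewrite gr_op_symbz// addr0.
have G k b : fext F k b -> gr_op F r D (symbz F k b) = symbz F (k + r) (D b).
  exact: gr_op_symbz.
split=> //.
  apply: gr_ext => [a u v|a u v|k b Fb]; first by rewrite lge lg.
    by rewrite lg lge scalerDr !scalerA mulrC.
  rewrite -/(symbz F k b) E ?G ?E ?De; try by [exact: Fb | apply: dD | apply: Fe].
  by rewrite symbzZ//; apply/Fe/dD.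
move=> x y; move: x; apply: gr_ext.
- by move=> a u v; rewrite mulrDl -pzscalerAl lg.
- move=> a u v; rewrite lg mulrDl -pzscalerAl (fun_if (fun z => z * _)).
  by rewrite lge !mulrDl -!pzscalerAl; case: p {De DM}; rewrite scalerDr addrACA.
move=> k b Fb; move: y; apply: gr_ext.
- by move=> a u v; rewrite mulrDr -pzscalerAr lg.
- by move=> a u v; rewrite lg !mulrDr -!pzscalerAr scalerDr addrACA.
move=> l c Fc; rewrite -/(symbz F k b) -/(symbz F l c).
have FDb : fext F (k%:Z + r) (D b) := dD _ _ (Fb : fext F k b).
have FDc : fext F (l%:Z + r) (D c) := dD _ _ (Fc : fext F l c).
have Feb := Fe _ _ (Fb : fext F k b).
rewrite symbzM// !G ?E//; last by apply: fext_mul.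
have -> : (if p then symbz F k (eps b) else symbz F k b) =
   symbz F k (if p then eps b else b) by case: p {De DM}.
have Fpb : fext F k (if p then eps b else b) by case: p {De DM}.
have FDbc := fext_mul FDb (Fc : fext F l c).
have FbDc := fext_mul Fpb FDc.
rewrite !symbzM// DM; rewrite addrAC in FDbc *; rewrite addrA in FbDc *.
by rewrite symbzD.
Qed.

End InducedOperators.

Lemma gr_graded_gda (R : realFieldType) n (f : 'I_n -> 'I_n -> 'I_n -> R)
    (B : pzAlgType R) (F : filtration B) (o : gda_ops B n) :
  is_filtered_gda f F o -> is_graded_gda f (gr_deg F) (gr_ops F o).
Proof.
case=> -[Pp Pi Pl Pd Hli Hll Hid Hii Hld Hdd] Dp Gp Di Dl Dd.
have lin_of p D : is_derivation (par o) p D -> linear D by case.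
have li a := lin_of _ _ (Pi a); have ll a := lin_of _ _ (Pl a).
have ld := lin_of _ _ Pd; have [lp _ _] := Pp.
split; [exact: gr_grading | split | exact: Gp | | |].
- exact: gr_parity.
- by move=> a; apply: gr_derivation.
- by move=> a; apply: gr_derivation.
- exact: gr_derivation.
- move=> a b x; rewrite gr_opcomm// add0r (eq_gr_op _ (Hli a b)).
  exact: gr_op_comb.
- move=> a b x; rewrite gr_opcomm// add0r (eq_gr_op _ (Hll a b)).
  exact: gr_op_comb.
- by move=> a x; rewrite gr_opcomm// addNr (eq_gr_op _ (Hid a)).
- by move=> a b x; rewrite gr_opcomm// (eq_gr_op _ (Hii a b)) gr_op0.
- by move=> a x; rewrite gr_opcomm// (eq_gr_op _ (Hld a)) gr_op0.
- by move=> x; rewrite gr_opcomm// (eq_gr_op _ Hdd) gr_op0.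
- by move=> a; apply: gr_op_deg.
- by move=> a; apply: gr_op_deg.
- exact: gr_op_deg.
Qed.

(** * Graded commutators *)

Section GradedCommutators.
Variables (R : realFieldType) (B : pzAlgType R) (eps : B -> B).
Hypothesis par_eps : is_parity eps.
Implicit Types (b c x : B) (p q : bool).

Let le : linear eps. Proof. by case: par_eps. Qed.
Let eM b c : eps (b * c) = eps b * eps c. Proof. by case: par_eps => _ []. Qed.
Let eK b : eps (eps b) = b. Proof. by case: par_eps. Qed.

Lemma halfD b : 2^-1 *: (b + b) = b.
Proof. by rewrite -mulr2n -scaler_nat scalerA mulVf ?scale1r// pnatr_eq0. Qed.

Lemma ad_evenE b c : eps b = b -> ad eps b c = b * c - c * b.
Proof.
by move=> eb; rewrite /ad /even_part /odd_part eb subrr scaler0 mulr0 subr0 halfD.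
Qed.

Lemma ad_oddE b c : eps b = - b -> ad eps b c = b * c - eps c * b.
Proof.
by move=> eb; rewrite /ad /even_part /odd_part eb subrr opprK scaler0 mulr0 subr0 halfD.
Qed.

Lemma ad_linr b : linear (ad eps b).
Proof.
move=> a c d; rewrite /ad; move: (even_part _ _) (odd_part _ _) => u v.
rewrite le !mulrDr !mulrDl -!pzscalerAr -!pzscalerAl !scalerBr !opprD.
by rewrite (addrACA (a *: (b * c))) [LHS]addrACA.
Qed.

Lemma ad_linl c : linear (ad eps ^~ c).
Proof.
move=> a b d; rewrite /ad /even_part /odd_part le.
have -> : 2^-1 *: (a *: b + d + (a *: eps b + eps d)) =
   a *: (2^-1 *: (b + eps b)) + 2^-1 *: (d + eps d).
  by rewrite addrACA -(scalerDr a) [LHS]scalerDr !scalerA (mulrC a).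
have -> : 2^-1 *: (a *: b + d - (a *: eps b + eps d)) =
   a *: (2^-1 *: (b - eps b)) + 2^-1 *: (d - eps d).
  by rewrite opprD addrACA -(scalerBr a) [LHS]scalerDr !scalerA (mulrC a).
move: (2^-1 *: _) (2^-1 *: _) (2^-1 *: _) (2^-1 *: _) => u v w z.
rewrite !mulrDr !mulrDl -!pzscalerAr -!pzscalerAl !scalerBr !opprD.
by rewrite (addrACA (a *: (b * c))) [LHS]addrACA.
Qed.

Lemma ad_derivation p b : eps b = (-1) ^+ p *: b -> is_derivation eps p (ad eps b).
Proof.
case: p => /=; rewrite ?expr0 ?expr1 ?scale1r ?scaleN1r => eb; split.
- exact: ad_linr.
- move=> c; rewrite scaleN1r !ad_oddE// (linB le) !eM eb !eK.
  by rewrite mulNr mulrN opprB opprK addrC.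
- move=> c d; rewrite !ad_oddE// eM mulrBl mulrBr !mulrA.
  by rewrite addrA subrK.
- exact: ad_linr.
- by move=> c; rewrite scale1r !ad_evenE// (linB le) !eM eb.
- move=> c d; rewrite !ad_evenE// mulrBl mulrBr !mulrA.
  by rewrite addrA subrK.
Qed.

Lemma ad_opcomm p q b c : eps b = (-1) ^+ p *: b -> eps c = (-1) ^+ q *: c ->
  opcomm p q (ad eps b) (ad eps c) =1 ad eps (ad eps b c).
Proof.
(* The bookkeeping of the graded Jacobi identity: [t] and [u] are the words with x between b and c,
   and they cancel. [cancel_odd] is the sign pattern for b and c both odd. *)
have cancel (V : zmodType) (s t u v w z : V) :
    s - t - (u - v) - (w - u - (t - z)) = s - w - (z - v).
  rewrite !opprB !addrA [LHS](ACl (1*8*3*6*(2*5)*(4*7)))%AC /=.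
  by rewrite !addNr !addr0.
have cancel_odd (V : zmodType) (s t u v w z : V) :
    s - t + (u - v) + (w - u + (t - z)) = s + w - (z + v).
  rewrite !opprD !addrA [LHS](ACl (1*5*8*4*(2*7)*(3*6)))%AC /=.
  by rewrite subrr addNr !addr0.
case: p; case: q; rewrite /= ?expr0 ?expr1 ?scale1r ?scaleN1r => eb ec x;
  rewrite /opcomm /= ?expr0 ?expr1 ?scale1r ?scaleN1r ?opprK.
- have adE : ad eps b c = b * c + c * b by rewrite ad_oddE// ec mulNr opprK.
  have ebc : eps (ad eps b c) = ad eps b c.
    by rewrite adE (linD le) !eM eb ec !mulrNN.
  have E b' c' : eps b' = - b' -> eps c' = - c' -> ad eps b' (ad eps c' x) =
      b' * c' * x - b' * eps x * c' + (c' * eps x * b' - x * c' * b').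
    move=> eb' ec'; rewrite !ad_oddE// (linB le) !eM ec' eK mulrBr mulrBl !mulrA.
    by rewrite !mulNr mulrN mulNr !opprD !opprK.
  rewrite !E// cancel_odd ad_evenE// adE mulrDl mulrDr !mulrA.
  by rewrite (addrC (x * b * c)).
- have ebc : eps (ad eps b c) = - ad eps b c.
    by rewrite ad_oddE// ec (linB le) !eM eb ec mulNr mulrN -opprD.
  rewrite (ad_oddE x ebc) (ad_oddE c eb) ec !(ad_oddE _ eb) !(ad_evenE _ ec).
  rewrite !(linB le) !eM ec !mulrBl !mulrBr !mulrA.
  exact: cancel.
- have ebc : eps (ad eps b c) = - ad eps b c.
    by rewrite ad_evenE// (linB le) !eM eb ec mulNr mulrN -opprD.
  rewrite (ad_oddE x ebc) (ad_evenE c eb) !(ad_oddE _ ec) !(ad_evenE _ eb).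
  rewrite !(linB le) !eM eb !mulrBl !mulrBr !mulrA.
  exact: cancel.
- have ebc : eps (ad eps b c) = ad eps b c by rewrite ad_evenE// (linB le) !eM eb ec.
  rewrite (ad_evenE x ebc) !(ad_evenE _ eb) !(ad_evenE _ ec) !mulrBl !mulrBr !mulrA.
  exact: cancel.
Qed.

End GradedCommutators.

(** * The non-commutative Weil algebra *)

Section NcWeilAlgebra.
Variables (R : realFieldType) (g : vectType R).
Variables (br : g -> g -> g) (ip : g -> g -> R).
Local Notation N := (ncweil br ip).
Local Notation u := (ncu br ip).
Local Notation X := (ncx br ip).
Local Notation eps := (@ncweil_par R g br ip).
Local Notation F := (ncweil_filt br ip).

Lemma ncu_lin : linear u.
Proof. by move=> a x y; rewrite /ncu tgen_lin (hom_lin (inl_hom _ _)). Qed.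
Lemma ncx_lin : linear X.
Proof. by move=> a x y; rewrite /ncx tgen_lin (hom_lin (inr_hom _ _)). Qed.

Lemma ncu_br x y : u x * u y - u y * u x = u (br x y).
Proof.
rewrite /ncu -[tgen _ (br x y)](tgen_rel (UeaRel br x y)) /= scaleN1r.
by rewrite (linB (@tens_linl _ _ _ 1)) !tensM mulr1.
Qed.

Lemma ncx_ip x y : X x * X y + X y * X x = ip x y *: (1 : N).
Proof.
rewrite /ncx !tensM !mulr1 -(linD (@tens_linr _ _ _ 1)).
have /= -> := tgen_rel (CliffRel ip x y).
by rewrite (linZ (@tens_linr _ _ _ 1)) tens1.
Qed.

Lemma ncux x y : u x * X y = X y * u x. Proof. exact: tens_comm. Qed.

Lemma cliff_par_hom : alg_hom (@cliff_par _ _ ip).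
Proof.
apply: tlift_hom => [a x y|_ _ [x y]] /=; first by rewrite tgen_lin opprD scalerN.
by rewrite !mulrNN; exact: (tgen_rel (CliffRel ip x y)).
Qed.

Lemma ncweil_parE : eps = tens_lift (fun a : uea br => tens a (1 : cliff ip))
  (fun b => tens 1 (cliff_par b)).
Proof.
by rewrite /ncweil_par /tens_lift; congr plift; apply/funext => z; rewrite tensE.
Qed.

Lemma ncweil_par_hom : alg_hom eps.
Proof.
rewrite ncweil_parE; apply: tens_lift_hom; first exact: inl_hom.
  exact: alg_hom_comp (inr_hom _ _) cliff_par_hom.
by move=> a b; apply: tens_comm.
Qed.

Lemma ncweil_par_tens a b : eps (tens a b) = tens a (cliff_par b).
Proof.
rewrite ncweil_parE tens_liftE -?tensE//; first exact: inl_hom.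
  exact: alg_hom_comp (inr_hom _ _) cliff_par_hom.
by move=> a' b'; apply: tens_comm.
Qed.

Lemma ncweil_par_u x : eps (u x) = u x.
Proof. by rewrite ncweil_par_tens (hom1 cliff_par_hom). Qed.

Lemma ncweil_par_x x : eps (X x) = - X x.
Proof.
rewrite ncweil_par_tens -(linN (@tens_linr _ _ _ 1)); congr tens.
apply: (@tlift_gen _ _ _ _ (fun x => - tgen (cliff_rel ip) x)) => [a y z|_ _ [y z]] /=.
  by rewrite tgen_lin opprD scalerN.
by rewrite !mulrNN; exact: (tgen_rel (CliffRel ip y z)).
Qed.

Lemma ncweil_ind (P : N -> Prop) :
  submod P -> P 1 -> (forall z t, P z -> P t -> P (z * t)) ->
  (forall x, P (u x)) -> (forall x, P (X x)) -> forall z, P z.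
Proof.
move=> sP P1 PM Pu Px; elim/presented_ind => [[a b]||||x y|a x].
- rewrite -/(tens a b) tensE; apply: (PM).
    elim/presented_ind: a => [x||||x y|c x].
    + exact: Pu.
    + by rewrite tens0l; exact: (submod0 sP).
    + by rewrite tens1.
    + by move=> x y Hx Hy; rewrite (linD (@tens_linl _ _ _ 1)); apply: (submodD sP).
    + by move=> Hx Hy; rewrite -[1]mulr1 -tensM; apply: (PM).
    + by move=> Hx; rewrite (linZ (@tens_linl _ _ _ 1)); apply: (submodZ sP).
  elim/presented_ind: b => [x||||x y|c x].
  + exact: Px.
  + by rewrite tens0r; exact: (submod0 sP).
  + by rewrite tens1.
  + by move=> x y Hx Hy; rewrite (linD (@tens_linr _ _ _ 1)); apply: (submodD sP).
  + by move=> Hx Hy; rewrite -[1]mulr1 -tensM; apply: (PM).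
  + by move=> Hx; rewrite (linZ (@tens_linr _ _ _ 1)); apply: (submodZ sP).
- exact: (submod0 sP).
- exact: P1.
- exact: (submodD sP).
- exact: PM.
- exact: (submodZ sP).
Qed.

Lemma ncweil_parity : is_parity eps.
Proof.
have [le me] := ncweil_par_hom; split=> //; elim/ncweil_ind.
- by split=> [|a x y /= ex ey]; rewrite ?(lin0 le)// !le ex ey.
- by rewrite !me.1.
- by move=> z t ez et; rewrite !me.2 ez et.
- by move=> x; rewrite !ncweil_par_u.
- by move=> x; rewrite !(ncweil_par_x, linN le) opprK.
Qed.

Lemma ncu_filt x : F 2%N (u x).
Proof.
apply: mem_span; exists 0%N, 1%N, (tgen _ x), 1; split=> //; last exact: tfilt1.
by apply: mem_span; exists [:: x]; rewrite ?big_seq1.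
Qed.
Lemma ncx_filt x : F 1%N (X x).
Proof.
apply: mem_span; exists 1%N, 0%N, 1, (tgen _ x); split=> //; first exact: tfilt1.
by apply: mem_span; exists [:: x]; rewrite ?big_seq1.
Qed.

Lemma ncweil_filt_words (k : nat) z : F k z ->
  span [set z | exists wu wx : seq g, (2 * size wu + size wx <= k)%N /\
    z = \prod_(x <- wu) u x * \prod_(x <- wx) X x] z.
Proof.
apply: span_min; first exact: span_submod.
move=> _ [j [m [a [b [<- Fa Gb ->]]]]].
have := tens_span2 Fa Gb; apply: span_mono => _ [_ [_ [[w wm ->] [w' wj ->] ->]]].
exists w, w'; split; first by rewrite addnC leq_add// leq_mul2l.
by rewrite tensE (hom_prod (inl_hom _ _)) (hom_prod (inr_hom _ _)).
Qed.

(** [F] is the smallest increasing multiplicative filtration with the [u x] in degree 2 and the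
    [X x] in degree 1, because it is spanned by words in these generators. Filtration statements are
    thereby reduced to generators. *)
Lemma ncweil_filt_ind (P : nat -> set N) :
  (forall k, submod (P k)) -> (forall k, P k `<=` P k.+1) -> P 0%N 1 ->
  (forall k l z t, P k z -> P l t -> P (k + l)%N (z * t)) ->
  (forall x, P 2%N (u x)) -> (forall x, P 1%N (X x)) ->
  forall k, F k `<=` P k.
Proof.
move=> sP iP P1 PM Pu Px k z /ncweil_filt_words; apply: span_min => // {}z.
case=> wu [wx [wk ->]].
have mono l m : (l <= m)%N -> P l `<=` P m.
  by move=> /subnK <-; elim: (m - l)%N => // i IH y /IH; apply: iP.
apply: mono wk _ _; apply: (PM).
  elim: wu => [|x w IH]; first by rewrite big_nil muln0.
  by rewrite big_cons mulnS; apply: (PM).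
elim: wx => [|x w IH]; first by rewrite big_nil.
by rewrite big_cons /= -add1n; apply: (PM).
Qed.

Lemma ncweil_par_deg : has_degree F 0 eps.
Proof.
have [le me] := ncweil_par_hom.
have Fe (k : nat) b : F k b -> F k (eps b).
  apply: (@ncweil_filt_ind (fun k => [set z | F k (eps z)])) => [l|l|||x|x] /=.
  - exact: (submod_preim le (filt_submod F l)).
  - by move=> z; apply: (@filt_incr _ _ F).
  - by rewrite me.1; apply: (@filt_1 _ _ F).
  - by move=> l m z t; rewrite me.2; apply: (@filt_mul _ _ F).
  - by rewrite ncweil_par_u; apply: ncu_filt.
  - by rewrite ncweil_par_x; exact: (submodN (filt_submod F 1%N) (ncx_filt x)).
move=> [k|k] b Fb; rewrite addr0; first exact: Fe.
by rewrite (Fb : b = 0) (lin0 le).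
Qed.

Lemma ncweil_par_gr k (b : N) : F k b -> filtp F k (eps b - (-1) ^+ k *: b).
Proof.
have [le me] := ncweil_par_hom.
(* Membership in [F k] is carried through the induction: the product step splits the defect into two
   terms, and each pairs the defect of one factor with the filtration degree of the other. *)
move=> Fb; suff : (F k `&` [set b | filtp F k (eps b - (-1) ^+ k *: b)]) b by case.
move: Fb; apply: (@ncweil_filt_ind (fun k => F k `&` _)) => [l|l|||x|x].
- have lin : linear (fun b => eps b - (-1) ^+ l *: b).
    move=> a x y; rewrite le scalerDr opprD addrACA scalerBr !scalerA.
    by rewrite (mulrC a).
  have [s0 sD] := submod_preim lin (filtp_submod F l).
  split=> [|a x y [Fx hx] [Fy hy]]; first by split; [exact: filt0 | exact: s0].
  by split; [exact: filtZD | exact: sD].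
- move=> z [Fz _]; split; first exact: (@filt_incr _ _ F).
  rewrite filtpE; apply: (submodD (filt_submod F l)).
    by have := ncweil_par_deg (Fz : fext F l z); rewrite addr0.
  by apply: (submodN (filt_submod F l)); apply: (submodZ (filt_submod F l)).
- split; first exact: filt_1.
  by rewrite /= me.1 expr0 scale1r subrr.
- move=> l m z t [Fz hz] [Ft ht]; split; first exact: filt_mul.
  have Fez : F l (eps z) by have := ncweil_par_deg (Fz : fext F l z); rewrite addr0.
  rewrite /= me.2 exprD -scalerA (_ : _ - _ =
    eps z * (eps t - (-1) ^+ m *: t) + (eps z - (-1) ^+ l *: z) * ((-1) ^+ m *: t)).
    apply: (submodD (filtp_submod F _)); first exact: filtpMr.
    by apply: filtpMl => //; apply: filtZ.
  by rewrite mulrBr mulrBl addrA subrK -pzscalerAl -pzscalerAr.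
- by split; [exact: ncu_filt | rewrite /= ncweil_par_u sqrrN expr1n scale1r subrr; exact: filtp0].
- split; first exact: ncx_filt.
  by rewrite /= ncweil_par_x expr1 scaleN1r opprK addNr; exact: filtp0.
Qed.

(** The Leibniz rule propagates the degree from the generators to products, the parity operator in
    its second term being of degree 0. *)
Lemma ncweil_derivation_deg r p (D : N -> N) : is_derivation eps p D ->
  (forall x, fext F (2%:Z + r) (D (u x))) -> (forall x, fext F (1%:Z + r) (D (X x))) ->
  has_degree F r D.
Proof.
move=> [lD _ DM] Du Dx.
have D1 : D 1 = 0.
  have [_ [e1 _] _] := ncweil_parity.
  have := DM 1 1; rewrite !mulr1 e1 if_same mul1r => /(congr1 (fun z => z - D 1)).
  by rewrite subrr addrK.
have Fp k z : F k z -> fext F k (if p then eps z else z).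
  case: p {DM} => // Fz.
  by have := ncweil_par_deg (Fz : fext F k z); rewrite addr0.
have Fe (k : nat) b : F k b -> fext F (k%:Z + r) (D b).
  move=> Fb; suff : (F k `&` [set b | fext F (k%:Z + r) (D b)]) b by case.
  move: Fb; apply: (@ncweil_filt_ind (fun k => F k `&` _)) => [l|l|||x|x].
  - have [s0 sD] := submod_preim lD (filt_fext_submod F (l%:Z + r)).
    split=> [|a x y [Fx hx] [Fy hy]]; first by split; [exact: filt0 | exact: s0].
    by split; [exact: filtZD | exact: sD].
  - move=> z [Fz hz]; split; first exact: (@filt_incr _ _ F).
    by rewrite /= -addn1 PoszD addrAC; exact: (@fext_incr _ _ F _ _ hz).
  - split; first exact: filt_1.
    by rewrite /= D1; exact: (submod0 (filt_fext_submod F _)).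
  - move=> l m z t [Fz hz] [Ft ht]; split; first exact: filt_mul.
    rewrite /= DM PoszD; apply: (submodD (filt_fext_submod F _)).
      by rewrite addrAC; exact: (@fext_mul _ _ F _ _ _ _ hz (Ft : fext F m t)).
    by rewrite -addrA; exact: (@fext_mul _ _ F _ _ _ _ (Fp _ _ Fz : fext F l _) ht).
  - by split; [exact: ncu_filt | exact: Du].
  - by split; [exact: ncx_filt | exact: Dx].
move=> [k|k] b Fb; first exact: Fe.
by rewrite (Fb : b = 0) (lin0 lD); exact: (submod0 (filt_fext_submod F _)).
Qed.

End NcWeilAlgebra.

(** * Orthonormal expansions and invariant tensors *)

Section OrthonormalBasis.
Variables (R : realFieldType) (g : vectType R).
Variables (br : g -> g -> g) (ip : g -> g -> R) (n : nat) (e : n.-tuple g).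
Hypotheses (ip_inner : is_inner_product ip) (e_basis : is_orthonormal_basis ip e).

Let ip_lin x : linear (ip x : g -> R^o). Proof. by case: ip_inner. Qed.

Lemma ip_expand x : x = \sum_(a < n) ip e`_a x *: e`_a.
Proof.
have [eb eo] := e_basis.
rewrite {1}(coord_basis eb (memvf x)); apply: eq_bigr => a _; congr (_ *: _).
rewrite {2}(coord_basis eb (memvf x)) (lin_sum (ip_lin e`_a)) (bigD1 a)//=.
rewrite (linZ (ip_lin _)) eo eqxx [_ *: _]mulr1 big1 ?addr0// => b ba.
by rewrite (linZ (ip_lin _)) eo eq_sym (negPf ba) [_ *: _]mulr0.
Qed.

Lemma lin_expand (V : lmodType R) (h : g -> V) : linear h ->
  forall x, h x = \sum_(a < n) ip e`_a x *: h e`_a.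
Proof.
move=> lh x; rewrite {1}(ip_expand x) (lin_sum lh).
by apply: eq_bigr => a _; rewrite (linZ lh).
Qed.

Lemma coord_ip a x : coord e a x = ip e`_a x.
Proof.
have [eb eo] := e_basis; rewrite {1}(ip_expand x) linear_sum /=.
rewrite (bigD1 a)//= big1 ?addr0 => [|b ba].
  by rewrite linearZ /= coord_free ?eqxx ?mulr1// (basis_free eb).
by rewrite linearZ /= coord_free ?(basis_free eb)// (negPf ba) mulr0.
Qed.

(** Trades sums over structure constants for brackets, so that the later computations can use
    linearity, Jacobi and invariance directly. *)
Lemma struct_const_expand (V : lmodType R) (h : g -> V) : linear h ->
  forall a b : 'I_n, h (br e`_a e`_b) = \sum_(c < n) struct_const br e a b c *: h e`_c.
Proof.
move=> lh a b; rewrite (lin_expand lh); apply: eq_bigr => c _.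
by rewrite /struct_const coord_ip.
Qed.

Hypotheses (br_lie : is_lie_bracket br) (ip_inv : is_invariant br ip).

Lemma br_antisym x y : br x y = - br y x.
Proof.
have [l r alt _] := br_lie; apply/eqP; rewrite -addr_eq0.
have := alt (x + y); rewrite (linD (l _)) !(linD (r _)) !alt add0r addr0.
by move=> ->.
Qed.

Lemma br_derivation x y z : br x (br y z) = br (br x y) z + br y (br x z).
Proof.
have [l r alt jac] := br_lie; apply/eqP; rewrite -subr_eq0; apply/eqP.
have h1 : br y (br z x) = - br y (br x z) by rewrite (br_antisym z) (linN (r y)).
have h2 : br z (br x y) = - br (br x y) z by rewrite br_antisym.
by rewrite -[RHS](jac x y z) h1 h2 opprD addrA addrAC.
Qed.

(* The tensor \sum_a e_a (x) e_a is invariant. *)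
Lemma casimir_invariant (V : lmodType R) (b : g -> g -> V) :
  (forall y, linear (b^~ y)) -> (forall x, linear (b x)) -> forall z,
  \sum_(a < n) b (br z e`_a) e`_a + \sum_(a < n) b e`_a (br z e`_a) = 0.
Proof.
move=> bl bR z.
have -> : \sum_(a < n) b (br z e`_a) e`_a =
    \sum_(a < n) \sum_(c < n) ip e`_c (br z e`_a) *: b e`_c e`_a.
  by apply: eq_bigr => a _; rewrite (lin_expand (bl _)).
have -> : \sum_(a < n) b e`_a (br z e`_a) =
    \sum_(a < n) \sum_(c < n) ip e`_a (br z e`_c) *: b e`_c e`_a.
  rewrite exchange_big; apply: eq_bigr => a _ /=; rewrite (lin_expand (bR _)).
  by apply: eq_bigr => c _.
rewrite -big_split big1// => a _; rewrite -big_split big1// => c _ /=.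
by rewrite -scalerDl (ip_sym ip_inner e`_c) ip_inv scale0r.
Qed.

End OrthonormalBasis.

(** * Contractions, Lie derivatives and differential on U(g) (x) Cl(g) *)

Section NcWeilOperators.
Variables (R : realFieldType) (g : vectType R).
Variables (br : g -> g -> g) (ip : g -> g -> R) (n : nat) (e : n.-tuple g).
Hypotheses (br_lie : is_lie_bracket br) (ip_inner : is_inner_product ip).
Hypotheses (ip_inv : is_invariant br ip) (e_basis : is_orthonormal_basis ip e).
Local Notation N := (ncweil br ip).
Local Notation u := (ncu br ip).
Local Notation X := (ncx br ip).
Local Notation eps := (@ncweil_par R g br ip).
Local Notation F := (ncweil_filt br ip).
Local Notation f := (struct_const br e).

Let xlin := @ncx_lin R g br ip.
Let ulin := @ncu_lin R g br ip.
Let brl := br_linearl br_lie.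
Let brr := br_linearr br_lie.
Let ipl x : linear (ip x : g -> R^o) := ip_linear ip_inner x.
Let ipC := ip_sym ip_inner.
Let P := ncweil_parity br ip.
Let elin : linear eps. Proof. by case: P. Qed.
Let eM b c : eps (b * c) = eps b * eps c. Proof. by case: P => _ []. Qed.

(* g_a and u_a + g_a, for arbitrary elements of g in place of e_a *)
Definition ncgx (y : g) : N := - (2^-1 *: \sum_(r < n) X e`_r * X (br y e`_r)).
Definition ncl (y : g) : N := u y + ncgx y.

Lemma ncgxE a : ncg br ip e a = ncgx e`_a.
Proof.
congr (- (_ *: _)); apply: eq_bigr => r _.
rewrite (struct_const_expand br ip_inner e_basis xlin) mulr_sumr.
by apply: eq_bigr => s _; rewrite pzscalerAr.
Qed.

Lemma ncgammaE : ncgamma br ip e =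
  - (6^-1 *: \sum_(a < n) \sum_(b < n) X e`_a * X e`_b * X (br e`_a e`_b)).
Proof.
congr (- (_ *: _)); apply: eq_bigr => a _; apply: eq_bigr => b _.
rewrite (struct_const_expand br ip_inner e_basis xlin) mulr_sumr.
by apply: eq_bigr => s _; rewrite pzscalerAr.
Qed.

Lemma ncgx_lin : linear ncgx.
Proof.
move=> a x y; rewrite /ncgx scalerN scalerA mulrC -scalerA -opprD -scalerDr.
congr (- (_ *: _)); rewrite scaler_sumr -big_split; apply: eq_bigr => r _ /=.
by rewrite brl xlin mulrDr pzscalerAr.
Qed.

Lemma ncl_lin : linear ncl.
Proof. by move=> a x y; rewrite /ncl ulin ncgx_lin scalerDr addrACA. Qed.

Lemma XXC y z : X y * X z = ip y z *: (1 : N) - X z * X y.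
Proof. by rewrite -ncx_ip addrK. Qed.

Lemma X_expand (h : g -> N) : linear h -> forall y,
  \sum_(r < n) ip y e`_r *: h e`_r = h y.
Proof.
move=> lh y; rewrite [RHS](lin_expand ip_inner e_basis lh).
by apply: eq_bigr => r _; rewrite ipC.
Qed.

(** Moving [X y] through the two factors of each summand gives two contractions. By invariance both
    sum to the same multiple of [X (br z y)], and the factor 1/2 compensates for the doubling. *)
Lemma ncgx_X z y : ncgx z * X y - X y * ncgx z = X (br z y).
Proof.
rewrite /ncgx mulNr mulrN -opprD -pzscalerAl -pzscalerAr -scalerBr.
have -> : (\sum_(r < n) X e`_r * X (br z e`_r)) * X y -
     X y * (\sum_(r < n) X e`_r * X (br z e`_r)) =
   - (\sum_(r < n) ip (br z y) e`_r *: X e`_r) - \sum_(r < n) ip y e`_r *: X (br z e`_r).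
  rewrite mulr_suml mulr_sumr -!sumrN -!big_split; apply: eq_bigr => r _ /=.
  rewrite -mulrA (XXC (br z e`_r) y) mulrA (XXC y e`_r).
  rewrite mulrBr mulrBl -!pzscalerAl -pzscalerAr mulr1 mul1r !mulrA.
  have -> : ip (br z e`_r) y = - ip (br z y) e`_r.
    by apply/eqP; rewrite -addr_eq0 (ipC (br z y)) ip_inv.
  by rewrite opprB addrA subrK scaleNr.
rewrite (X_expand xlin) (X_expand (h := fun x => X (br z x))); last first.
  by move=> a x x'; rewrite brr xlin.
by rewrite -opprD scalerN opprK halfD.
Qed.

Lemma ncgx_u z y : ncgx z * u y = u y * ncgx z.
Proof.
rewrite /ncgx mulNr mulrN -pzscalerAl -pzscalerAr mulr_suml mulr_sumr.
congr (- (_ *: _)); apply: eq_bigr => r _.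
by rewrite -mulrA -ncux mulrA -ncux mulrA.
Qed.

Lemma ncgx_even z : eps (ncgx z) = ncgx z.
Proof.
rewrite /ncgx (linN elin) (linZ elin) (lin_sum elin); congr (- (_ *: _)).
by apply: eq_bigr => r _; rewrite eM !ncweil_par_x mulrNN.
Qed.

Lemma ncl_even z : eps (ncl z) = ncl z.
Proof. by rewrite (linD elin) ncweil_par_u ncgx_even. Qed.

Lemma ncl_der z : is_derivation eps false (ad eps (ncl z)).
Proof. by apply: ad_derivation => //; rewrite ncl_even scale1r. Qed.

Lemma ncl_X z y : ad eps (ncl z) (X y) = X (br z y).
Proof.
rewrite (ad_evenE _ (ncl_even z)) mulrDl mulrDr ncux opprD addrACA subrr add0r.
exact: ncgx_X.
Qed.

Lemma ncl_u z y : ad eps (ncl z) (u y) = u (br z y).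
Proof.
rewrite (ad_evenE _ (ncl_even z)) mulrDl mulrDr ncgx_u opprD addrACA subrr addr0.
exact: ncu_br.
Qed.

Let LlinE z := let: And3 l _ _ := ncl_der z in l.
Let LM z := let: And3 _ _ m := ncl_der z in m.

Lemma ncl_gx z y : ad eps (ncl z) (ncgx y) = ncgx (br z y).
Proof.
rewrite (linN (LlinE z)) (linZ (LlinE z)) (lin_sum (LlinE z)).
under eq_bigr => r _ do rewrite LM !ncl_X.
congr (- (_ *: _)); rewrite big_split /=.
(* Invariance of the Casimir tensor moves [br z] from the first factor to the second. There it meets
   the other Leibniz term, and Jacobi turns the difference into the bracket with [br z y]. *)
have /eqP : \sum_(r < n) X (br z e`_r) * X (br y e`_r) +
    \sum_(r < n) X e`_r * X (br y (br z e`_r)) = 0.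
  apply: (casimir_invariant ip_inner e_basis ip_inv
    (b := fun a b => X a * X (br y b))) => t a x x'.
    by rewrite xlin mulrDl pzscalerAl.
  by rewrite brr xlin mulrDr pzscalerAr.
rewrite addr_eq0 => /eqP ->.
rewrite addrC -sumrB; apply: eq_bigr => r _; rewrite -mulrBr; congr (_ * _).
by rewrite -(linB xlin) (br_derivation br_lie z) addrK.
Qed.

Lemma ncl_l z y : ad eps (ncl z) (ncl y) = ncl (br z y).
Proof. by rewrite (linD (LlinE z)) ncl_u ncl_gx. Qed.

Local Notation D := (dirac br ip e).

Lemma ncl_dirac z : ad eps (ncl z) D = 0.
Proof.
rewrite /dirac (linD (LlinE z)) (lin_sum (LlinE z)).
under eq_bigr => r _ do rewrite LM ncl_X ncl_u.
rewrite big_split /= (casimir_invariant ip_inner e_basis ip_inv (b := fun a b => X a * u b)).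
- rewrite add0r ncgammaE (linN (LlinE z)) (linZ (LlinE z)).
  suff -> : ad eps (ncl z)
      (\sum_(a < n) \sum_(b < n) X e`_a * X e`_b * X (br e`_a e`_b)) = 0.
    by rewrite scaler0 oppr0.
  rewrite (lin_sum (LlinE z)).
  (* Each of the two summed basis vectors occurs once as a factor and once inside the bracket. The
     Leibniz terms are grouped by basis vector, and each group vanishes by invariance of the Casimir
     tensor. *)
  transitivity (\sum_(a < n) \sum_(b < n)
      (X (br z e`_a) * X e`_b * X (br e`_a e`_b) +
       X e`_a * X e`_b * X (br (br z e`_a) e`_b)) +
     \sum_(a < n) \sum_(b < n)
      (X e`_a * X (br z e`_b) * X (br e`_a e`_b) +
       X e`_a * X e`_b * X (br e`_a (br z e`_b)))).
    rewrite -big_split; apply: eq_bigr => a _ /=.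
    rewrite (lin_sum (LlinE z)) -big_split; apply: eq_bigr => b _ /=.
    rewrite !LM !ncl_X (br_derivation br_lie z) (linD xlin) mulrDl mulrDr.
    by rewrite addrACA.
  rewrite [X in X + _]exchange_big /= !big1 ?addr0// => a _; rewrite big_split /=.
    apply: (casimir_invariant ip_inner e_basis ip_inv
      (b := fun b c => X e`_a * X b * X (br e`_a c))) => t c x x'.
      by rewrite xlin mulrDr mulrDl -pzscalerAr -pzscalerAl.
    by rewrite brr xlin mulrDr pzscalerAr.
  apply: (casimir_invariant ip_inner e_basis ip_inv
    (b := fun b c => X b * X e`_a * X (br c e`_a))) => t c x x'.
    by rewrite xlin !mulrDl -!pzscalerAl.
  by rewrite brl xlin mulrDr pzscalerAr.
- by move=> t a x x'; rewrite xlin mulrDl pzscalerAl.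
- by move=> t a x x'; rewrite ulin mulrDr pzscalerAr.
Qed.

Lemma dirac_odd : eps D = - D.
Proof.
rewrite /dirac (linD elin) (lin_sum elin) opprD; congr (_ + _).
  by rewrite -sumrN; apply: eq_bigr => r _; rewrite eM ncweil_par_x ncweil_par_u mulNr.
rewrite ncgammaE (linN elin) (linZ elin) (lin_sum elin); congr (- _).
rewrite -scalerN -sumrN; congr (_ *: _); apply: eq_bigr => a _; rewrite (lin_sum elin) -sumrN.
by apply: eq_bigr => b _; rewrite !eM !ncweil_par_x mulrNN mulrN.
Qed.

Lemma ncx_dirac y : ad eps (X y) D = ncl y.
Proof.
rewrite (ad_oddE _ (ncweil_par_x _ _ _)) dirac_odd mulNr opprK /dirac mulrDr mulrDl addrACA.
congr (_ + _).
  rewrite mulr_sumr mulr_suml -big_split -[RHS](X_expand ulin).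
  apply: eq_bigr => r _ /=.
  by rewrite -[X e`_r * u _ * _]mulrA ncux !mulrA -mulrDl ncx_ip -pzscalerAl mul1r.
rewrite ncgammaE mulrN mulNr -opprD -pzscalerAl -pzscalerAr -scalerDr /ncgx.
set S := \sum_(r < n) X e`_r * X (br y e`_r).
(* Passing [X y] through a cubic word leaves one contraction per factor; by antisymmetry and
   invariance each of the three sums to [S]. Hence the 1/6 of gamma becomes the 1/2 of [ncgx]. *)
suff -> : X y * (\sum_(a < n) \sum_(b < n) X e`_a * X e`_b * X (br e`_a e`_b)) +
   (\sum_(a < n) \sum_(b < n) X e`_a * X e`_b * X (br e`_a e`_b)) * X y = 3 *: S.
  rewrite scalerA; congr (- (_ *: _)).
  by lra.
transitivity (\sum_(a < n) \sum_(b < n) (ip y e`_a *: (X e`_b * X (br e`_a e`_b)) -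
  ip y e`_b *: (X e`_a * X (br e`_a e`_b)) + ip (br e`_a e`_b) y *: (X e`_a * X e`_b))).
  rewrite mulr_sumr mulr_suml -big_split; apply: eq_bigr => a _ /=.
  rewrite mulr_sumr mulr_suml -big_split; apply: eq_bigr => b _ /=.
  move: (X (br e`_a e`_b)) (XXC (br e`_a e`_b) y) => Z ZC.
  rewrite -[X in _ + X]mulrA ZC mulrBr -pzscalerAr mulr1.
  rewrite 2!mulrA (XXC y e`_a) mulrBl mulrBl -!pzscalerAl mul1r.
  rewrite -[X e`_a * X y * X e`_b]mulrA (XXC y e`_b) mulrBr mulrBl -pzscalerAr mulr1 -pzscalerAl.
  by rewrite opprB !mulrA !addrA [LHS](ACl (1*3*4*(2*5)))%AC /= subrr addr0.
have sumD (V : lmodType R) (h k l : 'I_n -> 'I_n -> V) :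
    \sum_a \sum_b (h a b - k a b + l a b) =
    \sum_b \sum_a h a b - \sum_a \sum_b k a b + \sum_a \sum_b l a b.
  rewrite exchange_big /= [X in _ - X]exchange_big [X in _ + X]exchange_big /=.
  rewrite -sumrB -big_split; apply: eq_bigr => b _ /=.
  by rewrite -sumrB -big_split.
rewrite sumD scaler_nat !mulrS mulr0n addr0 addrA; congr (_ + _ + _).
- apply: eq_bigr => b _; apply: (X_expand (h := fun x => X e`_b * X (br x e`_b))).
  by move=> a x x'; rewrite brl xlin mulrDr pzscalerAr.
- rewrite -sumrN; apply: eq_bigr => a _.
  rewrite (X_expand (h := fun x => X e`_a * X (br e`_a x))); last first.
    by move=> t x x'; rewrite brr xlin mulrDr pzscalerAr.
  by rewrite (br_antisym br_lie) (linN xlin) mulrN opprK.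
- apply: eq_bigr => a _.
  have lh : linear (fun x => X e`_a * X x).
    by move=> t x x'; rewrite xlin mulrDr pzscalerAr.
  rewrite -[RHS](X_expand lh); apply: eq_bigr => b _; congr (_ *: _).
  have /eqP := ip_inv e`_b y e`_a; rewrite addr_eq0 => /eqP ->.
  by rewrite ipC (br_antisym br_lie y) [RHS]ipC (linN (ipl _)) ipC.
Qed.

Let odd_D : eps D = (-1) ^+ true *: D. Proof. by rewrite expr1 scaleN1r dirac_odd. Qed.
Let even_l y : eps (ncl y) = (-1) ^+ false *: ncl y.
Proof. by rewrite scale1r ncl_even. Qed.
Let odd_x y : eps (X y) = (-1) ^+ true *: X y.
Proof. by rewrite expr1 scaleN1r ncweil_par_x. Qed.

(* [D, D] commutes with x_y because [x_y, D] = u_y + g_y commutes with D; it also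
   commutes with u_y + g_y, hence with all generators. *)
Lemma dirac_central z : ad eps (ad eps D D) z = 0.
Proof.
set C := ad eps D D.
have adD y : ad eps (ncl y) C = 0.
  have := ad_opcomm P (even_l y) odd_D D.
  rewrite /opcomm scale1r ncl_dirac (lin0 (ad_linr P _)) subr0 => ->.
  by rewrite (lin0 (ad_linl P _)).
have Cx y : ad eps (X y) C = 0.
  have := ad_opcomm P (odd_x y) odd_D D.
  rewrite /opcomm /= expr1 scaleN1r opprK ncx_dirac ncl_dirac.
  have -> : ad eps D (ncl y) = 0.
    have := ncl_dirac y; rewrite (ad_evenE _ (ncl_even y)) (ad_oddE _ dirac_odd).
    by rewrite ncl_even => /eqP; rewrite subr_eq0 => /eqP ->; rewrite subrr.
  by rewrite addr0.
have eC : eps C = C.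
  by rewrite /C (ad_oddE _ dirac_odd) dirac_odd (linB elin) !eM (linN elin) dirac_odd !mulrNN.
clearbody C; rewrite (ad_evenE _ eC); apply/eqP; rewrite subr_eq0; apply/eqP.
have comm_x y : C * X y = X y * C.
  have := Cx y; rewrite (ad_oddE _ (ncweil_par_x _ _ _)) eC => /eqP.
  by rewrite subr_eq0 => /eqP.
have comm_g y : C * ncgx y = ncgx y * C.
  rewrite /ncgx mulrN mulNr -pzscalerAr -pzscalerAl mulr_sumr mulr_suml.
  congr (- (_ *: _)); apply: eq_bigr => r _.
  by rewrite mulrA comm_x -mulrA comm_x mulrA.
elim/ncweil_ind: z => [|||y|y].
- split=> [|a x y /= Cx' Cy]; first by rewrite /= mulr0 mul0r.
  by rewrite mulrDr mulrDl -pzscalerAr -pzscalerAl Cx' Cy.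
- by rewrite mulr1 mul1r.
- by move=> z t Cz Ct; rewrite mulrA Cz -mulrA Ct mulrA.
- have := adD y; rewrite (ad_evenE _ (ncl_even y)) mulrDl mulrDr -comm_g.
  by rewrite opprD addrACA subrr addr0 => /eqP; rewrite subr_eq0 => /eqP ->.
- exact: comm_x.
Qed.

Lemma dirac_X y : ad eps D (X y) = ncl y.
Proof.
rewrite -ncx_dirac (ad_oddE _ dirac_odd) (ad_oddE _ (ncweil_par_x _ _ _)).
by rewrite dirac_odd ncweil_par_x !mulNr !opprK addrC.
Qed.

(** Only the part [x_a u_a] of the Dirac element contributes: gamma lies in the Clifford factor,
    which commutes with [u y]. *)
Lemma dirac_u y : ad eps D (u y) = \sum_(a < n) X e`_a * u (br e`_a y).
Proof.
rewrite (ad_oddE _ dirac_odd) ncweil_par_u mulrDl mulrDr opprD addrACA.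
rewrite [X in _ + X](_ : _ = 0) ?addr0.
  rewrite mulr_suml mulr_sumr -sumrB; apply: eq_bigr => a _.
  by rewrite mulrA ncux -!mulrA -mulrBr ncu_br.
apply/eqP; rewrite subr_eq0 ncgammaE mulNr mulrN -pzscalerAl -pzscalerAr.
apply/eqP; congr (- (_ *: _)); rewrite mulr_suml mulr_sumr; apply: eq_bigr => a _.
rewrite mulr_suml mulr_sumr; apply: eq_bigr => b _.
by rewrite -!mulrA -ncux !mulrA; congr (_ * _); rewrite -!mulrA -ncux !mulrA ncux.
Qed.

Local Notation ops := (ncweil_ops br ip e).

Lemma ncweil_lieE a : lie ops a = ad eps (ncl e`_a).
Proof. by rewrite /ncl -ncgxE. Qed.

Lemma ncweil_gda : is_gda f ops.
Proof.
split; rewrite -/(@ncweil_par R g br ip).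
- exact: P.
- by move=> a; exact: (ad_derivation P (odd_x _)).
- by move=> a; rewrite ncweil_lieE; exact: (ad_derivation P (even_l _)).
- exact: (ad_derivation P odd_D).
- move=> a b x; rewrite ncweil_lieE (ad_opcomm P (even_l _) (odd_x _)) ncl_X.
  rewrite (struct_const_expand br ip_inner e_basis (h := fun y => ad eps (X y) x))//.
  by move=> t y z; rewrite xlin ad_linl.
- move=> a b x; rewrite !ncweil_lieE (ad_opcomm P (even_l _) (even_l _)) ncl_l.
  rewrite (struct_const_expand br ip_inner e_basis (h := fun y => ad eps (ncl y) x)).
    by apply: eq_bigr => c _; rewrite ncweil_lieE.
  by move=> t y z; rewrite ncl_lin ad_linl.
- move=> a x; rewrite ncweil_lieE (ad_opcomm P (odd_x _) odd_D) ncx_dirac//.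
- move=> a b x; rewrite (ad_opcomm P (odd_x _) (odd_x _)).
  rewrite (ad_oddE _ (ncweil_par_x _ _ _)) ncweil_par_x mulNr opprK ncx_ip.
  rewrite (linZ (ad_linl P x)) ad_evenE ?mulr1 ?mul1r ?subrr ?scaler0//.
  by case: P => _ [].
- move=> a x; rewrite ncweil_lieE (ad_opcomm P (even_l _) odd_D) ncl_dirac.
  exact: (lin0 (ad_linl P x)).
- by move=> x; rewrite (ad_opcomm P odd_D odd_D) dirac_central.
Qed.

Lemma ncx_ad_x y z : ad eps (X y) (X z) = ip y z *: (1 : N).
Proof. by rewrite (ad_oddE _ (ncweil_par_x _ _ _)) ncweil_par_x mulNr opprK ncx_ip. Qed.

Lemma ncx_ad_u y z : ad eps (X y) (u z) = 0.
Proof. by rewrite (ad_oddE _ (ncweil_par_x _ _ _)) ncweil_par_u ncux subrr. Qed.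

Lemma ncgx_filt y : F 2%N (ncgx y).
Proof.
apply: (submodN (filt_submod F 2%N)); apply: (submodZ (filt_submod F 2%N)).
apply: (submod_sum (filt_submod F 2%N)) => r _.
exact: (@filt_mul _ _ F 1 1 _ _ (ncx_filt _) (ncx_filt _)).
Qed.

Lemma ncl_filt y : F 2%N (ncl y).
Proof. exact: (submodD (filt_submod F 2%N) (ncu_filt _) (ncgx_filt y)). Qed.

Lemma ncweil_filtered_gda : is_filtered_gda f F ops.
Proof.
have [_ Pi Pl Pd _ _ _ _ _ _] := ncweil_gda.
split; first exact: ncweil_gda.
- exact: ncweil_par_deg.
- move=> k _ [b Fb ->]; have lin := hom_lin (ncweil_par_hom br ip).
  rewrite (gr_op_symb lin (@ncweil_par_deg _ _ br ip) Fb) addr0 -symbZ//.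
  have FeP := @ncweil_par_deg _ _ br ip k b Fb; rewrite addr0 in FeP.
  apply: symb_eq => //; first exact: filtZ.
  exact: ncweil_par_gr.
- move=> a; apply: ncweil_derivation_deg (Pi a) _ _ => x.
    by rewrite [Defs.iota _ _ _]ncx_ad_u; exact: (submod0 (filt_fext_submod F _)).
  by rewrite [Defs.iota _ _ _]ncx_ad_x; apply: (filtZ (F := F)); apply: (filt_1 F).
- move=> a; apply: ncweil_derivation_deg (Pl a) _ _ => x; rewrite ncweil_lieE addr0.
    by rewrite ncl_u; apply: ncu_filt.
  by rewrite ncl_X; apply: ncx_filt.
- apply: ncweil_derivation_deg Pd _ _ => x.
    rewrite [diff _ _]dirac_u; apply: (submod_sum (filt_submod F 3%N)) => a _.
    exact: (@filt_mul _ _ F 1 2 _ _ (ncx_filt _) (ncu_filt _)).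
  by rewrite [diff _ _]dirac_X; apply: ncl_filt.
Qed.

End NcWeilOperators.

(** * The Poincare-Birkhoff-Witt theorem *)

Section EndomorphismAlgebra.
Variables (R : comPzRingType) (V : lmodType R).

Definition lin_endo : Type := {h : V -> V | linear h}.
Implicit Types h k : lin_endo.

Lemma lin_endo0 : linear ((fun=> 0) : V -> V).
Proof. by move=> a x y; rewrite scaler0 addr0. Qed.
Lemma lin_endo1 : linear (id : V -> V). Proof. by []. Qed.
Lemma lin_endoD h k : linear (fun x => sval h x + sval k x).
Proof. by move=> a x y; rewrite (svalP h) (svalP k) scalerDr addrACA. Qed.
Lemma lin_endoM h k : linear (fun x => sval h (sval k x)).
Proof. by move=> a x y; rewrite (svalP k) (svalP h). Qed.
Lemma lin_endoZ (c : R) h : linear (fun x => c *: sval h x).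
Proof. by move=> a x y; rewrite (svalP h) scalerDr !scalerA mulrC. Qed.

(** Quotienting by pointwise equality disregards the proofs of linearity, so endomorphisms are
    compared by their values alone. *)
Definition endo_setoidAlg : setoidAlg R.
Proof.
refine (@SetoidAlg R lin_endo (fun h k => sval h =1 sval k)
  (exist _ _ lin_endo0) (exist _ _ lin_endo1)
  (fun h k => exist _ _ (lin_endoD h k)) (fun h => exist _ _ (lin_endoZ (-1) h))
  (fun h k => exist _ _ (lin_endoM h k)) (fun a h => exist _ _ (lin_endoZ a h))
  _ _ _ _ _ _ _ _ _ _ _ _ _ _ _ _ _ _ _ _ _ _) => /=.
- by [].
- by move=> s t h x.
- by move=> t s v h k x; rewrite h.
- by move=> s s' t t' h k x; rewrite h k.
- by move=> s s' h x; rewrite h.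
- by move=> s s' t t' h k x; rewrite k h.
- by move=> a s s' h x; rewrite h.
- by move=> s t v x; rewrite addrA.
- by move=> s t x; rewrite addrC.
- by move=> s x; rewrite add0r.
- by move=> s x; rewrite scaleN1r addNr.
- by [].
- by [].
- by [].
- by [].
- by move=> s t v x; rewrite (linD (svalP s)).
- by move=> a b s x; rewrite scalerA.
- by move=> s x; rewrite scale1r.
- by move=> a s t x; rewrite scalerDr.
- by move=> a b s x; rewrite scalerDl.
- by [].
- by move=> a s t x; rewrite (linZ (svalP s)).
Defined.

Definition endo : pzAlgType R := sa_quotAlg endo_setoidAlg.

Definition mkendo (h : V -> V) (lh : linear h) : endo :=
  sa_pi (exist _ h lh : sa_sort endo_setoidAlg).
Definition endo_app (z : endo) : V -> V := sval (sa_repr z : lin_endo).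

Lemma mkendoE (m : V -> V) (lm : linear m) x : endo_app (mkendo lm) x = m x.
Proof. exact: (@sa_repr_pi R endo_setoidAlg (exist _ m lm)). Qed.
Lemma endo_app_linr z : linear (endo_app z). Proof. exact: (svalP (sa_repr z : lin_endo)). Qed.
Lemma endo_app1 x : endo_app 1 x = x.
Proof. exact: (@sa_repr_pi R endo_setoidAlg (sa1 endo_setoidAlg)). Qed.
Lemma endo_appM z t x : endo_app (z * t) x = endo_app z (endo_app t x).
Proof. exact: (@sa_repr_pi R endo_setoidAlg (saM _ _)). Qed.
Lemma endo_appD z t x : endo_app (z + t) x = endo_app z x + endo_app t x.
Proof. exact: (@sa_repr_pi R endo_setoidAlg (saD _ _)). Qed.
Lemma endo_appZ a z x : endo_app (a *: z) x = a *: endo_app z x.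
Proof. exact: (@sa_repr_pi R endo_setoidAlg (saZ _ _)). Qed.
Lemma endo_app_linl x : linear (endo_app^~ x).
Proof. by move=> a z t; rewrite endo_appD endo_appZ. Qed.
Lemma endo_eqP z t : endo_app z =1 endo_app t -> z = t.
Proof. by move=> zt; rewrite -(sa_reprK z) -(sa_reprK t); apply/sa_piP. Qed.

End EndomorphismAlgebra.

(* Since D_a t_b = delta_ab at the point, D_(a_1) ... D_(a_k) pairs with
   t_(b_1) ... t_(b_k) by a permanent of Kronecker symbols, and every product of
   fewer than k derivatives kills t_(b_1) ... t_(b_k) at the point. *)
Section Jets.
Variables (R : realFieldType) (P : comAlgType R) (n : nat).
Variables (ev : P -> R) (D : 'I_n -> P -> P) (t : 'I_n -> P).
Hypotheses (ev_lin : scalar ev) (evM : forall p q, ev (p * q) = ev p * ev q).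
Hypothesis ev1 : ev 1 = 1.
Hypothesis D_lin : forall a, linear (D a).
Hypothesis DM : forall a p q, D a (p * q) = D a p * q + p * D a q.
Hypothesis ev_t : forall a, ev (t a) = 0.
Hypothesis ev_Dt : forall a b, ev (D a (t b)) = (a == b)%:R.
Implicit Types (p q : P) (s w : seq 'I_n).

(* [ipow k] is the k-th power of the maximal ideal of the point. *)
Fixpoint ipow (k : nat) : set P :=
  if k is k'.+1 then span [set z | exists m q, [/\ ev m = 0, ipow k' q & z = m * q]]
  else setT.

Lemma ipow_submod k : submod (ipow k).
Proof. by case: k => // k; apply: span_submod. Qed.

Lemma ipowS k m q : ev m = 0 -> ipow k q -> ipow k.+1 (m * q).
Proof. by move=> m0 Iq; apply: mem_span; exists m, q. Qed.

Lemma ipow_ideal k p q : ipow k p -> ipow k (q * p).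
Proof.
have lq x : linear (fun p => x * p) by move=> a y z; rewrite mulrDr scalerAr.
elim: k p q => // k IH p q Ip.
apply: (Ip [set p | ipow k.+1 (q * p)]) => [|_ [m [r [m0 Ir ->]]]] /=.
  exact: (submod_preim (lq q) (ipow_submod k.+1)).
by rewrite mulrCA; apply: ipowS => //; apply: IH.
Qed.

Lemma ev_ipow k p : ipow k.+1 p -> ev p = 0.
Proof.
move=> Ip; apply: (Ip [set p | ev p = 0]) => [|_ [m [r [m0 _ ->]]]] /=.
  have lev : linear (ev : P -> R^o) by exact: ev_lin.
  split=> [|a x y /= x0 y0]; first exact: (lin0 lev).
  by rewrite lev x0 y0 scaler0 addr0.
by rewrite evM m0 mul0r.
Qed.

(** By the Leibniz rule a derivation lowers the order of vanishing at the point by at most one. *)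
Lemma D_ipow k a p : ipow k.+1 p -> ipow k (D a p).
Proof.
elim: k p => // k IH p Ip.
apply: (Ip [set p | ipow k.+1 (D a p)]) => [|_ [m [r [m0 Ir ->]]]] /=.
  exact: (submod_preim (D_lin a) (ipow_submod k.+1)).
rewrite DM; apply: (submodD (ipow_submod k.+1)); first exact: ipow_ideal.
by apply: ipowS => //; apply: IH.
Qed.

Definition tword s : P := \prod_(a <- s) t a.
Definition Dword w p : P := foldr D p w.

Lemma Dword_lin w : linear (Dword w).
Proof. by move=> c x y; elim: w => //= a w ->; rewrite D_lin. Qed.

Lemma tword_ipow s : ipow (size s) (tword s).
Proof.
elim: s => //= a s IH; rewrite /tword big_cons; exact: ipowS.
Qed.

Lemma Dword_ipow w k p : ipow (size w + k) p -> ipow k (Dword w p).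
Proof.
elim: w k p => [//|a w IH] k p; rewrite [size _]/= addSnnS => Ip.
by apply: D_ipow; apply: IH.
Qed.

(** In the Leibniz expansion each [D a (t b)] may be replaced by its value at the point: the
    difference vanishes there, and this raises the order of the corresponding term by one. *)
Lemma D_tword a s : ipow (size s) (D a (tword s) - (count_mem a s)%:R *: tword (rem a s)).
Proof.
elim: s => [|b s IH].
  rewrite /tword big_nil scale0r subr0 //=.
rewrite {1}/tword big_cons DM -/(tword s) /=.
have e1 : ev (D a (t b) - (b == a)%:R *: 1) = 0.
  have lev : linear (ev : P -> R^o) by exact: ev_lin.
  by rewrite (linB lev) (linZ lev) ev_Dt ev1 eq_sym [_ *: _]mulr1 subrr.
have e2 : (count_mem a s)%:R *: tword (if b == a then s else b :: rem a s) =
    t b * ((count_mem a s)%:R *: tword (rem a s)).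
  rewrite -scalerAr; case: eqP => [->|_]; last by rewrite /tword big_cons.
  have [/perm_to_rem as_|/count_memPn -> //] := boolP (a \in s); last by rewrite !scale0r.
  by rewrite /tword (perm_big _ as_) big_cons.
rewrite natrD scalerDl e2.
have -> : (b == a)%:R *: tword (if b == a then s else b :: rem a s) =
    (b == a)%:R *: 1 * tword s.
  by case: eqP => _; rewrite ?scale0r ?scale1r ?mul0r ?mul1r.
rewrite opprD addrACA -mulrBl -mulrBr.
apply: (submodD (ipow_submod (size s).+1)); apply: ipowS => //.
exact: tword_ipow.
Qed.

(** When [w] rearranges [s], the value is the product of the factorials of the multiplicities of the
    letters. Only its positivity is recorded, which in characteristic 0 makes it nonzero. *)
Lemma Dword_tword w s : size w = size s ->
  exists2 c : nat, (0 < c)%N & ev (Dword w (tword s)) = if perm_eq w s then c%:R else 0.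
Proof.
have lev : linear (ev : P -> R^o) by exact: ev_lin.
elim/last_ind: w s => [|w a IH] s.
  by move=> /esym/size0nil ->; exists 1%N => //=; rewrite /tword big_nil ev1.
rewrite size_rcons => sz.
have -> : ev (Dword (rcons w a) (tword s)) =
    (count_mem a s)%:R * ev (Dword w (tword (rem a s))).
  rewrite /Dword foldr_rcons -/(Dword w _); apply/eqP; rewrite -subr_eq0.
  rewrite -[_ * _](linZ lev) -(linZ (Dword_lin w)) -(linB lev) -(linB (Dword_lin w)).
  (* The error term of [D_tword] has order [size s], one more than the number of derivatives in [w],
     so it still vanishes at the point after all of them. *)
  apply/eqP; apply: (@ev_ipow 0); apply: Dword_ipow.
  by rewrite addn1 sz; apply: D_tword.
have [as_|nas] := boolP (a \in s); last first.
  exists 1%N => //; rewrite (count_memPn nas) mul0r.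
  case: ifP => // /perm_mem/(_ a); rewrite mem_rcons inE eqxx => /esym h.
  by rewrite h in nas.
have [|c c0 ->] := IH (rem a s); first by rewrite size_rem// -sz.
exists (count_mem a s * c)%N.
  by rewrite muln_gt0 c0 andbT -has_count has_pred1.
have -> : perm_eq (rcons w a) s = perm_eq w (rem a s).
  rewrite perm_rcons; have := perm_to_rem as_ => /permPr ->.
  by rewrite perm_cons.
by case: ifP; rewrite ?mulr0// natrM.
Qed.

End Jets.

(** * The Jordan-Wigner representation, tensored with a representation of g *)

Section Fock.
Variables (R : realFieldType) (n : nat).
Implicit Types (a b : 'I_n) (I J : {set 'I_n}) (w : seq 'I_n).

(** Symmetric difference with {a}: creation or annihilation of the a-th mode on the basis of R^(2^n)
    indexed by subsets. *)
Definition flip a I : {set 'I_n} := if a \in I then (I :\ a)%SET else (a |: I)%SET.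

Lemma in_flip a b I : (b \in flip a I) = if b == a then a \notin I else b \in I.
Proof.
rewrite /flip; case: ifP => aI; rewrite !inE; case: eqP => [->|//]; by rewrite ?aI.
Qed.

Lemma flipK a : involutive (flip a).
Proof.
by move=> I; apply/setP => b; rewrite !in_flip eqxx; case: eqP => [->|//]; rewrite negbK.
Qed.

Lemma flipC a b I : flip a (flip b I) = flip b (flip a I).
Proof.
have [->//|ab] := eqVneq a b; apply/setP => c; rewrite !in_flip.
rewrite (negPf ab) [b == a]eq_sym (negPf ab).
case: (eqVneq c a) => [ca|_]; case: (eqVneq c b) => [cb|_] //.
by rewrite -ca -cb eqxx in ab.
Qed.

Lemma card_flip a I : (#|flip a I| <= #|I|.+1)%N.
Proof.
rewrite /flip; case: ifP => aI; first by rewrite (cardsD1 a I) aI ltnW// ltnW.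
by rewrite cardsU1 aI.
Qed.

Lemma foldr_flip w : uniq w -> foldr flip finset.set0 w = [set a in w]%SET.
Proof.
elim: w => [_|a w IH] /=; first by apply/setP => b; rewrite !inE.
case/andP=> aw uw; rewrite IH//; apply/setP => b; rewrite in_flip !inE.
by case: eqP => [->|].
Qed.

(* The Jordan-Wigner sign, and creation/annihilation weights making the square
   of the a-th operator equal to 1/2. *)
Definition jw_sign a I : R := \prod_(b < n | (b < a)%N) (-1) ^+ (b \in I).
Definition jw_coef a I : R := jw_sign a I * (if a \in I then 1 else 2^-1).

Lemma jw_sign_flip a b I : jw_sign b (flip a I) =
  (if (a < b)%N then -1 else 1) * jw_sign b I.
Proof.
rewrite /jw_sign; case: ifP => ab.
  rewrite (bigD1 a) //= [in RHS](bigD1 a)//= in_flip eqxx mulrA; congr (_ * _).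
    by case: (a \in I); rewrite /= ?expr0 ?expr1 ?mulr1 ?mulrNN ?mulr1.
  by apply: eq_bigr => c /andP[_ ca]; rewrite in_flip (negPf ca).
rewrite mul1r; apply: eq_bigr => c cb; rewrite in_flip; case: eqP => // ca.
by rewrite -ca cb in ab.
Qed.

Lemma jw_sign_sq a I : jw_sign a I * jw_sign a I = 1.
Proof.
rewrite /jw_sign -big_split big1//= => b _.
by case: (_ \in _); rewrite ?expr0 ?expr1 ?mulr1 ?mulrNN ?mulr1.
Qed.

Lemma jw_coef_neq0 a I : jw_coef a I != 0.
Proof.
rewrite mulf_eq0 negb_or; apply/andP; split; last by case: ifP; rewrite ?oner_eq0 ?invr_eq0 ?pnatr_eq0.
apply/eqP => s0; have := jw_sign_sq a I; rewrite s0 mul0r => /eqP.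
by rewrite eq_sym oner_eq0.
Qed.

(** The sign of the larger index sees the flip of the smaller one, but not conversely, so the two
    orders of application differ by exactly one sign. *)
Lemma jw_anticomm a b I : a != b ->
  jw_coef a I * jw_coef b (flip a I) + jw_coef b I * jw_coef a (flip b I) = 0.
Proof.
move=> ab; rewrite /jw_coef !jw_sign_flip !in_flip [b == a]eq_sym (negPf ab).
move: (if a \in I then _ else _) (if b \in I then _ else _) => x y.
by case: (ltngtP a b) => [_|_|/val_inj/eqP]; [ring | ring | rewrite (negPf ab)].
Qed.

Lemma jw_square a I : jw_coef a I * jw_coef a (flip a I) = 2^-1.
Proof.
rewrite /jw_coef jw_sign_flip ltnn mul1r mulrACA jw_sign_sq mul1r in_flip eqxx.
by case: (a \in I); rewrite ?mulr1 ?mul1r.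
Qed.

Variables (g : vectType R) (br : g -> g -> g) (ip : g -> g -> R) (e : n.-tuple g).
Hypotheses (ip_inner : is_inner_product ip) (e_basis : is_orthonormal_basis ip e).
Variables (P : comAlgType R) (D : g -> P -> P).
Hypotheses (D_linl : forall p, linear (D^~ p)) (D_linr : forall x, linear (D x)).
Hypothesis DC : forall x y p, D x (D y p) - D y (D x p) = D (br x y) p.

Definition fock : Type := {ffun {set 'I_n} -> P}.
HB.instance Definition _ := GRing.Lmodule.on fock.
Implicit Type m : fock.

Definition jw_op a m : fock := [ffun I => jw_coef a I *: m (flip a I)].
Definition fock_x (x : g) m : fock := \sum_(a < n) ip e`_a x *: jw_op a m.
Definition fock_u (x : g) m : fock := [ffun I => D x (m I)].

Lemma fock_addE m m' I : (m + m') I = m I + m' I. Proof. by rewrite ffunE. Qed.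
Lemma fock_scaleE c m I : (c *: m) I = c *: m I. Proof. by rewrite ffunE. Qed.

Lemma jw_op_lin a : linear (jw_op a).
Proof.
move=> c m m'; apply/ffunP => I; rewrite fock_addE fock_scaleE !ffunE.
by rewrite scalerDr !scalerA mulrC.
Qed.

Lemma fock_x_linr x : linear (fock_x x).
Proof.
move=> c m m'; rewrite /fock_x scaler_sumr -big_split; apply: eq_bigr => a _ /=.
by rewrite jw_op_lin scalerDr !scalerA mulrC.
Qed.

Lemma fock_x_linl m : linear (fock_x^~ m).
Proof.
move=> c x y; rewrite /fock_x scaler_sumr -big_split; apply: eq_bigr => a _ /=.
by rewrite (ip_linear ip_inner) scalerDl scalerA.
Qed.

Lemma fock_x_e a m : fock_x e`_a m = jw_op a m.
Proof.
rewrite /fock_x (bigD1 a)//= big1 ?addr0 => [|b ba].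
  by rewrite (proj2 e_basis) eqxx scale1r.
by rewrite (proj2 e_basis) (negPf ba) scale0r.
Qed.

Lemma fock_u_linr x : linear (fock_u x).
Proof.
move=> c m m'; apply/ffunP => I; rewrite fock_addE fock_scaleE !ffunE.
by rewrite D_linr.
Qed.

Lemma fock_u_linl m : linear (fock_u^~ m).
Proof.
by move=> c x y; apply/ffunP => I; rewrite fock_addE fock_scaleE !ffunE D_linl.
Qed.

Lemma fock_u_jw x a m : fock_u x (jw_op a m) = jw_op a (fock_u x m).
Proof. by apply/ffunP => I; rewrite !ffunE (linZ (D_linr x)). Qed.

Lemma fock_u_x x y m : fock_u x (fock_x y m) = fock_x y (fock_u x m).
Proof.
rewrite /fock_x (lin_sum (fock_u_linr x)); apply: eq_bigr => a _.
by rewrite (linZ (fock_u_linr x)) fock_u_jw.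
Qed.

Lemma jw_op_anticomm a b m : jw_op a (jw_op b m) + jw_op b (jw_op a m) = (a == b)%:R *: m.
Proof.
apply/ffunP => I; rewrite fock_addE fock_scaleE !ffunE !scalerA.
case: eqVneq => [->|ab].
  have half2 : 2^-1 + 2^-1 = 1 :> R by lra.
  by rewrite flipK jw_square -scalerDl half2.
by rewrite (flipC b a) -scalerDl jw_anticomm // !scale0r.
Qed.

Lemma fock_x_ip x y m : fock_x x (fock_x y m) + fock_x y (fock_x x m) = ip x y *: m.
Proof.
have E x' y' : fock_x x' (fock_x y' m) = \sum_(a < n) \sum_(b < n)
    ip e`_a x' *: (ip e`_b y' *: jw_op a (jw_op b m)).
  rewrite /fock_x; apply: eq_bigr => a _; rewrite -scaler_sumr (lin_sum (jw_op_lin a)).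
  by congr (_ *: _); apply: eq_bigr => b _; rewrite (linZ (jw_op_lin a)).
rewrite E E [X in _ + X]exchange_big -big_split /=.
transitivity (\sum_(a < n) ip e`_a x *: (ip e`_a y *: m)).
  apply: eq_bigr => a _; rewrite -big_split (bigD1 a)//= big1 ?addr0.
    by rewrite !scalerA [ip _ y * _]mulrC -scalerDr jw_op_anticomm eqxx scale1r.
  move=> b ba; rewrite !scalerA [ip _ y * _]mulrC -scalerDr jw_op_anticomm.
  by rewrite eq_sym (negPf ba) scale0r scaler0.
rewrite (lin_expand ip_inner e_basis (ip_linear ip_inner x : linear (ip x : g -> R^o))).
rewrite scaler_suml; apply: eq_bigr => a _; rewrite scalerA (ip_sym ip_inner x).
by rewrite [ip _ y *: _]mulrC.
Qed.

Let ku x : endo fock := mkendo (fock_u_linr x).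
Let kx x : endo fock := mkendo (fock_x_linr x).

Lemma fock_u_rel s r : uea_rel br s r -> teval ku s = teval ku r.
Proof.
case=> x y /=; apply: endo_eqP => m.
rewrite endo_appD endo_appZ !endo_appM !mkendoE scaleN1r.
by apply/ffunP => I; rewrite fock_addE !ffunE DC.
Qed.

Lemma fock_x_rel s r : cliff_rel ip s r -> teval kx s = teval kx r.
Proof.
case=> x y /=; apply: endo_eqP => m.
by rewrite endo_appD endo_appZ endo_app1 !endo_appM !mkendoE fock_x_ip.
Qed.

Lemma ku_lin : linear ku.
Proof.
move=> c x y; apply: endo_eqP => m.
by rewrite endo_appD endo_appZ !mkendoE fock_u_linl.
Qed.

Lemma kx_lin : linear kx.
Proof.
move=> c x y; apply: endo_eqP => m.
by rewrite endo_appD endo_appZ !mkendoE fock_x_linl.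
Qed.

Lemma fock_comm (z : uea br) (t : cliff ip) :
  plift ku z * plift kx t = plift kx t * (plift ku z : endo fock).
Proof.
apply: (tlift_comm ku_lin fock_u_rel kx_lin fock_x_rel) => x y.
by apply: endo_eqP => m; rewrite !endo_appM !mkendoE fock_u_x.
Qed.

Definition fock_rep : ncweil br ip -> endo fock := tens_lift (plift ku) (plift kx).

Lemma fock_rep_hom : alg_hom fock_rep.
Proof.
exact: tens_lift_hom (tlift_hom ku_lin fock_u_rel) (tlift_hom kx_lin fock_x_rel) fock_comm.
Qed.

Definition act (z : ncweil br ip) (m : fock) : fock := endo_app (fock_rep z) m.

Lemma act_linl m : linear (act^~ m).
Proof. by move=> c z t; rewrite /act (hom_lin fock_rep_hom) endo_app_linl. Qed.
Lemma act_linr z : linear (act z). Proof. exact: endo_app_linr. Qed.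
Lemma act1 m : act 1 m = m.
Proof. by rewrite /act (hom1 fock_rep_hom) endo_app1. Qed.
Lemma actM z t m : act (z * t) m = act z (act t m).
Proof. by rewrite /act (homM fock_rep_hom) endo_appM. Qed.

Lemma act_u x m : act (ncu br ip x) m = fock_u x m.
Proof.
rewrite /act /fock_rep tens_liftE.
- by rewrite (hom1 (tlift_hom kx_lin fock_x_rel)) mulr1 (tlift_gen ku_lin fock_u_rel) mkendoE.
- exact: tlift_hom ku_lin fock_u_rel.
- exact: tlift_hom kx_lin fock_x_rel.
- exact: fock_comm.
Qed.

Lemma act_x x m : act (ncx br ip x) m = fock_x x m.
Proof.
rewrite /act /fock_rep tens_liftE.
- by rewrite (hom1 (tlift_hom ku_lin fock_u_rel)) mul1r (tlift_gen kx_lin fock_x_rel) mkendoE.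
- exact: tlift_hom ku_lin fock_u_rel.
- exact: tlift_hom kx_lin fock_x_rel.
- exact: fock_comm.
Qed.

Definition fock_delta J (p : P) : fock := [ffun I => if I == J then p else 0].

Lemma jw_op_delta a J p : jw_op a (fock_delta J p) = jw_coef a (flip a J) *: fock_delta (flip a J) p.
Proof.
apply/ffunP => I; rewrite fock_scaleE !ffunE.
rewrite -(inj_eq (can_inj (flipK a))) flipK.
by case: eqP => [->|]; rewrite ?scaler0.
Qed.

Lemma act_xword w p : exists2 c : R, c != 0 &
  act (\prod_(a <- w) ncx br ip e`_a) (fock_delta finset.set0 p) =
  c *: fock_delta (foldr flip finset.set0 w) p.
Proof.
elim: w => [|a w [c c0 IH]]; first by exists 1; rewrite ?oner_eq0// big_nil act1 scale1r.
exists (c * jw_coef a (flip a (foldr flip finset.set0 w))).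
  by rewrite mulf_neq0// jw_coef_neq0.
by rewrite big_cons actM IH (linZ (act_linr _)) act_x fock_x_e jw_op_delta scalerA.
Qed.

Lemma act_uword (w : seq g) m I : act (\prod_(x <- w) ncu br ip x) m I = foldr D (m I) w.
Proof.
elim: w => [|x w IH]; first by rewrite big_nil act1.
by rewrite big_cons actM act_u ffunE IH.
Qed.

(** Each [x] changes a subset by one element, so a word reaches only subsets of at most its length.
    It acts on [P] by scalars, so the components stay in [S]; this is used with [S] a power of the
    maximal ideal of the point. *)
Lemma act_xword_supp (S : set P) p (w : seq g) I : submod S -> S p ->
  S (act (\prod_(x <- w) ncx br ip x) (fock_delta finset.set0 p) I) /\
  ((size w < #|I|)%N -> act (\prod_(x <- w) ncx br ip x) (fock_delta finset.set0 p) I = 0).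
Proof.
move=> sS Sp; elim: w I => [|x w IH] I.
  rewrite big_nil act1 ffunE; case: eqP => [->|_]; first by rewrite cards0.
  by split=> //; exact: (submod0 sS).
rewrite big_cons actM act_x /fock_x.
have E (G : 'I_n -> fock) : (\sum_(a < n) G a) I = \sum_(a < n) G a I.
  by rewrite sum_ffunE.
rewrite E; split.
  apply: (submod_sum sS) => a _; rewrite fock_scaleE ffunE.
  by do 2![apply: (submodZ sS)]; apply: (IH _).1.
move=> /= wI; apply: big1 => a _; rewrite fock_scaleE ffunE (IH _).2 ?scaler0//.
have := card_flip a (flip a I); rewrite flipK => h.
by have := leq_trans wI h; rewrite ltnS.
Qed.

End Fock.

Section LinearInverse.
Variables (R : fieldType) (V W : vectType R) (h : V -> W).

Lemma linear_left_inverse : linear h -> (forall x, h x = 0 -> x = 0) ->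
  exists2 k : W -> V, linear k & cancel h k.
Proof.
move=> lh h0.
pose h' : {linear V -> W} := HB.pack h (GRing.isLinear.Build R V W *:%R h lh).
have inj : lker (linfun h') == 0%VS.
  by apply/lker0P => x y; rewrite !lfunE /= => xy; apply/eqP; rewrite -subr_eq0;
    apply/eqP/h0; rewrite (linB lh) xy subrr.
exists ((linfun h')^-1)%VF; first exact: linearP.
by move=> x; have := lker0_lfunK inj x; rewrite lfunE.
Qed.

Lemma kernel_projection : linear h ->
  exists p : V -> V, [/\ linear p, forall x, h (p x) = 0 & forall x, h x = 0 -> p x = x].
Proof.
move=> lh.
pose h' : {linear V -> W} := HB.pack h (GRing.isLinear.Build R V W *:%R h lh).
have kerE x : (x \in lker (linfun h')) = (h x == 0) by rewrite memv_ker lfunE.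
exists (projv (lker (linfun h'))); split=> [|x|x]; first exact: linearP.
  by apply/eqP; rewrite -kerE memv_proj.
by move=> /eqP; rewrite -kerE; apply: projv_id.
Qed.

End LinearInverse.

(** * Polynomial vector fields representing a Lie algebra *)

Section PolynomialDerivations.
Variables (R : realFieldType) (N : nat).
Implicit Types p q : {mpoly R[N]}.

(** Meant for the defect of a bracket relation between vector fields: it is again a derivation, so
    the relation need only be checked on coordinates. *)
Lemma derivation_eq0 (E : {mpoly R[N]} -> {mpoly R[N]}) : linear E ->
  (forall p q, E (p * q) = E p * q + p * E q) -> (forall i, E 'X_i = 0) ->
  forall p, E p = 0.
Proof.
move=> lE EM EX.
have EM0 p q : E p = 0 -> E q = 0 -> E (p * q) = 0.
  by move=> p0 q0; rewrite EM p0 q0 mul0r mulr0 addr0.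
have E1 : E 1 = 0.
  have := EM 1 1; rewrite !mulr1 mul1r => /(congr1 (fun z => z - E 1)).
  by rewrite subrr addrK.
elim/mpolyind => [|c m p _ _ Ep]; first exact: (lin0 lE).
rewrite lE Ep addr0 mpolyXE_id [E _](_ : _ = 0) ?scaler0//.
apply: (big_ind (fun p => E p = 0)) => // i _.
by elim: (m i) => [|k IH]; rewrite ?expr0// exprS; apply: EM0.
Qed.

Variable V : 'I_N -> {mpoly R[N]}.
Definition vfield p : {mpoly R[N]} := \sum_i V i * p^`M(i).

Lemma vfield_lin : linear vfield.
Proof.
move=> a p q; rewrite /vfield scaler_sumr -big_split; apply: eq_bigr => i _ /=.
by rewrite mderivD mderivZ mulrDr scalerAr.
Qed.

Lemma vfieldM p q : vfield (p * q) = vfield p * q + p * vfield q.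
Proof.
rewrite /vfield mulr_suml mulr_sumr -big_split; apply: eq_bigr => i _ /=.
by rewrite mderivM mulrDr -mulrA [in X in _ + X]mulrCA.
Qed.

Lemma vfieldX i : vfield 'X_i = V i.
Proof.
rewrite /vfield (bigD1 i)//= big1 ?addr0 => [|j ji].
  have -> : (U_(i) = 0 + U_(i))%MM by apply/mnmP => j; rewrite !mnmE.
  by rewrite mderivX !mnmE eqxx scale1r addmK mpolyX0 mulr1.
by rewrite mderivX mnm1E eq_sym (negPf ji) scale0r mulr0.
Qed.

End PolynomialDerivations.

(* A realization of g by vector fields on an affine space, linearly independent
   at some point: g acts on End(g) x g by A |-> A ad(x) on the first factor and
   by translations on the second one. *)
Section VectorFields.
Variables (R : realFieldType) (g : vectType R).
Variables (br : g -> g -> g) (ip : g -> g -> R) (n : nat) (e : n.-tuple g).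
Hypotheses (br_lie : is_lie_bracket br) (ip_inner : is_inner_product ip).
Hypotheses (ip_inv : is_invariant br ip) (e_basis : is_orthonormal_basis ip e).

Let brl := br_linearl br_lie.
Let brr := br_linearr br_lie.
Let ipl x : linear (ip x : g -> R^o) := ip_linear ip_inner x.
Let ipC := ip_sym ip_inner.

Let adm (x : g) (i j : 'I_n) : R := ip e`_i (br x e`_j).

Let adm_lin i j : linear (fun x => adm x i j : R^o).
Proof. by move=> a x y; rewrite /adm brl ipl. Qed.

Let adm_mul x y i j : \sum_k adm x i k * adm y k j = ip e`_i (br x (br y e`_j)).
Proof.
rewrite (lin_expand ip_inner e_basis (h := fun z => ip e`_i (br x z) : R^o)).
  by apply: eq_bigr => k _; rewrite mulrC.
by move=> a z z'; rewrite brr ipl.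
Qed.

Let adm_br x y i j : \sum_k adm x i k * adm y k j - \sum_k adm y i k * adm x k j =
  adm (br x y) i j.
Proof.
by rewrite !adm_mul /adm -(linB (ipl _)) (br_derivation br_lie x y) addrK.
Qed.

Lemma vector_fields_exist :
  exists (P : comAlgType R) (ev : P -> R) (D : g -> P -> P) (t : 'I_n -> P),
  [/\ scalar ev, forall p q, ev (p * q) = ev p * ev q & ev 1 = 1] /\
  [/\ forall p, linear (D^~ p), forall x, linear (D x),
      forall x p q, D x (p * q) = D x p * q + p * D x q &
      forall x y p, D x (D y p) - D y (D x p) = D (br x y) p] /\
  (forall a, ev (t a) = 0) /\ (forall a b : 'I_n, ev (D e`_a (t b)) = (a == b)%:R).
Proof.
(* [pr] is some linear projection onto the center. It enters through the functionals [ip (pr y)],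
   which pair with central elements and hence vanish on brackets by invariance; this makes the
   translations an action. *)
have [pr [prL prZ prK]] : exists p : g -> g,
    [/\ linear p, forall x y, br (p x) y = 0 & forall x, (forall y, br x y = 0) -> p x = x].
  pose h (x : g) : 'M[R^o]_n := \matrix_(i, j) (adm x i j : R^o).
  have lh : linear h by move=> a x y; apply/matrixP => i j; rewrite !mxE adm_lin.
  have h0 x : h x = 0 <-> forall y, br x y = 0.
    split=> [h0 y|b0]; last first.
      by apply/matrixP => i j; rewrite !mxE /adm b0 (lin0 (ipl _)).
    have bj (j : 'I_n) : br x e`_j = 0.
      rewrite (ip_expand ip_inner e_basis (br x _)) big1// => i _.
      by have /matrixP/(_ i j) := h0; rewrite !mxE /adm => ->; rewrite scale0r.
    rewrite (ip_expand ip_inner e_basis y) (lin_sum (brr x)) big1// => j _.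
    by rewrite (linZ (brr x)) bj scaler0.
  have [p [pL p0 pK]] := kernel_projection lh.
  by exists p; split=> // x; [apply/h0 | move=> /h0/pK].
pose T := ('I_n * 'I_n + 'I_n)%type; pose N := #|{: T}|.
(* [L x] is the value of the field of x at the base point [xi], the pair of the identity matrix and
   0. If it vanishes, then ad x = 0, so x is central and is orthogonal to the center, in particular
   to itself. *)
pose L (x : g) : {ffun T -> R^o} :=
  [ffun s : T => match s with inl ij => adm x ij.1 ij.2 | inr i => ip (pr e`_i) x end].
have lL : linear L.
  move=> a x y; apply/ffunP => -[[i j]|i]; rewrite !ffunE.
    by rewrite adm_lin.
  by rewrite ipl.
have L0 x : L x = 0 -> x = 0.
  move=> /ffunP Lx0.
  have bx (j : 'I_n) : br x e`_j = 0.
    rewrite (ip_expand ip_inner e_basis (br x _)) big1// => i _.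
    by have := Lx0 (inl (i, j)); rewrite !ffunE /adm /= => ->; rewrite scale0r.
  have px : pr x = x.
    apply: prK => y; rewrite (ip_expand ip_inner e_basis y) (lin_sum (brr x)) big1// => j _.
    by rewrite (linZ (brr x)) bx scaler0.
  have ipx y : ip (pr y) x = 0.
    rewrite ipC (lin_expand ip_inner e_basis (h := fun y => ip x (pr y) : R^o)).
      rewrite big1// => i _; have := Lx0 (inr i); rewrite !ffunE ipC => ->.
      by rewrite scaler0.
    by move=> a z z'; rewrite prL ipl.
  apply/eqP/negPn/negP => /(ip_pos ip_inner).
  by rewrite -[X in ip X _]px ipx ltxx.
have [Li lLi LK] := linear_left_inverse lL L0.
pose var (s : T) : {mpoly R[N]} := 'X_(enum_rank s).
pose V x (k : 'I_N) : {mpoly R[N]} := match (enum_val k : T) with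
  | inl ij => \sum_l adm x l ij.2 *: var (inl (ij.1, l))
  | inr i => (ip (pr e`_i) x)%:MP end.
pose xi (s : T) : R := if s is inl ij then (ij.1 == ij.2)%:R else 0.
pose ev (p : {mpoly R[N]}) := p.@[fun k => xi (enum_val k)].
pose D x := vfield (V x).
have D_var x (s : T) : D x (var s) = V x (enum_rank s) by rewrite /D vfieldX.
have VE x (s : T) : V x (enum_rank s) = match s with
    inl ij => \sum_l adm x l ij.2 *: var (inl (ij.1, l))
  | inr i => (ip (pr e`_i) x)%:MP end by rewrite /V enum_rankK.
have ev_var (s : T) : ev (var s) = xi s by rewrite /ev mevalXU enum_rankK.
have ev_lin : scalar ev by move=> a p q; rewrite /ev mevalD mevalZ.
have ev_linO : linear (ev : _ -> R^o) by exact: ev_lin.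
(* The matrix of the left inverse [Li] in the given bases. The functions built from it apply [Li] to
   the displacement from the base point, so the field of the a-th basis vector differentiates the
   b-th one to the b-th coordinate of [Li (L _)], which is the Kronecker symbol. *)
pose c (s : T) (b : 'I_n) : R := ip e`_b (Li [ffun s' : T => (s == s')%:R : R^o]).
exists {mpoly R[N]}, ev, D, (fun b : 'I_n => \sum_(s : T) c s b *: (var s - (xi s)%:MP)).
have D_linl p : linear (D^~ p).
  have lV k : linear (V^~ k).
    move=> a x y; rewrite /V; case: (enum_val k) => [[i j]|i] /=.
      rewrite scaler_sumr -big_split; apply: eq_bigr => l _ /=.
      by rewrite adm_lin scalerDl scalerA.
    by rewrite ipl mpolyCD -mul_mpolyC -mpolyCM.
  move=> a x y; rewrite /D /vfield scaler_sumr -big_split; apply: eq_bigr => k _ /=.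
  by rewrite lV mulrDl scalerAl.
have D_linr x : linear (D x) by exact: vfield_lin.
have DM x p q : D x (p * q) = D x p * q + p * D x q by exact: vfieldM.
have DC_var x (a : R) : D x a%:MP = 0.
  by rewrite /D /vfield big1// => k _; rewrite mderivC mulr0.
split; first by split; [exact: ev_lin | move=> p q; exact: mevalM | exact: meval1].
split; last split.
- split=> // x y p; apply/eqP; rewrite -subr_eq0; apply/eqP; move: p.
  apply: derivation_eq0 => [a p q|p q|k].
  + by rewrite !D_linr !scalerBr !opprD (addrACA (a *: _)) [LHS]addrACA.
  + rewrite !DM !(linD (D_linr _)) !DM.
    move: (D x (D y p)) (D x (D y q)) (D y (D x p)) (D y (D x q)) => p1 q1 p2 q2.
    move: (D (br x y) p) (D (br x y) q) (D x p) (D x q) (D y p) (D y q) => p3 q3 p4 q4 p5 q5.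
    by ring.
  + rewrite -(enum_valK k) -/(var _) !D_var !VE; case: (enum_val k) => [[i j]|i] /=.
      (* Multiplication by ad(x) on the right makes [D x'] after [D y'] produce ad(x') ad(y') in
         this order, so commutators of fields match commutators of matrices without a change of
         sign. *)
      have E x' y' : D x' (\sum_l adm y' l j *: var (inl (i, l))) =
          \sum_m (\sum_l adm x' m l * adm y' l j) *: var (inl (i, m)).
        rewrite (lin_sum (D_linr _)).
        under eq_bigr => l _ do rewrite (linZ (D_linr _)) D_var VE scaler_sumr.
        rewrite exchange_big; apply: eq_bigr => m _ /=; rewrite scaler_suml.
        by apply: eq_bigr => l _; rewrite scalerA mulrC.
      rewrite !E -!sumrB big1// => m _.
      by rewrite -!scalerBl adm_br subrr scale0r.
    rewrite !DC_var subrr sub0r; apply/eqP; rewrite oppr_eq0; apply/eqP.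
    have := ip_inv (pr e`_i) y x.
    by rewrite (br_antisym br_lie) prZ oppr0 ipC (lin0 (ipl _)) add0r => ->.
- move=> a; rewrite (lin_sum ev_linO) big1// => s _.
  by rewrite (linZ ev_linO) (linB ev_linO) ev_var /ev mevalC subrr scaler0.
move=> a b.
rewrite (lin_sum (D_linr _)) (lin_sum ev_linO).
transitivity (ip e`_b (Li (L e`_a))); last by rewrite LK (proj2 e_basis) eq_sym.
have -> : L e`_a = \sum_(s : T) L e`_a s *: [ffun s' : T => (s == s')%:R : R^o].
  apply/ffunP => s; rewrite sum_ffunE (bigD1 s)//= big1 ?addr0 => [|s' ss'].
    by rewrite !ffunE eqxx [_ *: _]mulr1.
  by rewrite !ffunE (negPf ss') scaler0.
rewrite (lin_sum lLi) (lin_sum (ipl _)); apply: eq_bigr => s _.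
rewrite (linZ lLi) (linZ (ipl _)) (linZ (D_linr _)) (linB (D_linr _)) (linZ ev_linO).
rewrite DC_var subr0 D_var VE [LHS]mulrC; congr (_ * _).
case: s => [[i j]|i]; rewrite ffunE /=; last by rewrite /ev mevalC.
rewrite (lin_sum ev_linO) (bigD1 i)//= big1 ?addr0 => [|l li].
  by rewrite (linZ ev_linO) ev_var /= eqxx [_ *: _]mulr1.
by rewrite (linZ ev_linO) ev_var /= eq_sym (negPf li) [_ *: _]mulr0.
Qed.

End VectorFields.

Section DualFunctionals.
Variables (R : realFieldType) (g : vectType R).
Variables (br : g -> g -> g) (ip : g -> g -> R) (n : nat) (e : n.-tuple g).
Hypotheses (br_lie : is_lie_bracket br) (ip_inner : is_inner_product ip).
Hypotheses (ip_inv : is_invariant br ip) (e_basis : is_orthonormal_basis ip e).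
Local Notation N := (ncweil br ip).
Local Notation F := (ncweil_filt br ip).

Definition pbw_monomial (s : seq 'I_n) (J : {set 'I_n}) : N :=
  \prod_(a <- s) ncu br ip e`_a * \prod_(a <- enum J) ncx br ip e`_a.

(* The Poincare-Birkhoff-Witt theorem, in the form of functionals dual to the
   monomials of top degree. *)
Lemma pbw_functional (s : seq 'I_n) (J : {set 'I_n}) : exists lam : N -> R,
  [/\ scalar lam,
      forall k z, (k < 2 * size s + #|J|)%N -> F k z -> lam z = 0 &
      forall s' (J' : {set 'I_n}), (2 * size s' + #|J'| = 2 * size s + #|J|)%N ->
        (lam (pbw_monomial s' J') != 0) = perm_eq s' s && (J' == J)].
Proof.
have [P [ev [D [t [[ev_lin evM ev1] [[D_linl D_linr DM DC] [ev_t ev_Dt]]]]]]] :=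
  vector_fields_exist br_lie ip_inner ip_inv e_basis.
pose De (a : 'I_n) := D e`_a.
have De_lin a : linear (De a) by exact: D_linr.
have DeM a p q : De a (p * q) = De a p * q + p * De a q by exact: DM.
have ev_linO : linear (ev : P -> R^o) by exact: ev_lin.
have Ip := @ipow_submod _ P ev.
pose ac := act e D_linr (br := br) (ip := ip).
(* [lam] reads off the component [J] at the point, starting from [tword t s] over the empty set: the
   letters x have to build [J], and the letters u have to differentiate the monomial down to a
   constant. *)
pose vac : fock n P := fock_delta finset.set0 (tword t s).
pose lam z := ev (ac z vac J).
have foldrD_lin (w : seq g) : linear (fun p => foldr D p w).
  by move=> c x y; elim: w => //= x' w ->; rewrite D_linr.
have foldrD (w : seq 'I_n) p : foldr D p [seq e`_a | a : 'I_n <- w] = Dword De w p.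
  by elim: w => //= a w ->.
have D_ip k x p : ipow ev k.+1 p -> ipow ev k (D x p).
  move=> Ipp; rewrite (lin_expand ip_inner e_basis (D_linl p)).
  apply: (submod_sum (Ip k)) => a _; apply: (submodZ (Ip k)).
  exact: (D_ipow De_lin DeM a Ipp).
have foldrD_ip (w : seq g) k p : ipow ev (size w + k) p -> ipow ev k (foldr D p w).
  elim: w k => [//|x w IH] k; rewrite [size _]/= addSnnS => Ipp.
  by apply: D_ip; apply: IH.
exists lam; split.
- move=> c z z'; rewrite /lam /ac (act_linl ip_inner e_basis D_linl D_linr DC).
  by rewrite fock_addE fock_scaleE ev_lin.
- move=> k z kz Fz; have /(_ [set z | lam z = 0]) := ncweil_filt_words Fz; apply.
    split=> [|c x y /= x0 y0]; rewrite /= /lam /ac.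
      by rewrite (lin0 (act_linl ip_inner e_basis D_linl D_linr DC _)) ffunE (lin0 ev_linO).
    rewrite (act_linl ip_inner e_basis D_linl D_linr DC) fock_addE fock_scaleE ev_lin.
    by rewrite [ev _]x0 [ev _]y0 mulr0 addr0.
  move=> _ [wu [wx [wk ->]]] /=; rewrite /lam /ac (actM ip_inner e_basis D_linl D_linr DC).
  rewrite (act_uword ip_inner e_basis D_linl D_linr DC).
  have [Iv v0] := act_xword_supp ip_inner e_basis D_linl D_linr DC wx J
    (Ip (size s)) (tword_ipow ev_t s).
  (* Degree below 2|s| + |J| leaves two cases: fewer than |J| letters x, so the component [J] is not
     reached, or fewer than |s| letters u, so the derivatives of [tword t s] still vanish at the
     point. *)
  have [/v0 ->|lex] := ltnP (size wx) #|J|.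
    by rewrite (lin0 (foldrD_lin _)) (lin0 ev_linO).
  have : (size wu < size s)%N by move: (leq_ltn_trans wk kz); lia.
  move=> /subnKC lt; apply: (ev_ipow ev_lin evM (k := size s - (size wu).+1)).
  by apply: foldrD_ip; rewrite addnS -addSn lt.
move=> s' J' sz; rewrite /lam /ac /pbw_monomial (actM ip_inner e_basis D_linl D_linr DC).
have [c c0 ->] := act_xword ip_inner e_basis D_linl D_linr DC (enum J') (tword t s).
rewrite foldr_flip ?enum_uniq// set_enum (linZ (act_linr e D_linr _)).
rewrite -(big_map (fun a : 'I_n => e`_a) predT (ncu br ip)) fock_scaleE (linZ ev_linO).
rewrite (act_uword ip_inner e_basis D_linl D_linr DC) foldrD ffunE mulf_eq0 (negPf c0) /= (eq_sym J J').
(* The letters of [J'] carry the starting vector into the component [J'] alone. When [J' = J],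
   equality of degrees forces [s'] and [s] to have equal length. *)
case: (eqVneq J' J) => [JJ'|_]; last first.
  by rewrite andbF (lin0 (Dword_lin De_lin _)) (lin0 ev_linO) eqxx.
rewrite andbT.
have ss : size s' = size s by move: sz; rewrite JJ'; lia.
have [k k0 ->] := Dword_tword ev_lin evM ev1 De_lin DeM ev_t ev_Dt ss.
by case: ifP; rewrite ?eqxx// pnatr_eq0 -lt0n.
Qed.

End DualFunctionals.

(** * The symbol isomorphism *)

Section DualSpace.
Variables (R : realFieldType) (g : vectType R) (ip : g -> g -> R) (n : nat) (e : n.-tuple g).
Hypotheses (ip_inner : is_inner_product ip) (e_basis : is_orthonormal_basis ip e).

Definition dual_app (m : dual_space g) (x : g) : R := (m : 'Hom(g, R^o)) x.

Lemma dual_app_linr m : linear (dual_app m : g -> R^o).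
Proof. exact: linearP. Qed.
Lemma dual_app_linl x : linear (dual_app^~ x : dual_space g -> R^o).
Proof. by move=> a m m'; rewrite /dual_app add_lfunE scale_lfunE. Qed.
Lemma dual_eqP m m' : dual_app m =1 dual_app m' -> m = m'.
Proof. by move=> mm; apply/lfunP. Qed.

Lemma flatE x y : dual_app (flat ip x) y = ip x y.
Proof.
pose h : {linear g -> R^o} :=
  HB.pack (ip x : g -> R^o) (GRing.isLinear.Build R g R^o *:%R _ (ip_linear ip_inner x)).
exact: (lfunE h).
Qed.

Lemma dual_basisE (a : 'I_n) x : dual_app (dual_basis e a) x = ip e`_a x.
Proof.
have lc : linear (coord e a : g -> R^o) by move=> c y z; rewrite linearP.
pose h : {linear g -> R^o} :=
  HB.pack (coord e a : g -> R^o) (GRing.isLinear.Build R g R^o *:%R _ lc).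
by rewrite -(coord_ip ip_inner e_basis); exact: (lfunE h).
Qed.

Lemma dual_expand m : m = \sum_(a < n) dual_app m e`_a *: dual_basis e a.
Proof.
apply: dual_eqP => x; rewrite (lin_sum (dual_app_linl x)).
rewrite (lin_expand ip_inner e_basis (dual_app_linr m)); apply: eq_bigr => a _.
by rewrite (linZ (dual_app_linl x)) dual_basisE [LHS]mulrC.
Qed.

Definition sharp (m : dual_space g) : g := \sum_(a < n) dual_app m e`_a *: e`_a.

Lemma sharp_lin : linear sharp.
Proof.
move=> a m m'; rewrite /sharp scaler_sumr -big_split; apply: eq_bigr => b _ /=.
by rewrite (dual_app_linl _) scalerDl scalerA.
Qed.

Lemma flatK : cancel (flat ip) sharp.
Proof.
move=> x; rewrite /sharp [RHS](ip_expand ip_inner e_basis); apply: eq_bigr => a _.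
by rewrite flatE (ip_sym ip_inner).
Qed.

Lemma flat_e (a : 'I_n) : flat ip e`_a = dual_basis e a.
Proof. by apply: dual_eqP => x; rewrite flatE dual_basisE. Qed.

Lemma sharp_dual_basis (a : 'I_n) : sharp (dual_basis e a) = e`_a.
Proof. by rewrite -flat_e flatK. Qed.

End DualSpace.

(** * Monomials spanning the Weil algebra *)

Section WeilMonomials.
Variables (R : realFieldType) (g : vectType R) (ip : g -> g -> R) (n : nat) (e : n.-tuple g).
Hypotheses (ip_inner : is_inner_product ip) (e_basis : is_orthonormal_basis ip e).
Local Notation V := (dual_space g).

Definition leI : rel 'I_n := fun a b => (a <= b)%N.
Lemma leI_trans : transitive leI. Proof. by move=> a b c; apply: leq_trans. Qed.
Lemma leI_anti : antisymmetric leI.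
Proof. by move=> a b /anti_leq/val_inj. Qed.
Lemma leI_total : total leI. Proof. by move=> a b; apply: leq_total. Qed.

Lemma symalg_span (z : symalg V) : span [set z | exists2 s : seq 'I_n, sorted leI s &
  z = \prod_(a <- s) tgen (@sym_rel R V) (dual_basis e a)] z.
Proof.
have := tquot_words (Q := @sym_rel R V) (dual_expand ip_inner e_basis) z.
apply: span_mono => _ [w ->]; exists (sort leI w); first exact: sort_sorted leI_total _.
have comm (a b : 'I_n) : tgen (@sym_rel R V) (dual_basis e a) * tgen _ (dual_basis e b) =
    1 *: (tgen _ (dual_basis e b) * tgen _ (dual_basis e a)).
  by rewrite scale1r; exact: (tgen_rel (SymRel _ _)).
have [k ->] := perm_prod_scalar comm (w := w) (w' := sort leI w)
  ltac:(by rewrite perm_sym perm_sort).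
by rewrite expr1n scale1r.
Qed.

(** A word without repetition is, up to sign, the enumeration of its support; in a word with a
    repetition two equal letters can be made adjacent, and their product is 0. *)
Lemma extalg_span (z : extalg V) : span [set z | exists J : {set 'I_n},
  z = \prod_(a <- enum J) tgen (@ext_rel R V) (dual_basis e a)] z.
Proof.
have := tquot_words (Q := @ext_rel R V) (dual_expand ip_inner e_basis) z.
apply: span_min => [|{}z [w ->]]; first exact: span_submod.
have sq x : tgen (@ext_rel R V) x * tgen _ x = 0 by exact: (tgen_rel (ExtRel x)).
have comm (a b : 'I_n) : tgen (@ext_rel R V) (dual_basis e a) * tgen _ (dual_basis e b) =
    (-1) *: (tgen _ (dual_basis e b) * tgen _ (dual_basis e a)).
  have := sq (dual_basis e a + dual_basis e b).
  rewrite (linD (@tgen_lin _ _ _)) mulrDl !mulrDr !sq add0r addr0 => /eqP.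
  by rewrite addr_eq0 scaleN1r => /eqP.
have [uw|nuw] := boolP (uniq w).
  have pw : perm_eq w (enum [set a in w]%SET).
    by apply: uniq_perm => //; rewrite ?enum_uniq// => a; rewrite mem_enum inE.
  have [k ->] := perm_prod_scalar comm pw.
  by apply: (submodZ (span_submod _)); apply: mem_span; exists [set a in w]%SET.
suff [a [w' pw]] : exists a w', perm_eq w [:: a, a & w'].
  have [k ->] := perm_prod_scalar comm pw.
  rewrite !big_cons mulrA sq mul0r scaler0; exact: (submod0 (span_submod _)).
elim: w nuw => //= a w IH; rewrite negb_and negbK => /orP[aw|/IH [b [w' pw]]].
  by exists a, (rem a w); rewrite perm_cons perm_to_rem.
exists b, (a :: w'); rewrite -(perm_cons a) in pw; apply: perm_trans pw _.
by apply/permPl; exact: (perm_catCA [:: a] [:: b; b] w').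
Qed.

(** Sorted sequences stand for multisets: for them the permutation criterion of [pbw_functional]
    becomes equality of indices. *)
Definition weil_index := ({s : seq 'I_n | sorted leI s} * {set 'I_n})%type.

Definition weil_monomial (j : weil_index) : weil g :=
  tens (\prod_(a <- val j.1) tgen (@sym_rel R V) (dual_basis e a))
       (\prod_(a <- enum j.2) tgen (@ext_rel R V) (dual_basis e a)).

Lemma weil_span (z : weil g) : span [set weil_monomial j | j in setT] z.
Proof.
have := tens_span symalg_span extalg_span z.
apply: span_mono => _ [_ [_ [[s ss ->] [J ->] ->]]].
by exists (exist _ s ss, J).
Qed.

End WeilMonomials.

(** * The symbol map from the Weil algebra and its bijectivity *)

Section SymbolMap.
Variables (R : realFieldType) (g : vectType R).
Variables (br : g -> g -> g) (ip : g -> g -> R) (n : nat) (e : n.-tuple g).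
Hypotheses (br_lie : is_lie_bracket br) (ip_inner : is_inner_product ip).
Hypotheses (ip_inv : is_invariant br ip) (e_basis : is_orthonormal_basis ip e).
Local Notation N := (ncweil br ip).
Local Notation u := (ncu br ip).
Local Notation X := (ncx br ip).
Local Notation eps := (@ncweil_par R g br ip).
Local Notation F := (ncweil_filt br ip).
Local Notation f := (struct_const br e).
Local Notation ops := (ncweil_ops br ip e).
Local Notation U2 x := (symb F 2 (u x)).
Local Notation X1 x := (symb F 1 (X x)).

Let uF x : F 2%N (u x) := ncu_filt x.
Let xF x : F 1%N (X x) := ncx_filt x.

Lemma U2_lin : linear (fun x => U2 x).
Proof. by move=> a x y; rewrite ncu_lin symb_lin. Qed.
Lemma X1_lin : linear (fun x => X1 x).
Proof. by move=> a x y; rewrite ncx_lin symb_lin. Qed.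

(** The commutator [u (br x y)] has filtration degree 2, hence dies in degree 4. *)
Lemma U2_comm x y : U2 x * U2 y = U2 y * U2 x.
Proof.
rewrite !symbM//; apply: symb_eq; [exact: filt_mul | exact: filt_mul |].
by rewrite ncu_br filtpE; apply: (@filt_incr _ _ F).
Qed.

(** By the Clifford relation the square is a scalar, of filtration degree 0, hence dies in degree
    2. *)
Lemma X1_sq x : X1 x * X1 x = 0.
Proof.
rewrite symbM//; apply/symb_filtp; first exact: filt_mul.
rewrite filtpE -[X x * X x]halfD ncx_ip; do 2!apply: (submodZ (filt_submod F 1%N)).
exact: (@filt_incr _ _ F 0%N _ (filt_1 F)).
Qed.

Lemma UX_comm x y : U2 x * X1 y = X1 y * U2 x.
Proof. by rewrite !symbM// ncux. Qed.

Lemma U2_word (w : seq g) : \prod_(x <- w) U2 x = symb F (2 * size w) (\prod_(x <- w) u x) /\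
  F (2 * size w)%N (\prod_(x <- w) u x).
Proof.
elim: w => [|x w [IH Fw]]; first by rewrite !big_nil muln0 symb1; split=> //; exact: (filt_1 F).
rewrite !big_cons [size _]/= mulnS IH symbM//; split=> //.
exact: (@filt_mul _ _ F 2 _ _ _ (uF x) Fw).
Qed.

Lemma X1_word (w : seq g) : \prod_(x <- w) X1 x = symb F (size w) (\prod_(x <- w) X x) /\
  F (size w) (\prod_(x <- w) X x).
Proof.
elim: w => [|x w [IH Fw]]; first by rewrite !big_nil symb1; split=> //; exact: (filt_1 F).
rewrite !big_cons [size _]/= -add1n IH symbM//; split=> //.
exact: (@filt_mul _ _ F 1 _ _ _ (xF x) Fw).
Qed.

Let kv (m : dual_space g) : gr F := U2 (sharp e m).
Let ky (m : dual_space g) : gr F := X1 (sharp e m).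

Let kv_lin : linear kv.
Proof. by move=> a m m'; rewrite /kv sharp_lin U2_lin. Qed.
Let ky_lin : linear ky.
Proof. by move=> a m m'; rewrite /ky sharp_lin X1_lin. Qed.

Let kv_rel s t : @sym_rel R (dual_space g) s t -> teval kv s = teval kv t.
Proof. by case=> m m' /=; apply: U2_comm. Qed.
Let ky_rel s t : @ext_rel R (dual_space g) s t -> teval ky s = teval ky t.
Proof. by case=> m /=; apply: X1_sq. Qed.

Let kvy_comm := tlift_comm kv_lin kv_rel ky_lin ky_rel (fun m m' => UX_comm _ _).

Definition symbol_map : weil g -> gr F := tens_lift (plift kv) (plift ky).
Local Notation psi := symbol_map.

Lemma symbol_map_hom : alg_hom psi.
Proof. exact: tens_lift_hom (tlift_hom kv_lin kv_rel) (tlift_hom ky_lin ky_rel) kvy_comm. Qed.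

Lemma symbol_mapE a b : psi (tens a b) = plift kv a * plift ky b.
Proof. exact: tens_liftE (tlift_hom kv_lin kv_rel) (tlift_hom ky_lin ky_rel) kvy_comm _ _. Qed.

Lemma symbol_map_v m : psi (weilv m) = U2 (sharp e m).
Proof.
by rewrite symbol_mapE (hom1 (tlift_hom ky_lin ky_rel)) mulr1 (tlift_gen kv_lin kv_rel).
Qed.
Lemma symbol_map_y m : psi (weily m) = X1 (sharp e m).
Proof.
by rewrite symbol_mapE (hom1 (tlift_hom kv_lin kv_rel)) mul1r (tlift_gen ky_lin ky_rel).
Qed.

Lemma symbol_map_words (w w' : seq (dual_space g)) :
  psi (tens (\prod_(m <- w) tgen (@sym_rel R _) m) (\prod_(m <- w') tgen (@ext_rel R _) m)) =
  symb F (2 * size w + size w')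
    (\prod_(x <- map (sharp e) w) u x * \prod_(x <- map (sharp e) w') X x) /\
  F (2 * size w + size w')%N
    (\prod_(x <- map (sharp e) w) u x * \prod_(x <- map (sharp e) w') X x).
Proof.
have [uE uw] := U2_word (map (sharp e) w); have [xE xw] := X1_word (map (sharp e) w').
rewrite !size_map in uE uw xE xw.
rewrite symbol_mapE (hom_prod (tlift_hom kv_lin kv_rel)) (hom_prod (tlift_hom ky_lin ky_rel)).
under eq_bigr => m _ do rewrite (tlift_gen kv_lin kv_rel).
under [X in _ * X]eq_bigr => m _ do rewrite (tlift_gen ky_lin ky_rel).
split; last exact: (@filt_mul _ _ F _ _ _ _ uw xw).
rewrite -(big_map (sharp e) predT (fun x => U2 x)) -(big_map (sharp e) predT (fun x => X1 x)).
by rewrite uE xE symbM.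
Qed.

Lemma symbol_map_deg k z : weil_deg k z -> gr_deg F k (psi z).
Proof.
move=> Wz; apply: (Wz [set z | gr_deg F k (psi z)]).
  exact: (submod_preim (hom_lin symbol_map_hom) (gr_deg_submod F k)).
move=> _ [j [m [a [b [<- Da Db ->]]]]] /=.
have Wab := tens_span2 Da Db; apply: (Wab [set z | gr_deg F (j + 2 * m) (psi z)]).
  exact: (submod_preim (hom_lin symbol_map_hom) (gr_deg_submod F _)).
move=> _ [_ [_ [[w <- ->] [w' <- ->] ->]]] /=.
have [-> Fw] := symbol_map_words w w'; rewrite addnC.
by eexists; [exact: Fw|].
Qed.

Lemma symbol_map_onto_deg k x : gr_deg F k x -> exists2 z, weil_deg k z & psi z = x.
Proof.
have lpsi := hom_lin symbol_map_hom.
move=> [b Fb ->].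
have sub : submod (F k `&` [set b | exists2 z, weil_deg k z & psi z = symb F k b]).
  split=> [|a x1 x2 [F1 [z1 w1 e1]] [F2 [z2 w2 e2]]].
    split; first exact: filt0.
    exists 0; first exact: (submod0 (span_submod _)).
    by rewrite (lin0 lpsi) symb0.
  split; first exact: filtZD.
  exists (a *: z1 + z2); first by apply: (proj2 (span_submod _)).
  by rewrite lpsi e1 e2 symb_lin.
have [|_ [z wz ez]] := ncweil_filt_words Fb sub; last by exists z.
move=> _ [wu [wx [wk ->]]].
have [_ Fu] := U2_word wu; have [_ Fx] := X1_word wx.
have Fw := filt_mul Fu Fx.
have mono l m : (l <= m)%N -> F l `<=` F m by exact: ncweil_part_mono.
split; first exact: mono wk _ Fw.
(* A word of exact degree k is the image of the same word in the Weil generators; a shorter word has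
   zero symbol in degree k and is lifted to 0. *)
move: wk; rewrite leq_eqVlt => /orP[/eqP <-|wk].
  exists (tens (\prod_(m <- map (flat ip) wu) tgen (@sym_rel R _) m)
               (\prod_(m <- map (flat ip) wx) tgen (@ext_rel R _) m)).
    apply: mem_span; exists (size wx), (size wu).
    eexists; eexists; split; [by rewrite addnC | | | by []].
      by apply: mem_span; exists (map (flat ip) wu); rewrite ?size_map.
    by apply: mem_span; exists (map (flat ip) wx); rewrite ?size_map.
  have [-> _] := symbol_map_words (map (flat ip) wu) (map (flat ip) wx).
  by rewrite !size_map !(mapK (flatK ip_inner e_basis)).
exists 0; first exact: (submod0 (span_submod _)).
rewrite [psi _](lin0 lpsi); apply/esym/symb_filtp; first exact: mono (ltnW wk) _ Fw.
by rewrite filtpE; case: (k) wk => // l wk; exact: (mono _ l wk _ Fw).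
Qed.

Lemma symbol_map_onto x : exists z, psi z = x.
Proof.
have lpsi := hom_lin symbol_map_hom.
have [N ->] := gr_sum x.
apply: (big_ind (fun x => exists z, psi z = x)) => [|_ _ [z <-] [z' <-]|k _].
- by exists 0; rewrite (lin0 lpsi).
- by exists (z + z'); rewrite (linD lpsi).
have [|z _ <-] := @symbol_map_onto_deg k (symb F k (grc x k)); last by exists z.
by exists (grc x k) => //; apply: grcF.
Qed.

Lemma symbol_map_monomial (j : weil_index n) :
  psi (weil_monomial e j) = symb F (2 * size (val j.1) + #|j.2|) (pbw_monomial br ip e (val j.1) j.2)
  /\ F (2 * size (val j.1) + #|j.2|)%N (pbw_monomial br ip e (val j.1) j.2).
Proof.
have E := symbol_map_words [seq dual_basis e a | a : 'I_n <- val j.1]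
  [seq dual_basis e a | a : 'I_n <- enum j.2].
rewrite !size_map !big_map -cardE in E.
have sE (w : seq 'I_n) (A : pzAlgType R) (h : g -> A) :
    \prod_(a <- w) h (sharp e (dual_basis e a)) = \prod_(a <- w) h e`_a.
  by apply: eq_bigr => a _; rewrite (sharp_dual_basis ip_inner e_basis).
by rewrite !sE in E.
Qed.

(** A PBW functional vanishes on the filtration step below its degree, so it is well defined on that
    component of [gr F]. Together these functionals are biorthogonal to the images of the Weil
    monomials. *)
Lemma symbol_map_inj : injective psi.
Proof.
pose dg (j : weil_index n) := (2 * size (val j.1) + #|j.2|)%N.
have [lam lamP] := choice (fun j : weil_index n =>
  pbw_functional br_lie ip_inner ip_inv e_basis (val j.1) j.2).
have llam j : linear (lam j : N -> R^o) by case: (lamP j).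
have lam_filtp j z : filtp F (dg j) z -> lam j z = 0.
  have [_ l0 _] := lamP j; rewrite filtpE; case ej: (dg j) => [|k].
    by move=> ->; exact: (lin0 (llam j)).
  by apply: l0; rewrite -[X in (_ < X)%N]/(dg j) ej.
have lam_eq j z t : filtp F (dg j) (z - t) -> lam j z = lam j t.
  by move=> /lam_filtp; rewrite (linB (llam j)) => /eqP; rewrite subr_eq0 => /eqP.
have lamE i j : (lam i (grc (psi (weil_monomial e j)) (dg i)) != 0) = (i == j).
  have [-> Fj] := symbol_map_monomial j.
  rewrite (lam_eq _ _ _ (grc_symb (dg i) Fj)) /rees_single.
  have [dij|dij] := eqVneq (dg i) (2 * size (val j.1) + #|j.2|)%N; last first.
    rewrite (lin0 (llam i)) eqxx; apply/esym/negbTE/eqP => ij.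
    by rewrite ij eqxx in dij.
  have [_ _ ->] := lamP i; last by rewrite -dij.
  case: i dij => -[s ss] J; case: j {Fj} => -[s' ss'] J' /= _.
  rewrite -pair_eqE /= (eq_sym J'); congr (_ && _); rewrite -val_eqE /=.
  apply/idP/eqP => [ps|->//].
  by apply: (sorted_eq (@leI_trans n) (@leI_anti n)) => //; rewrite perm_sym.
apply: (biorthogonal_inj (b := weil_monomial e) (lam := fun j x => lam j (grc x (dg j)))).
- exact: (hom_lin symbol_map_hom).
- move=> j a x y; have [lj _ _] := lamP j.
  by rewrite (lam_eq _ _ _ (grc_lin a x y (dg j))) lj.
- exact: weil_span ip_inner e_basis.
- by move=> j; apply: mulIf; rewrite lamE.
- by move=> i j ij; apply/eqP; rewrite -[_ == _]negbK lamE.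
Qed.

End SymbolMap.

(** * Transport of the graded operators to the Weil algebra *)

Section WeilParity.
Variables (R : realFieldType) (g : vectType R).
Local Notation V := (dual_space g).

Lemma weil_hom_eq (A : pzAlgType R) (h k : weil g -> A) : alg_hom h -> alg_hom k ->
  (forall m, h (weilv m) = k (weilv m)) -> (forall m, h (weily m) = k (weily m)) -> h =1 k.
Proof.
move=> hh hk hkv hky; apply: presented_eq => // -[a b]; rewrite -/(tens a b) tensE.
rewrite (homM hh) (homM hk); congr (_ * _).
  move: a; apply: (presented_eq (alg_hom_comp hh (inl_hom _ _)) (alg_hom_comp hk (inl_hom _ _))).
  exact: hkv.
move: b; apply: (presented_eq (alg_hom_comp hh (inr_hom _ _)) (alg_hom_comp hk (inr_hom _ _))).
exact: hky.
Qed.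

Let opp_lin : linear (fun x : V => - tgen (@ext_rel R V) x).
Proof. by move=> a x y; rewrite tgen_lin opprD scalerN. Qed.
Let opp_rel s t : @ext_rel R V s t -> teval (fun x => - tgen (@ext_rel R V) x) s =
  teval (fun x => - tgen (@ext_rel R V) x) t.
Proof. by case=> x /=; rewrite mulrNN; exact: (tgen_rel (ExtRel x)). Qed.

Lemma weil_parE : @weil_par R g = tens_lift (fun a => tens a 1) (fun b => tens 1 (extalg_par b)).
Proof.
by rewrite /weil_par /tens_lift; congr plift; apply/funext => z; rewrite tensE.
Qed.

Let ext_hom : alg_hom (fun b : extalg V => tens (1 : symalg V) (extalg_par b)) :=
  alg_hom_comp (inr_hom _ _) (tlift_hom opp_lin opp_rel).

Lemma weil_par_hom : alg_hom (@weil_par R g).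
Proof.
by rewrite weil_parE; apply: (tens_lift_hom (inl_hom _ _) ext_hom) => a b; apply: tens_comm.
Qed.

Lemma weil_par_tens a b : @weil_par R g (tens a b) = tens a (extalg_par b).
Proof.
by rewrite weil_parE (tens_liftE (inl_hom _ _) ext_hom) -?tensE//; move=> ? ?; apply: tens_comm.
Qed.

Lemma weil_par_v m : @weil_par R g (weilv m) = weilv m.
Proof. by rewrite weil_par_tens [extalg_par 1](hom1 (tlift_hom opp_lin opp_rel)). Qed.

Lemma weil_par_y m : @weil_par R g (weily m) = - weily m.
Proof.
by rewrite weil_par_tens [extalg_par _](tlift_gen opp_lin opp_rel) (linN (@tens_linr _ _ _ 1)).
Qed.

End WeilParity.

Section Isomorphism.
Variables (R : realFieldType) (g : vectType R).
Variables (br : g -> g -> g) (ip : g -> g -> R) (n : nat) (e : n.-tuple g).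
Hypotheses (br_lie : is_lie_bracket br) (ip_inner : is_inner_product ip).
Hypotheses (ip_inv : is_invariant br ip) (e_basis : is_orthonormal_basis ip e).
Local Notation N := (ncweil br ip).
Local Notation u := (ncu br ip).
Local Notation X := (ncx br ip).
Local Notation eps := (@ncweil_par R g br ip).
Local Notation F := (ncweil_filt br ip).
Local Notation f := (struct_const br e).
Local Notation ops := (ncweil_ops br ip e).
Local Notation U2 x := (symb F 2 (u x)).
Local Notation X1 x := (symb F 1 (X x)).
Local Notation psi := (@symbol_map R g br ip n e).

Let uF x : F 2%N (u x) := ncu_filt x.
Let xF x : F 1%N (X x) := ncx_filt x.

Let hpsi := symbol_map_hom br ip e.
Let lpsi : linear psi := hom_lin hpsi.
Let psi_inj := symbol_map_inj br_lie ip_inner ip_inv e_basis.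
Let psi_v (a : 'I_n) : psi (weilv (dual_basis e a)) = U2 e`_a.
Proof. by rewrite symbol_map_v (sharp_dual_basis ip_inner e_basis). Qed.
Let psi_y (a : 'I_n) : psi (weily (dual_basis e a)) = X1 e`_a.
Proof. by rewrite symbol_map_y (sharp_dual_basis ip_inner e_basis). Qed.

Let fgda : is_filtered_gda f F ops := ncweil_filtered_gda br_lie ip_inner ip_inv e_basis.

Definition unsymbol (x : gr F) : weil g := sval (cid (symbol_map_onto ip_inner e_basis x)).
Local Notation phi := unsymbol.

Lemma unsymbolK : cancel phi psi.
Proof. by move=> x; rewrite /phi; case: cid. Qed.
Lemma symbol_mapK : cancel psi phi.
Proof. by move=> z; apply: psi_inj; rewrite unsymbolK. Qed.

Lemma symbol_map_par z : psi (weil_par z) = gr_op F 0 eps (psi z).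
Proof.
have [lp mp _] := gr_parity (ncweil_parity br ip) (@ncweil_par_deg R g br ip).
have hp : alg_hom (gr_op F 0 eps) by [].
have le := hom_lin (ncweil_par_hom br ip).
move: z; apply: (weil_hom_eq (alg_hom_comp hpsi (weil_par_hom g)) (alg_hom_comp hp hpsi)) => m.
  rewrite weil_par_v symbol_map_v (gr_op_symb le (@ncweil_par_deg R g br ip) (uF _)).
  by rewrite ncweil_par_u.
rewrite weil_par_y (linN lpsi) symbol_map_y.
rewrite (gr_op_symb le (@ncweil_par_deg R g br ip) (xF _)) addr0 ncweil_par_x.
by rewrite -scaleN1r -[in RHS]scaleN1r /symbz symbZ.
Qed.

(** Conjugates by the symbol map of the operators on [gr F]. Defining them this way makes them
    derivations at once and makes [unsymbol] intertwine them by construction. *)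
Definition weil_ops : gda_ops (weil g) n :=
  {| par := @weil_par R g;
     Defs.iota := fun a z => phi (gr_op F (-1) (Defs.iota ops a) (psi z));
     lie := fun a z => phi (gr_op F 0 (lie ops a) (psi z));
     diff := fun z => phi (gr_op F 1 (diff ops) (psi z)) |}.

Lemma unsymbol_derivation p (D : gr F -> gr F) : is_derivation (gr_op F 0 eps) p D ->
  is_derivation (@weil_par R g) p (fun z => phi (D (psi z))).
Proof.
move=> [lD De DM]; split.
- by move=> a z t; apply: psi_inj; rewrite !lpsi !unsymbolK lD.
- move=> z; apply: psi_inj; rewrite (linZ lpsi) !symbol_map_par !unsymbolK De //.
- move=> z t; apply: psi_inj; rewrite (linD lpsi) !(homM hpsi) !unsymbolK DM.
  by congr (_ + _ * _); case: p {De DM}; rewrite ?symbol_map_par.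
Qed.

Let gda : is_gda f ops. Proof. by case: fgda. Qed.
Let gr_der := ggda_gda (gr_graded_gda fgda).

Let der_lin p (D : N -> N) : is_derivation eps p D -> linear D. Proof. by case. Qed.

(** Invariance of the inner product. With [f_anti] it makes [f] totally antisymmetric, which turns
    the adjoint action on symbols into the coadjoint formulas of the Weil algebra. *)
Let f_cyc (a b c : 'I_n) : f a b c = f b c a.
Proof.
rewrite /struct_const !(coord_ip ip_inner e_basis).
have := ip_inv e`_a e`_c e`_b; rewrite (br_antisym br_lie e`_b e`_a).
have ipl := ip_linear ip_inner; rewrite (ip_sym ip_inner (- _)).
rewrite (linN (ipl e`_c : linear (ip e`_c : g -> R^o))) => /eqP.
by rewrite addrC subr_eq0 => /eqP.
Qed.

Let f_anti (a b c : 'I_n) : f a b c = - f b a c.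
Proof. by rewrite /struct_const (br_antisym br_lie) linearN. Qed.

Lemma weil_opsP : is_weil_ops br e weil_ops.
Proof.
have [iD lD dD] : [/\ forall a, has_degree F (-1) (Defs.iota ops a),
  forall a, has_degree F 0 (lie ops a) & has_degree F 1 (diff ops)] by case: fgda.
have iL a : linear (Defs.iota ops a) := der_lin (gda_iota gda a).
have lL a : linear (lie ops a) := der_lin (gda_lie gda a).
have dL : linear (diff ops) := der_lin (gda_diff gda).
have brE (V : lmodType R) (h : g -> V) : linear h -> forall a c : 'I_n,
    h (br e`_a e`_c) = - \sum_(b < n) f a b c *: h e`_b.
  move=> lh a c; rewrite (struct_const_expand br ip_inner e_basis lh) -sumrN.
  by apply: eq_bigr => b _; rewrite -scaleNr (f_cyc a b c) (f_cyc a c b) f_anti.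
split=> //.
- by move=> a; apply/unsymbol_derivation/(gda_iota gr_der).
- move=> a b; apply: psi_inj; rewrite unsymbolK psi_y.
  rewrite (gr_op_symb (iL a) (iD a) (xF _)) [Defs.iota _ _ _]ncx_ad_x.
  rewrite (proj2 e_basis) [symbz _ _ _](symbZ _ (filt_1 F)) symb1.
  by case: (a == b); rewrite ?scale1r ?scale0r ?(hom1 hpsi) ?(lin0 lpsi).
- move=> a b; apply: psi_inj; rewrite unsymbolK psi_v (lin0 lpsi).
  by rewrite (gr_op_symb (iL a) (iD a) (uF _)) [Defs.iota _ _ _]ncx_ad_u symbz0.
- by move=> a; apply/unsymbol_derivation/(gda_lie gr_der).
- move=> a c; apply: psi_inj; rewrite unsymbolK psi_y.
  rewrite (gr_op_symb (lL a) (lD a) (xF _)) addr0 (ncweil_lieE br ip_inner e_basis).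
  rewrite ncl_X// (linN lpsi) (lin_sum lpsi) /symbz.
  rewrite (brE _ (fun x => X1 x)); last exact: X1_lin.
  by congr (- _); apply: eq_bigr => b _; rewrite (linZ lpsi) psi_y.
- move=> a c; apply: psi_inj; rewrite unsymbolK psi_v.
  rewrite (gr_op_symb (lL a) (lD a) (uF _)) addr0 (ncweil_lieE br ip_inner e_basis).
  rewrite ncl_u// (linN lpsi) (lin_sum lpsi) /symbz.
  rewrite (brE _ (fun x => U2 x)); last exact: U2_lin.
  by congr (- _); apply: eq_bigr => b _; rewrite (linZ lpsi) psi_v.
- exact/unsymbol_derivation/(gda_diff gr_der).
- move=> a; apply: psi_inj; rewrite unsymbolK psi_y.
  (* The differential of [x_a] is [u_a + g_a], and both terms have exact weight 2, so [g_a] survives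
     in the symbol and supplies the quadratic part of d y^a. *)
  rewrite (gr_op_symb dL dD (xF _)) [diff _ _]dirac_X//.
  rewrite (linB lpsi) psi_v (linZ lpsi) (lin_sum lpsi).
  rewrite (_ : symbz F _ _ = symb F 2 (u e`_a + ncg br ip e a)); last by rewrite ncgxE.
  have XX (r s : 'I_n) : F 2%N (X e`_r * X e`_s).
    exact: (@filt_mul _ _ F 1 1 _ _ (xF _) (xF _)).
  have XXs (r : 'I_n) (c : 'I_n -> R) : F 2%N (\sum_s c s *: (X e`_r * X e`_s)).
    by apply: (submod_sum (filt_submod F 2%N)) => s _; apply: (submodZ (filt_submod F 2%N)).
  have XXt (c : 'I_n -> 'I_n -> R) : F 2%N (\sum_r \sum_s c r s *: (X e`_r * X e`_s)).
    by apply: (submod_sum (filt_submod F 2%N)) => r _; apply: XXs.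
  have XXa := XXt (fun r s => f a r s).
  rewrite /ncg addrC -scaleN1r symb_lin; [|exact: (submodZ (filt_submod F 2%N))|exact: uF].
  rewrite !scaleN1r addrC (symbZ _ XXa); congr (_ - _ *: _).
  rewrite symb_sum; last by move=> r _; apply: XXs.
  apply: eq_bigr => r _; rewrite (lin_sum lpsi) symb_sum.
    apply: eq_bigr => s _; rewrite (symbZ _ (XX r s)) (linZ lpsi) (homM hpsi) !psi_y (symbM (xF _) (xF _)).
    by rewrite f_cyc.
  by move=> s _; apply: (submodZ (filt_submod F 2%N)).
- move=> a; apply: psi_inj; rewrite unsymbolK psi_v.
  rewrite (gr_op_symb dL dD (uF _)) [diff _ _]dirac_u//.
  have XU x y : F 3%N (X x * u y) by exact: (@filt_mul _ _ F 1 2 _ _ (xF _) (uF _)).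
  rewrite [symbz _ _ _]symb_sum; last by move=> r _; exact: XU.
  rewrite (linN lpsi) (lin_sum lpsi) -sumrN; apply: eq_bigr => j _.
  rewrite (lin_sum lpsi) -sumrN.
  (* Expanding the bracket produces the coefficients [f j a k], which total antisymmetry turns into
     [- f j k a], the sign in d v^a. *)
  rewrite (struct_const_expand br ip_inner e_basis (h := fun x => symb F 3 (X e`_j * u x))).
    apply: eq_bigr => k _; rewrite (linZ lpsi) (homM hpsi) psi_y psi_v (symbM (xF _) (uF _)).
    by rewrite (f_anti j a k) (f_cyc a j k) scaleNr.
  by move=> c x y; rewrite ncu_lin mulrDr -pzscalerAr symb_lin.
Qed.

End Isomorphism.

Section GradedWeilAlgebra.
Variables (R : realFieldType) (g : vectType R).
Variables (br : g -> g -> g) (ip : g -> g -> R) (n : nat) (e : n.-tuple g).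
Hypotheses (br_lie : is_lie_bracket br) (ip_inner : is_inner_product ip).
Hypotheses (ip_inv : is_invariant br ip) (e_basis : is_orthonormal_basis ip e).
Local Notation F := (ncweil_filt br ip).
Local Notation psi := (symbol_map br ip e).
Local Notation phi := (@unsymbol R g br ip n e ip_inner e_basis).

Lemma unsymbol_iso :
  is_gda_iso (gr_deg F) (gr_ops F (ncweil_ops br ip e)) (@weil_deg R g)
    (weil_ops br ip_inner e_basis) phi.
Proof.
have hpsi := symbol_map_hom br ip e.
have psi_inj := symbol_map_inj br_lie ip_inner ip_inv e_basis.
have phiK : cancel phi psi := unsymbolK ip_inner e_basis.
have psiK : cancel psi phi := symbol_mapK br_lie ip_inner ip_inv e_basis.
split.
- by exists psi.
- by move=> a x y; apply: psi_inj; rewrite (hom_lin hpsi) !phiK.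
- by split=> [|x y]; apply: psi_inj; rewrite ?(hom1 hpsi) ?(homM hpsi) !phiK.
- move=> k x; split=> [/(symbol_map_onto_deg ip_inner e_basis)[z wz <-]|wx]; first by rewrite psiK.
  by rewrite -(phiK x); apply: symbol_map_deg.
- by move=> x; apply: psi_inj; rewrite phiK [par _ _]/= symbol_map_par phiK.
- move=> a x; exact: (congr1 (fun y => phi (gr_op F (-1) (Defs.iota (ncweil_ops br ip e) a) y)) (esym (phiK x))).
- move=> a x; exact: (congr1 (fun y => phi (gr_op F 0 (lie (ncweil_ops br ip e) a) y)) (esym (phiK x))).
- move=> x; exact: (congr1 (fun y => phi (gr_op F 1 (diff (ncweil_ops br ip e)) y)) (esym (phiK x))).
Qed.

Lemma unsymbol_gen x : phi (symb F 2 (ncu br ip x)) = weilv (flat ip x) /\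
  phi (symb F 1 (ncx br ip x)) = weily (flat ip x).
Proof.
split; apply: (symbol_map_inj br_lie ip_inner ip_inv e_basis); rewrite unsymbolK.
  by rewrite symbol_map_v (flatK ip_inner e_basis).
by rewrite symbol_map_y (flatK ip_inner e_basis).
Qed.

End GradedWeilAlgebra.

(* The Lie algebras with an invariant inner product are exactly the Lie algebras
   of compact connected Lie groups, and only the Lie algebra of G enters. *)
Theorem theorem3p6 (R : realType) (g : vectType R)
    (br : g -> g -> g) (ip : g -> g -> R) (n : nat) (e : n.-tuple g) :
  is_lie_bracket br -> is_inner_product ip -> is_invariant br ip ->
  is_orthonormal_basis ip e ->
  let f := struct_const br e in
  let F := ncweil_filt br ip in
  is_filtered_gda f F (ncweil_ops br ip e) /\
  is_graded_gda f (gr_deg F) (gr_ops F (ncweil_ops br ip e)) /\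
  exists o : gda_ops (weil g) n,
    is_weil_ops br e o /\
    exists phi : gr F -> weil g,
      is_gda_iso (gr_deg F) (gr_ops F (ncweil_ops br ip e)) (@weil_deg R g) o phi /\
      forall x : g, phi (symb F 2 (ncu br ip x)) = weilv (flat ip x) /\
                    phi (symb F 1 (ncx br ip x)) = weily (flat ip x).
Proof.
move=> br_lie ip_inner ip_inv e_basis f F.
have fgda := ncweil_filtered_gda br_lie ip_inner ip_inv e_basis.
split=> //; split; first exact: gr_graded_gda.
exists (weil_ops br ip_inner e_basis); split; first exact: weil_opsP.
exists (@unsymbol R g br ip n e ip_inner e_basis); split; first exact: unsymbol_iso.
exact: unsymbol_gen.
Qed.
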